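(* Let $p\in\mathbb N_0$ and let $\Phi$ be a locally absolutely square-integrable invariant random complex measure on $\mathbb R^d$. If $\Phi$ is $(2p+d)$-uniform, then $\Phi$ is $p$-rigid. Further, if $\Phi$ is $q$-uniform for all $q\in[-d,\infty)$, in particular if $\Phi$ is $\infty$-uniform, then $\Phi$ is maximally rigid.
   Context: $d\in\mathbb N$, $\mathbb N_0=\{0,1,2,\dots\}$, $B_r=\{x\in\mathbb R^d:\|x\|<r\}$. $(\Omega,\mathcal A,\mathbb P)$ is a probability space with a measurable flow $\{\theta_x:x\in\mathbb R^d\}$ ($\theta_0=\mathrm{id}$, $\theta_{x+y}=\theta_x\theta_y$, $(\omega,x)\mapsto\theta_x\omega$ measurable) preserving $\mathbb P$. A random complex measure $\Phi$ is a random element of the space of complex measures on $\mathbb R^d$ of the form $\mu_1-\mu_2+i(\mu_3-\mu_4)$ with $\mu_j$ locally finite measures ($\sigma$-field generated by evaluations on bounded Borel sets); $|\Phi|$ is its total variation measure and $\Phi(f)=\int f\,d\Phi$. $\Phi$ is invariant if $\Phi(\theta_x\omega,B)=\Phi(\omega,B+x)$ for all $x,\omega$ and bounded Borel $B$, and locally absolutely square-integrable if $\mathbb E[|\Phi|(B_1)^2]<\infty$. With $\hat f(k)=\int e^{-i\langle k,x\rangle}f(x)\,dx$ and $\mathrm{Cov}[X,Y]=\mathbb E[X\overline Y]-\mathbb E[X]\overline{\mathbb E[Y]}$, the Bartlett spectral measure $\hat\beta_\Phi$ of such $\Phi$ is the unique locally finite nonnegative measure on $\mathbb R^d$ with $\mathrm{Cov}[\Phi(f),\Phi(g)]=(2\pi)^{-d}\int\hat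 f\,\overline{\hat g}\,d\hat\beta_\Phi$ for all bounded measurable compactly supported $f,g:\mathbb R^d\to\mathbb C$. For $q\in[-d,\infty)$, $\Phi$ is $q$-uniform if $\varepsilon^{-d}\hat\beta_\Phi(B_\varepsilon)=O(\varepsilon^q)$ as $\varepsilon\to0$. $\Phi$ is $\infty$-uniform if $\hat\beta_\Phi(B_\varepsilon)=0$ for some $\varepsilon>0$. $\Phi$ is $p$-rigid if for every bounded Borel set $B\subseteq\mathbb R^d$ and every $q\in\{0,\dots,p\}$ the (tensor-valued) random variable $\int_B x^{\otimes q}\,\Phi(dx)$ is almost surely equal to a $\sigma(\Phi|_{B^c})$-measurable random variable. $\Phi$ is maximally rigid if for every bounded Borel set $B$ the restriction $\Phi|_B$ is almost surely equal to a $\sigma(\Phi|_{B^c})$-measurable random element. *)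

(* Defs.v *)
From HB Require Import structures.
From mathcomp Require Import all_boot all_order all_algebra.
From mathcomp Require Import all_classical all_reals all_analysis.
From mathcomp Require Export complex.

Set Implicit Arguments.
Unset Strict Implicit.
Unset Printing Implicit Defensive.

Import Order.TTheory GRing.Theory Num.Theory.
Import numFieldNormedType.Exports.

Local Open Scope classical_set_scope.
Local Open Scope ring_scope.

(* 'rV[R]_d carries the sigma-algebra generated by the coordinates (as the
   library does for tuples); it is the Borel sigma-algebra of R^d by
   [measurable_rVE] below. *)
Definition rV_display : measure_display.
Proof. exact: default_measure_display. Qed.

Section measurable_rV.
Context {R : realType} (d : nat).

Definition rV_coord (i : 'I_d) (x : 'rV[R]_d) : R := x ord0 i.

Let rV_set0 : g_sigma_preimage rV_coord set0.
Proof. exact: sigma_algebra0. Qed.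

Let rV_setC A : g_sigma_preimage rV_coord A -> g_sigma_preimage rV_coord (~` A).
Proof. exact: sigma_algebraC. Qed.

Let rV_bigcup (F : (set 'rV[R]_d)^nat) :
  (forall i, g_sigma_preimage rV_coord (F i)) ->
  g_sigma_preimage rV_coord (\bigcup_i (F i)).
Proof. exact: sigma_algebra_bigcup. Qed.

HB.instance Definition _ := @isMeasurable.Build rV_display
  'rV[R]_d (g_sigma_preimage rV_coord) rV_set0 rV_setC rV_bigcup.

Lemma measurable_rV_coord (i : 'I_d) :
  measurable_fun [set: 'rV[R]_d] (rV_coord i).
Proof.
move=> _ Y mY; rewrite setTI; apply: sub_sigma_algebra => /=.
rewrite -bigcup_seq/=; exists i => /=; first by rewrite mem_index_enum.
by exists Y => //; rewrite setTI.
Qed.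

Lemma measurable_fun_rV d1 (T1 : measurableType d1) (f : T1 -> 'rV[R]_d) :
  (forall i, measurable_fun [set: T1] (rV_coord i \o f)) ->
  measurable_fun [set: T1] f.
Proof.
move=> mf _ Y mY; rewrite setTI.
suff : g_sigma_preimage (fun i => rV_coord i \o f) `<=` measurable.
  by apply; rewrite g_sigma_preimage_comp; exists Y => //; rewrite setTI.
apply: smallest_sub; first exact: sigma_algebra_measurable.
rewrite -bigcup_seq => A [i _ [B mB <-]]; exact: mf.
Qed.

End measurable_rV.

Lemma measurable_rVE (R : realType) (d : nat) :
  @measurable _ 'rV[R]_d = <<s [set U | open U] >>.
Proof.
apply/seteqP; split; last first.
  apply: smallest_sub; first exact: sigma_algebra_measurable.
  move=> U oU.
  pose box (q : 'rV[rat]_d * 'rV[rat]_d) : set 'rV[R]_d :=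
    \bigcap_(j in [set: 'I_d]) (rV_coord j @^-1`
       `]ratr (q.1 ord0 j), ratr (q.2 ord0 j)[%classic).
  pose F q := if `[< box q `<=` U >] then box q else set0.
  have -> : U = \bigcup_q F q.
    apply/seteqP; split=> [x Ux|x [q _]]; last first.
      by rewrite /F; case: asboolP => // + ?; exact.
    have [Q Qx QU] : nbhs x U by exact: open_nbhs_nbhs.
    have abP (j : 'I_d) : exists ab : rat * rat,
        ratr ab.1 < x ord0 j < ratr ab.2 /\
        `]ratr ab.1, ratr ab.2[%classic `<=` Q ord0 j.
      have /nbhs_ballP[e /= e0 eQ] := Qx ord0 j.
      have [a] := @rat_in_itvoo R (x ord0 j - e) (x ord0 j) ltac:(by rewrite ltrBlDr ltrDl).
      rewrite in_itv /= => /andP[ea ax].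
      have [b] := @rat_in_itvoo R (x ord0 j) (x ord0 j + e) ltac:(by rewrite ltrDl).
      rewrite in_itv /= => /andP[xb be].
      exists (a, b); rewrite /= ax xb; split => // y /=; rewrite in_itv /=.
      move=> /andP[ay yb]; apply: eQ; rewrite /ball /= ltr_distlC.
      by rewrite (lt_trans ea ay) (lt_trans yb be).
    have [ab abE] := choice abP.
    pose q := (\row_j (ab j).1, \row_j (ab j).2) : 'rV[rat]_d * 'rV[rat]_d.
    exists q => //; rewrite /F asboolT => [j _|y yq].
      by have [xab _] := abE j; rewrite /= in_itv /= !mxE.
    apply: QU => i j; rewrite (ord1 i); have [_] := abE j; apply.
    by have := yq j I; rewrite /= !mxE.
  apply: countable_bigcupT_measurable; first exact: countableP.
  move=> q; rewrite /F; case: ifP => // _.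
  apply: fin_bigcap_measurable => // j _.
  by rewrite -[X in measurable X]setTI; apply: measurable_rV_coord.
apply: smallest_sub; first exact: smallest_sigma_algebra.
rewrite -bigcup_seq => A [i _ [B mB <-]].
have : measurable_fun setT (rV_coord i : g_sigma_algebraType [set U : set 'rV[R]_d | open U] -> R).
  apply: (measurability _ (measurable_realfun.RGenOInfty.measurableE R)) => _ [_ [x ->] <-].
  rewrite setTI; apply: sub_sigma_algebra => /=.
  have := @coord_continuous R 1 d ord0 i.
  by move=> /continuousP; apply; exact: interval_open.
by apply.
Qed.

(* Lebesgue measure on R^d, by recursion on d, as a product measure;
   [lebesgue_rV_box] gives its value on boxes. *)
Section lebesgue_rV.
Context {R : realType}.

Definition cons_rV d (p : measurableTypeR R * 'rV[R]_d) : 'rV[R]_d.+1 :=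
  \row_(j < d.+1) oapp (p.2 ord0) p.1 (unlift ord0 j).

Lemma measurable_cons_rV d : measurable_fun setT (@cons_rV d).
Proof.
apply: measurable_fun_rV => i.
rewrite (_ : _ \o _ = fun p : measurableTypeR R * 'rV[R]_d =>
  oapp (p.2 ord0) p.1 (unlift ord0 i)); last first.
  by apply/funext => p; rewrite /= /rV_coord mxE.
case: (unlift ord0 i) => [j|] /=; last exact: measurable_fst.
apply: (@measurableT_comp _ _ _ _ _ _ (@rV_coord R d j)).
  exact: measurable_rV_coord.
exact: measurable_snd.
Qed.

Section cons_measure.
Context d (mu : {sigma_finite_measure set 'rV[R]_d -> \bar R}).

Definition cons_measure : set 'rV[R]_d.+1 -> \bar R :=
  pushforward (@lebesgue_measure R \x mu)%E (@cons_rV d).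

Let cons_measure0 : cons_measure set0 = 0%E.
Proof. by rewrite /cons_measure /pushforward preimage_set0 measure0. Qed.

Let cons_measure_ge0 A : (0 <= cons_measure A)%E.
Proof. by rewrite /cons_measure /pushforward; exact: measure_ge0. Qed.

Let cons_measure_sigma_additive : semi_sigma_additive cons_measure.
Proof.
have mc := @measurable_cons_rV d.
move=> F mF tF mUF; rewrite /cons_measure /pushforward preimage_bigcup.
apply: measure_semi_sigma_additive.
- by move=> n; rewrite -[X in measurable X]setTI; exact: mc.
- apply/trivIsetP => /= i j _ _ ij; rewrite -preimage_setI.
  by move/trivIsetP : tF => /(_ _ _ _ _ ij) ->//; rewrite preimage_set0.
- by rewrite -preimage_bigcup -[X in measurable X]setTI; exact: mc.
Qed.

HB.instance Definition _ := isMeasure.Build _ _ _ cons_measure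
  cons_measure0 cons_measure_ge0 cons_measure_sigma_additive.

Let uncons_rV (x : 'rV[R]_d.+1) : measurableTypeR R * 'rV[R]_d :=
  (rV_coord ord0 x, \row_j rV_coord (lift ord0 j) x).

Let uncons_rVK : cancel (@cons_rV d) uncons_rV.
Proof.
move=> [a x]; rewrite /uncons_rV /cons_rV /rV_coord mxE unlift_none /=.
by congr (_, _); apply/rowP => j; rewrite !mxE liftK.
Qed.

Let measurable_uncons_rV : measurable_fun setT uncons_rV.
Proof.
apply/measurable_fun_pairP; split; first exact: measurable_rV_coord.
apply: measurable_fun_rV => i.
rewrite (_ : _ \o _ = rV_coord (lift ord0 i)); first exact: measurable_rV_coord.
by apply/funext => x; rewrite /= /rV_coord mxE.
Qed.

Let cons_measure_sigma_finite : sigma_finite setT cons_measure.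
Proof.
have /sigma_finiteP[F [FT ndF Foo]] := sigma_finiteT (@lebesgue_measure R).
have /sigma_finiteP[G [GT ndG Goo]] := sigma_finiteT mu.
exists (fun k => uncons_rV @^-1` (F k `*` G k)).
  rewrite -preimage_bigcup; apply/esym; rewrite -subTset => x _ /=.
  have [n _ Fn] : (\bigcup_k F k) (uncons_rV x).1 by rewrite -FT.
  have [m _ Gm] : (\bigcup_k G k) (uncons_rV x).2 by rewrite -GT.
  exists (maxn n m) => //; split.
  - by move: Fn; exact/subsetPset/ndF/leq_maxl.
  - by move: Gm; exact/subsetPset/ndG/leq_maxr.
move=> k; have [mF Fk] := Foo k; have [mG Gk] := Goo k; split.
  rewrite -[X in measurable X]setTI; apply: measurable_uncons_rV => //.
  exact: measurableX.
rewrite /cons_measure /pushforward -comp_preimage.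
rewrite (_ : _ \o _ = id); last by apply/funext => p; exact: uncons_rVK.
by rewrite preimage_id product_measure1E// lte_mul_pinfty// ge0_fin_numE.
Qed.

HB.instance Definition _ := Measure_isSigmaFinite.Build _ _ _ cons_measure
  cons_measure_sigma_finite.
End cons_measure.

Fixpoint lebesgue_rV d : {sigma_finite_measure set 'rV[R]_d -> \bar R} :=
  match d with
  | 0 => \d_(0 : 'rV[R]_0)
  | d'.+1 => cons_measure (lebesgue_rV d')
  end.

Lemma lebesgue_rV_box d (A : 'I_d -> set (measurableTypeR R)) :
  (forall i, measurable (A i)) ->
  lebesgue_rV d [set x | forall i, A i (x ord0 i)] =
  (\prod_(i < d) lebesgue_measure (A i))%E.
Proof.
elim: d A => [|d IHd] A mA.
  by rewrite big_ord0 /= diracE mem_set// => -[].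
rewrite big_ord_recl -(IHd (fun i => A (lift ord0 i)))//.
rewrite /= /cons_measure /pushforward.
rewrite [X in product_measure1 _ _ X](_ : _ =
    A ord0 `*` [set x : 'rV[R]_d | forall i, A (lift ord0 i) (x ord0 i)]).
  rewrite product_measure1E//.
  rewrite (_ : [set x | _] = \bigcap_(i in [set: 'I_d])
    (rV_coord i @^-1` A (lift ord0 i))); last first.
    by apply/seteqP; split => [x Ax i _|x Ax i]; exact: Ax.
  apply: fin_bigcap_measurable => // i _.
  by rewrite -[X in measurable X]setTI; apply: measurable_rV_coord => //; exact: mA.
apply/seteqP; split => -[a x] /=.
  move=> Aax; split => [|i].
    by have := Aax ord0; rewrite mxE unlift_none.
  by have := Aax (lift ord0 i); rewrite mxE liftK.
move=> [Aa Ax] i; rewrite mxE /=.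
by case: unliftP => [j ->|->].
Qed.
End lebesgue_rV.

HB.instance Definition _ (R : realType) := isPointed.Build R[i] 0.

(* The Borel sigma-algebra of the complex plane, identified with R x R. *)
Definition complex_pair (R : realType) (z : R[i]) : R * R :=
  (complex.Re z, complex.Im z).

HB.instance Definition _ (R : realType) :=
  Measurable.copy R[i] (g_sigma_algebra_preimageType (@complex_pair R)).

Section cintegral.
Context disp (T : measurableType disp) (R : realType).
Variable mu : {measure set T -> \bar R}.
Implicit Types (D : set T) (f : T -> R[i]).

Definition cintegrable D f : Prop :=
  mu.-integrable D (fun x => (complex.Re (f x))%:E) /\
  mu.-integrable D (fun x => (complex.Im (f x))%:E).

Definition cintegral D f : R[i] :=
  Complex (\int[mu]_(x in D) complex.Re (f x))
          (\int[mu]_(x in D) complex.Im (f x)).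

End cintegral.

Section euclidean.
Context {R : realType} {d : nat}.
Implicit Types (x y : 'rV[R]_d) (B : set 'rV[R]_d).

Definition dotp x y : R := \sum_(i < d) x ord0 i * y ord0 i.
Definition enorm x : R := Num.sqrt (dotp x x).
Definition eball (r : R) : set 'rV[R]_d := [set x | enorm x < r].

Definition bounded_borel B : Prop :=
  measurable B /\ exists r : R, B `<=` eball r.

Definition locally_finite (mu : {measure set 'rV[R]_d -> \bar R}) : Prop :=
  forall B, bounded_borel B -> (mu B < +oo)%E.

(* e^{it} *)
Definition cexpi (t : R) : R[i] := Complex (cos t) (sin t).

Definition fourier (f : 'rV[R]_d -> R[i]) (k : 'rV[R]_d) : R[i] :=
  cintegral (lebesgue_rV d) setT (fun x => cexpi (- dotp k x) * f x).

Definition test_function (f : 'rV[R]_d -> R[i]) : Prop :=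
  [/\ measurable_fun setT f,
      exists M : R, forall x, ComplexField.Normc.normc (f x) <= M &
      exists r : R, forall x, ~ eball r x -> f x = 0].

End euclidean.

Section complex_measure.
Context {R : realType} {d : nat}.
Local Notation measureRd := {measure set 'rV[R]_d -> \bar R}.

(* m = mu1 - mu2 + i (mu3 - mu4) on bounded Borel sets *)
Definition decomposition (m : set 'rV[R]_d -> R[i])
    (mu1 mu2 mu3 mu4 : measureRd) : Prop :=
  [/\ locally_finite mu1, locally_finite mu2, locally_finite mu3,
      locally_finite mu4 &
      forall B, bounded_borel B ->
        m B = Complex (fine (mu1 B) - fine (mu2 B))
                      (fine (mu3 B) - fine (mu4 B))].

(* A complex measure is only defined on bounded Borel sets; the value 0
   elsewhere makes Leibniz equality coincide with equality of measures. *)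
Record cmeasure : Type := CMeasure {
  cmval :> set 'rV[R]_d -> R[i];
  cmval_decomp : exists mu1 mu2 mu3 mu4, decomposition cmval mu1 mu2 mu3 mu4;
  cmval_out : forall B, ~ bounded_borel B -> cmval B = 0 }.

Lemma cmeasure_eq (m n : cmeasure) :
  (forall B, bounded_borel B -> m B = n B) -> m = n.
Proof.
case: m n => [m dm om] [n dn on] /= mn.
have {}mn : m = n.
  apply/funext => B; have [/mn//|nB] := pselect (bounded_borel B).
  by rewrite om// on.
by subst n; congr CMeasure; exact: Prop_irrelevance.
Qed.

(* the restriction m|_D, i.e. A |-> m (A `&` D) *)
Section restriction.
Variables (D : set 'rV[R]_d) (mD : measurable D) (m : cmeasure).

Let restr_val A : R[i] := if `[< bounded_borel A >] then m (A `&` D) else 0.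

Let restr_decomp :
  exists mu1 mu2 mu3 mu4, decomposition restr_val mu1 mu2 mu3 mu4.
Proof.
have bbI A : bounded_borel A -> bounded_borel (A `&` D).
  move=> [mA [r Ar]]; split; first exact: measurableI.
  by exists r => x [/Ar].
have [mu1 [mu2 [mu3 [mu4 [l1 l2 l3 l4 mE]]]]] := cmval_decomp m.
exists (mrestr mu1 mD), (mrestr mu2 mD), (mrestr mu3 mD), (mrestr mu4 mD).
split=> [A /bbI|A /bbI|A /bbI|A /bbI|A bA]; [exact: l1|exact: l2|exact: l3|exact: l4|].
by rewrite /restr_val asboolT// mE//; exact: bbI.
Qed.

Let restr_out B : ~ bounded_borel B -> restr_val B = 0.
Proof. by move=> nB; rewrite /restr_val asboolF. Qed.

Definition crestr : cmeasure := CMeasure restr_decomp restr_out.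

Lemma crestrE A : bounded_borel A -> crestr A = m (A `&` D).
Proof. by move=> bA; rewrite /= /restr_val asboolT. Qed.

End restriction.

Definition cmeasure0 : cmeasure.
Proof.
apply: (@CMeasure (fun=> 0)) => //.
exists mzero, mzero, mzero, mzero.
split=> [B _|B _|B _|B _|B _]; do ?by rewrite /mzero ltry.
by rewrite /mzero /= subrr.
Defined.

HB.instance Definition _ := gen_eqMixin cmeasure.
HB.instance Definition _ := gen_choiceMixin cmeasure.
HB.instance Definition _ := isPointed.Build cmeasure cmeasure0.

Definition cmeasure_eval : set (set cmeasure) :=
  \bigcup_(B in bounded_borel)
    preimage_set_system setT (fun m : cmeasure => m B) measurable.

HB.instance Definition _ :=
  Measurable.copy cmeasure (g_sigma_algebraType cmeasure_eval).

(* |m|(A), as a supremum over finite families of disjoint Borel subsets *)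
Definition total_var (m : cmeasure) (A : set 'rV[R]_d) : \bar R :=
  ereal_sup [set s | exists n (F : 'I_n -> set 'rV[R]_d),
    [/\ forall i, bounded_borel (F i) /\ F i `<=` A, trivIset setT F &
        s = (\sum_(i < n) ComplexField.Normc.normc (m (F i)))%:E]].

Definition decomp_integral (mu1 mu2 mu3 mu4 : measureRd) (D : set 'rV[R]_d)
    (f : 'rV[R]_d -> R[i]) : R[i] :=
  cintegral mu1 D f - cintegral mu2 D f
  + Complex 0 1 * (cintegral mu3 D f - cintegral mu4 D f).

(* \int_D f dm, for f bounded on D and vanishing on D outside a ball: any
   decomposition of m gives the same value. *)
Definition cmintegral (m : cmeasure) (D : set 'rV[R]_d) (f : 'rV[R]_d -> R[i])
    : R[i] :=
  xget 0 [set z | exists mu1 mu2 mu3 mu4,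
    decomposition m mu1 mu2 mu3 mu4 /\ z = decomp_integral mu1 mu2 mu3 mu4 D f].

End complex_measure.
Arguments cmeasure : clear implicits.

Section random_measure.
Context {R : realType} {d : nat} {disp : measure_display}
  {Omega : measurableType disp} (P : probability Omega R).

Definition measurable_flow (theta : 'rV[R]_d -> Omega -> Omega) : Prop :=
  [/\ theta 0 = id,
      forall x y, theta (x + y) = theta x \o theta y,
      measurable_fun [set: Omega * 'rV[R]_d] (fun z => theta z.2 z.1) &
      forall x A, measurable A -> P (theta x @^-1` A) = P A].

Definition cexpectation (X : Omega -> R[i]) : R[i] := cintegral P setT X.

Definition ccovariance (X Y : Omega -> R[i]) : R[i] :=
  cexpectation (fun w => X w * conjc (Y w))
  - cexpectation X * conjc (cexpectation Y).

Variable Phi : {mfun Omega >-> cmeasure R d}.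

Definition invariant_cm (theta : 'rV[R]_d -> Omega -> Omega) : Prop :=
  forall x w B, bounded_borel B ->
    Phi (theta x w) B = Phi w [set y + x | y in B].

Definition locally_abs_square_integrable : Prop :=
  (\int[P]_w (total_var (Phi w) (eball 1) ^+ 2) < +oo)%E.

(* The integrability clause is implicit in the existence of the integral
   on the right-hand side. *)
Definition bartlett_measure (beta : {measure set 'rV[R]_d -> \bar R}) : Prop :=
  locally_finite beta /\
  forall f g : 'rV[R]_d -> R[i], test_function f -> test_function g ->
    let h k := fourier f k * conjc (fourier g k) in
    cintegrable beta setT h /\
    ccovariance (fun w => cmintegral (Phi w) setT f)
                (fun w => cmintegral (Phi w) setT g)
    = ((2 * pi) ^- d)%:C%C * cintegral beta setT h.

(* The Bartlett spectral measure is unique when it exists. *)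
Definition q_uniform (q : R) : Prop :=
  exists2 beta : {measure set 'rV[R]_d -> \bar R}, bartlett_measure beta &
    (fun e : R => e ^- d * fine (beta (eball e)) : R^o) =O_ (0^'+)
    (fun e : R => e `^ q : R^o).

Definition infty_uniform : Prop :=
  exists2 beta : {measure set 'rV[R]_d -> \bar R}, bartlett_measure beta &
    exists2 e : R, 0 < e & beta (eball e) = 0%E.

(* sigma(Phi|_D)-measurability of a random element Y of T *)
Definition restr_measurable D (mD : measurable D) disp' (T : measurableType disp')
    (Y : Omega -> T) : Prop :=
  measurable_fun setT
    (Y : g_sigma_algebra_preimageType (fun w => crestr mD (Phi w)) -> T).

(* The tensor x^{\otimes q}, through its components. *)
Definition tensor_moment (B : set 'rV[R]_d) q (w : Omega)
    : {ffun q.-tuple 'I_d -> R[i]} :=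
  [ffun I : q.-tuple 'I_d => cmintegral (Phi w) B
    (fun x => (\prod_(j < q) x ord0 (tnth I j))%:C%C)].

Definition rigid (p : nat) : Prop :=
  forall B (bB : bounded_borel B) q, (q <= p)%N ->
    exists Y : Omega -> {ffun q.-tuple 'I_d -> R[i]},
      (forall I, restr_measurable (measurableC bB.1) (fun w => Y w I)) /\
      {ae P, forall w, tensor_moment B q w = Y w}.

Definition maximally_rigid : Prop :=
  forall B (bB : bounded_borel B),
    exists Psi : Omega -> cmeasure R d,
      restr_measurable (measurableC bB.1) Psi /\
      {ae P, forall w, crestr bB.1 (Phi w) = Psi w}.

End random_measure.

(* Main.v *)
Require Import Defs.
From HB Require Import structures.
From mathcomp Require Import all_boot all_order all_algebra.
From mathcomp Require Import all_classical all_reals all_analysis.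
From mathcomp Require Import measurable_realfun.
From mathcomp Require Import ring lra zify.

Set Implicit Arguments.
Unset Strict Implicit.
Unset Printing Implicit Defensive.

Import Order.TTheory GRing.Theory Num.Theory.
Import numFieldNormedType.Exports.
Local Open Scope classical_set_scope.
Local Open Scope ring_scope.

(** Moments on B are recovered from Phi outside B by linear statistics of small
variance.  Let x^l be a monomial of degree q <= p, and let f_n be x^l cut off on
a cube of side of order n and averaged over segments of length n in the
coordinate directions.  On the cube of size n, f_n is x^l plus a polynomial of
lower degree, and its Fourier transform is O(n^(q+d) (n |k|)^-(q+d+1)).  Put
F_N = sum_(i < N) f_(rho 2^i).  If beta(B_e) = O(e^(2(q+d))), then on each dyadic
shell of frequencies the summands of F_N decay geometrically away from the
matching scale, so each shell contributes O(1) to the variance, and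
Var Phi(F_N) = O(N).  Hence Phi(F_N / N)
tends to its mean in L^2, and solving for the integral over B of x^l expresses
it through Phi outside B and moments of lower degree: induct on the degree.

If all moments on B are determined, so is the integral over B of every bounded
pointwise limit of polynomials, hence Phi(A cap B) for every Borel set A.  To
turn these countably many random variables into a random measure, embed R^d
into [0, 1] by ternary expansions; the images of Re Phi and Im Phi become
functions of bounded variation on Q, and the variation function gives a
measurable decomposition into two Lebesgue-Stieltjes measures. *)

(** * Integrals of bounded functions with bounded support *)

(** A single scale is not enough: if beta(B_e) has exact order e^(2(q+d)), the estimate for Var
    Phi(f_n) is O(1) for every n and does not improve, because the growth of the transform of f_n is
    only just compensated. What helps is the near-orthogonality of distant scales: the variance of
    F_N grows at most like N, while the squared coefficient of x^l in it is N^2. Segment averages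
    replace a smooth cut-off because they are explicit multipliers in frequency space and send
    polynomials to polynomials with the same leading monomial. The terms of lower degree that they
    create are what forces the induction on the degree. For maximal rigidity the obstacle is that
    the sigma-algebra of Phi outside B is not completed: each value Phi(A cap B) has its own null
    set, and a genuine measure must be produced at every sample point by a measurable construction
    from countably many versions. On the line, the values on rational rays are such a countable
    family and distribution functions give the construction; this is the reason for embedding R^d
    into it. *)

Section real_test_functions.
Context {R : realType} {d : nat}.
Implicit Types (u v : 'rV[R]_d -> R) (mu nu : {measure set 'rV[R]_d -> \bar R}).

Definition rtest u : Prop :=
  [/\ measurable_fun setT u, exists M : R, forall x, `|u x| <= M &
      exists r : R, forall x, ~ eball r x -> u x = 0].

Lemma measurable_dotp d1 (T : measurableType d1) (f g : T -> 'rV[R]_d) :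
  measurable_fun setT f -> measurable_fun setT g ->
  measurable_fun setT (fun x => dotp (f x) (g x)).
Proof.
move=> mf mg; apply: measurable_sum => i; apply: measurable_funM.
- exact: (measurableT_comp (measurable_rV_coord i) mf).
- exact: (measurableT_comp (measurable_rV_coord i) mg).
Qed.

Lemma measurable_enorm : measurable_fun setT (@enorm R d).
Proof.
have ms : measurable_fun setT (@Num.sqrt R).
  by apply: continuous_measurable_fun; exact: sqrt_continuous.
by apply: (measurableT_comp ms); apply: measurable_dotp; exact: measurable_id.
Qed.

Lemma measurable_eball (r : R) : measurable (@eball R d r).
Proof.
rewrite (_ : eball r = @enorm R d @^-1` `]-oo, r[%classic).
  by rewrite -[X in measurable X]setTI; exact: measurable_enorm.
by apply/seteqP; split => x /=; rewrite in_itv.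
Qed.

Lemma bounded_borel_eball (r : R) : bounded_borel (@eball R d r).
Proof. by split; [exact: measurable_eball|exists r]. Qed.

Lemma eball_le (r s : R) : r <= s -> @eball R d r `<=` eball s.
Proof. by move=> rs x /=; rewrite /eball /= => /lt_le_trans; exact. Qed.

Lemma bounded_borelS (A B : set 'rV[R]_d) :
  bounded_borel B -> measurable A -> A `<=` B -> bounded_borel A.
Proof. by move=> [_ [r Br]] mA AB; split => //; exists r => x /AB /Br. Qed.

Lemma rtest_lin (a : R) u v : rtest u -> rtest v ->
  rtest (fun x => a * u x + v x).
Proof.
move=> [mu [M uM] [r ur]] [mv [N vN] [s vs]]; split.
- by apply: measurable_funD => //; apply: measurable_funM.
- exists (`|a| * M + N) => x; rewrite (le_trans (ler_normD _ _))//.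
  by rewrite lerD// normrM ler_wpM2l.
- exists (Num.max r s) => x xrs.
  rewrite ur ?vs ?mulr0 ?addr0// => h; apply: xrs; apply: eball_le h;
    by rewrite le_max lexx ?orbT.
Qed.

Lemma rtestM u v : rtest u -> measurable_fun setT v ->
  (exists M : R, forall x, `|v x| <= M) -> rtest (fun x => u x * v x).
Proof.
move=> [mu [M uM] [r ur]] mv [N vN]; split.
- exact: measurable_funM.
- by exists (M * N) => x; rewrite normrM ler_pM.
- by exists r => x /ur ->; rewrite mul0r.
Qed.

Lemma rtest_indic A : bounded_borel A -> rtest \1_A.
Proof.
move=> [mA [r Ar]]; split => //.
- by exists 1 => x; rewrite indicE; case: (_ \in _); rewrite ?normr0 ?normr1.
- by exists r => x xr; rewrite indicE memNset// => /Ar.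
Qed.

Lemma rtest0 : rtest (fun=> 0).
Proof. by split => //; [exists 0 => x; rewrite normr0|exists 0]. Qed.

Lemma rtestZ (a : R) u : rtest u -> rtest (fun x => a * u x).
Proof.
move=> tu; have := rtest_lin a tu rtest0.
by under eq_fun do rewrite addr0.
Qed.

Lemma rtestD u v : rtest u -> rtest v -> rtest (fun x => u x + v x).
Proof.
move=> tu tv; have := rtest_lin 1 tu tv.
by under eq_fun do rewrite mul1r.
Qed.

Lemma rtest_sum I (s : seq I) (u : I -> 'rV[R]_d -> R) :
  (forall i, rtest (u i)) -> rtest (fun x => \sum_(i <- s) u i x).
Proof.
move=> tu; elim: s => [|i s ih].
  by under eq_fun do rewrite big_nil; exact: rtest0.
by under eq_fun do rewrite big_cons; exact: rtestD.
Qed.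

Lemma rtest_integrable mu u : locally_finite mu -> rtest u ->
  mu.-integrable setT (EFin \o u).
Proof.
move=> lmu [mu' [M uM] [r ur]].
have -> : EFin \o u = (EFin \o u) \_ (eball r).
  apply/funext => x; rewrite patchE; case: ifPn => //= /negP xr.
  by rewrite ur// => h; apply: xr; rewrite inE.
apply/(integrable_mkcond _ (measurable_eball r)).
apply: measurable_bounded_integrable; first exact: measurable_eball.
- exact/lmu/bounded_borel_eball.
- exact: measurable_funTS.
- exists M; split; first exact: num_real.
  by move=> y My x _ /=; rewrite (le_trans (uM x))// ltW.
Qed.

(** Values of [u] are rounded down to the grid of step [e] that starts at [-K]. The level sets are
    disjoint and inside [B], as a comparison with the total variation requires. *)
Lemma simple_approx (B : set 'rV[R]_d) u (K e : R) : bounded_borel B ->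
  measurable_fun setT u -> (forall x, `|u x| <= K) -> (forall x, ~ B x -> u x = 0) ->
  0 < e ->
  exists n (a : 'I_n -> R) (A : 'I_n -> set 'rV[R]_d),
   [/\ forall i, bounded_borel (A i) /\ A i `<=` B, trivIset setT A,
       forall i, `|a i| <= K + e &
       forall x, `|u x - \sum_i a i * \1_(A i) x| <= e].
Proof.
move=> bB mu uK uB e0.
have K0 : 0 <= K by rewrite (le_trans _ (uK 0)).
pose n := (Num.trunc ((K + K) / e)).+1.
pose ix (x : 'rV[R]_d) := Num.trunc ((u x + K) / e).
have uK0 x : 0 <= u x + K by have := uK x; rewrite ler_norml => /andP[]; lra.
have ixn x : (ix x < n)%N.
  rewrite ltnS; apply: le_truncn; rewrite ler_pM2r ?invr_gt0//.
  by rewrite lerD2r (le_trans (ler_norm _)).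
have ixP x : (ix x)%:R * e <= u x + K < (ix x)%:R * e + e.
  have /trunc_itv : 0 <= (u x + K) / e by rewrite divr_ge0// ltW.
  by rewrite ler_pdivlMr// ltr_pdivrMr// -natr1 [(_ + 1) * _]mulrDl mul1r.
pose a (i : 'I_n) := i%:R * e - K.
pose A (i : 'I_n) := B `&` u @^-1` `[i%:R * e - K, i%:R * e + e - K[%classic.
have Aix x (i : 'I_n) : B x -> (A i x <-> i = ix x :> nat).
  move=> Bx; rewrite /A /=; split=> [[_]|->]; last first.
    by split=> //; rewrite in_itv/=; have := ixP x; lra.
  rewrite in_itv/= => h; apply/esym/eqP; rewrite truncn_eq; last first.
    by rewrite divr_ge0// ltW.
  by rewrite ler_pdivlMr// ltr_pdivrMr// -natr1 [(_ + 1) * _]mulrDl mul1r; lra.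
exists n, a, A; split.
- move=> i; have AB : A i `<=` B by move=> x [].
  split => //; apply: (bounded_borelS bB) => //.
  apply: measurableI; first exact: bB.1.
  by rewrite -[X in measurable X]setTI; apply: mu => //.
- move=> i j _ _ [x [Aix' Ajx]]; apply/val_inj => /=.
  have Bx := Aix'.1.
  by rewrite ((Aix x i Bx).1 Aix') ((Aix x j Bx).1 Ajx).
- move=> i; rewrite /a.
  have ie : i%:R * e <= K + K.
    have := ltn_ord i; rewrite ltnS truncn_ge_nat ?ler_pdivlMr// mul0r.
    exact: addr_ge0.
  have := mulr_ge0 (ler0n R i) (ltW e0) => h.
  by rewrite ler_norml; apply/andP; split; lra.
- move=> x; have [Bx|nBx] := pselect (B x); last first.
    rewrite uB// big1 ?subrr ?normr0 ?ltW// => i _.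
    by rewrite indicE memNset ?mulr0// => -[].
  rewrite (bigD1 (Ordinal (ixn x)))//= big1 => [|i ni]; last first.
    rewrite indicE memNset ?mulr0// => /(Aix x i Bx) h.
    by move/eqP: ni; apply; exact/val_inj.
  rewrite addr0 indicE mem_set; last exact/(Aix x _ Bx).
  rewrite mulr1 /a/=; have := ixP x => /andP[h1 h2].
  by rewrite ler_norml; apply/andP; split; lra.
Qed.

(** Stands in for the monotone class theorem: identities between integrals, and measurability in the
    measure, are checked on indicators and pass to bounded limits with common support. It holds
    because [simple_approx] approximates uniformly inside a fixed ball. *)
Lemma rtest_ind (P : ('rV[R]_d -> R) -> Prop) :
  (forall A, bounded_borel A -> P \1_A) ->
  (forall a u v, rtest u -> rtest v -> P u -> P v -> P (fun x => a * u x + v x)) ->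
  (forall (u : nat -> 'rV[R]_d -> R) v (M r : R), (forall n, rtest (u n)) ->
     (forall n, P (u n)) -> (forall n x, `|u n x| <= M) ->
     (forall n x, ~ eball r x -> u n x = 0) ->
     (forall x, u n x @[n --> \oo] --> v x) -> P v) ->
  forall u, rtest u -> P u.
Proof.
move=> P1 Plin Plim u tu.
have P0 : P (fun=> 0).
  have b0 : bounded_borel (set0 : set 'rV[R]_d) by split => //; exists 0.
  have := Plin (-1) _ _ (rtest_indic b0) (rtest_indic b0) (P1 _ b0) (P1 _ b0).
  by under eq_fun do rewrite mulN1r addNr.
have Psum (I : Type) (s : seq I) (a : I -> R) (A : I -> set 'rV[R]_d) :
    (forall i, bounded_borel (A i)) ->
    P (fun x => \sum_(i <- s) a i * \1_(A i) x).
  move=> bA; elim: s => [|i s ih].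
    by under eq_fun do rewrite big_nil.
  under eq_fun do rewrite big_cons; apply: Plin => //; last exact: P1.
    exact: rtest_indic.
  apply: rtest_sum => j; apply: rtestZ; exact: rtest_indic.
have [mu [M uM] [r ur]] := tu.
have n0 n : (0 : R) < n.+1%:R^-1 by rewrite invr_gt0.
have H n := simple_approx (bounded_borel_eball r) mu uM ur (n0 n).
have {}H n : exists w, [/\ rtest w, P w, forall x, ~ eball r x -> w x = 0 &
    forall x, `|u x - w x| <= n.+1%:R^-1].
  have [m [a [A [bA _ _ Ah]]]] := H n.
  exists (fun x => \sum_i a i * \1_(A i) x); split => //.
  - by apply: rtest_sum => i; apply/rtestZ/rtest_indic; exact: (bA i).1.
  - by apply: Psum => i; exact: (bA i).1.
  - move=> x xr; rewrite big1// => i _.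
    by rewrite indicE memNset ?mulr0// => /(bA i).2.
have [w /all_and4[tw Pw wr wu]] := choice H.
apply: (Plim w u (M + 1) r) => //.
- move=> n x; rewrite -[w n x](subKr (u x)) (le_trans (ler_normB _ _))//.
  rewrite lerD// (le_trans (wu n x))// invf_le1 ?ler1n//.
- move=> x; apply/cvgrPdist_le => e e0; near=> n.
  rewrite (le_trans (wu n x))// ltW//.
  near: n; exact: (near_infty_natSinv_lt (PosNum e0)).
Unshelve. all: by end_near. Qed.

End real_test_functions.

(** * Integration of real functions against a complex measure *)

Section integral_against_cmeasure.
Context {R : realType} {d : nat}.
Implicit Types (u v : 'rV[R]_d -> R) (mu nu : {measure set 'rV[R]_d -> \bar R}).
Implicit Types (m : cmeasure R d) (b : bool).

(* Real and imaginary parts are treated at once: [true] stands for Re. *)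
Definition cpart b (z : R[i]) : R := if b then complex.Re z else complex.Im z.

Lemma cpart_eq (z w : R[i]) : (forall b, cpart b z = cpart b w) -> z = w.
Proof. by case: z w => [a b] [c e] h; have /= -> := h true; have /= -> := h false. Qed.

Lemma normc_sqr (z : R[i]) :
  ComplexField.Normc.normc z ^+ 2 = cpart true z ^+ 2 + cpart false z ^+ 2.
Proof. by case: z => [a b] /=; rewrite sqr_sqrtr// addr_ge0// sqr_ge0. Qed.

Lemma cpart_le_normc b (z : R[i]) : `|cpart b z| <= ComplexField.Normc.normc z.
Proof.
have n0 : 0 <= ComplexField.Normc.normc z by case: z => ? ?; exact: sqrtr_ge0.
rewrite -(ler_sqr (normr_ge0 _) n0) normc_sqr -normrX ger0_norm ?sqr_ge0//.
by case: b; rewrite ?lerDl ?lerDr sqr_ge0.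
Qed.

Definition rintegral b m u : R :=
  cpart b (cmintegral m setT (fun x => (u x)%:C%C)).

Lemma cmintegral_restrict m (D : set 'rV[R]_d) u :
  cmintegral m D (fun x => (u x)%:C%C) =
  cmintegral m setT (fun x => ((u \_ D) x)%:C%C).
Proof.
have E mu : cintegral mu D (fun x => (u x)%:C%C) =
    cintegral mu setT (fun x => ((u \_ D) x)%:C%C).
  rewrite /cintegral /=; congr Complex; first by rewrite Rintegral_mkcond.
  by rewrite Rintegral_mkcond; apply: eq_Rintegral => x _; rewrite patchE if_same.
rewrite /cmintegral; congr xget; apply/seteqP.
by split => z [m1 [m2 [m3 [m4 [h ->]]]]]; exists m1, m2, m3, m4; split;
  rewrite // /decomp_integral !E.
Qed.

Lemma cintegral_real mu u :
  cintegral mu setT (fun x => (u x)%:C%C) = Complex (\int[mu]_x u x) 0.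
Proof.
rewrite /cintegral; congr Complex => /=.
by rewrite /Rintegral integral0.
Qed.

(** With the negative terms moved across, the hypothesis says that two positive measures,
    [mu1 + nu2] and [nu1 + mu2], agree on the Borel subsets of a ball outside which [u] vanishes. *)
Lemma diff_integral_eq mu1 mu2 nu1 nu2 u :
  locally_finite mu1 -> locally_finite mu2 ->
  locally_finite nu1 -> locally_finite nu2 ->
  (forall B, bounded_borel B ->
     fine (mu1 B) - fine (mu2 B) = fine (nu1 B) - fine (nu2 B)) ->
  rtest u ->
  \int[mu1]_x u x - \int[mu2]_x u x = \int[nu1]_x u x - \int[nu2]_x u x.
Proof.
move=> l1 l2 l3 l4 E tu.
have [mu' _ [r ur]] := tu.
have i1 := rtest_integrable l1 tu; have i2 := rtest_integrable l2 tu.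
have i3 := rtest_integrable l3 tu; have i4 := rtest_integrable l4 tu.
have : (\int[measure_add mu1 nu2]_x (EFin \o u) x =
        \int[measure_add nu1 mu2]_x (EFin \o u) x)%E.
  have uE : EFin \o u = (EFin \o u) \_ (eball r).
    apply/funext => x; rewrite patchE; case: ifPn => //= /negP xr.
    by rewrite ur// => h; apply: xr; rewrite inE.
  rewrite uE -!integral_mkcond; apply: eq_measure_integral => A mA Ar.
  have bA : bounded_borel A := bounded_borelS (bounded_borel_eball r) mA Ar.
  have f mu : locally_finite mu -> mu A = (fine (mu A))%:E.
    by move=> /(_ _ bA) h; rewrite fineK// ge0_fin_numE.
  transitivity (mu1 A + nu2 A)%E; first exact: measure_addE.
  transitivity (nu1 A + mu2 A)%E; last exact/esym/measure_addE.
  have := E _ bA.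
  rewrite (f _ l1) (f _ l2) (f _ l3) (f _ l4) /= => e.
  by rewrite -!EFinD; congr EFin; lra.
rewrite !integral_measure_add// => e.
have F mu : mu.-integrable setT (EFin \o u) ->
    (\int[mu]_x (EFin \o u) x = (\int[mu]_x u x)%:E)%E.
  by move=> /integrable_fin_num h; rewrite /Rintegral fineK//; exact: h.
move: e; rewrite !F// -!EFinD => -[e]; lra.
Qed.

Lemma rintegral_decomp b m : exists mu nu,
  [/\ locally_finite mu, locally_finite nu,
      forall B, bounded_borel B -> cpart b (m B) = fine (mu B) - fine (nu B) &
      forall u, rtest u -> rintegral b m u = \int[mu]_x u x - \int[nu]_x u x].
Proof.
have [m1 [m2 [m3 [m4 dm]]]] := cmval_decomp m.
have [l1 l2 l3 l4 mE] := dm.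
have H u : rtest u -> cmintegral m setT (fun x => (u x)%:C%C) =
    Complex (\int[m1]_x u x - \int[m2]_x u x) (\int[m3]_x u x - \int[m4]_x u x).
  move=> tu; rewrite /cmintegral; case: xgetP; last first.
    by move/(_ (decomp_integral m1 m2 m3 m4 setT (fun x => (u x)%:C%C))) => []; exists m1, m2, m3, m4.
  move=> _ -> [n1 [n2 [n3 [n4 [[k1 k2 k3 k4 nE] ->]]]]].
  rewrite /decomp_integral !cintegral_real.
  rewrite (_ : \int[n1]_x u x = \int[n2]_x u x + (\int[m1]_x u x - \int[m2]_x u x)).
    rewrite (_ : \int[n3]_x u x = \int[n4]_x u x + (\int[m3]_x u x - \int[m4]_x u x)).
      by apply: cpart_eq => -[] /=; ring.
    have := @diff_integral_eq n3 n4 m3 m4 u k3 k4 l3 l4 _ tu.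
    move=> <-; first by ring.
    by move=> B bB; have := nE _ bB; rewrite mE// => -[_ ->].
  have := @diff_integral_eq n1 n2 m1 m2 u k1 k2 l1 l2 _ tu.
  move=> <-; first by ring.
  by move=> B bB; have := nE _ bB; rewrite mE// => -[-> _].
case: b; [exists m1, m2|exists m3, m4]; split => //.
- by move=> B bB; rewrite mE.
- by move=> u tu; rewrite /rintegral H.
- by move=> B bB; rewrite mE.
- by move=> u tu; rewrite /rintegral H.
Qed.

Lemma rintegral_indic b m A : bounded_borel A ->
  rintegral b m \1_A = cpart b (m A).
Proof.
move=> bA; have [mu [nu [lm ln mE ->]]] := rintegral_decomp b m; last exact: rtest_indic.
rewrite mE// /Rintegral !integral_indic//; [|exact: bA.1..].
by rewrite !setIT.
Qed.

Opaque rintegral.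

Lemma rintegral_lin b m (a : R) u v : rtest u -> rtest v ->
  rintegral b m (fun x => a * u x + v x) = a * rintegral b m u + rintegral b m v.
Proof.
move=> tu tv; have [mu [nu [lm ln mE E]]] := rintegral_decomp b m.
have H k : locally_finite k -> \int[k]_x (a * u x + v x) =
    a * \int[k]_x u x + \int[k]_x v x.
  move=> lk; rewrite RintegralD//; [|exact: rtest_integrable (rtestZ a tu)|exact: rtest_integrable].
  by rewrite RintegralZl//; exact: rtest_integrable.
rewrite !E//; last exact: rtest_lin.
by rewrite !H//; ring.
Qed.

Lemma rintegral_cvg b m (w : nat -> 'rV[R]_d -> R) v (M r : R) :
  (forall n, rtest (w n)) -> (forall n x, `|w n x| <= M) ->
  (forall n x, ~ eball r x -> w n x = 0) ->
  (forall x, w n x @[n --> \oo] --> v x) ->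
  rtest v /\ rintegral b m (w n) @[n --> \oo] --> rintegral b m v.
Proof.
move=> tw wM wr wv.
have M0 : 0 <= M by rewrite (le_trans _ (wM 0%N 0)).
have mv : measurable_fun setT v.
  apply: (measurable_fun_cvg (h := w)); first by move=> n; have [] := tw n.
  by move=> x _; exact: wv.
have tv : rtest v.
  split => //.
  - exists M => x; have h : `|w n x| @[n --> \oo] --> `|v x| by apply: cvg_norm; exact: wv.
    rewrite -(cvg_lim _ h)//; apply: limr_le; first by apply/cvg_ex; exists `|v x|.
    by apply: nearW => n; exact: wM.
  - exists r => x xr; rewrite -(cvg_lim _ (wv x))//.
    rewrite (_ : w ^~ x = fun=> 0); first by rewrite lim_cst.
    by apply/funext => n; rewrite wr.
split => //.
have [mu [nu [lm ln mE E]]] := rintegral_decomp b m.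
rewrite E//; under eq_fun do rewrite E//.
have H k : locally_finite k -> \int[k]_x w n x @[n --> \oo] --> \int[k]_x v x.
  move=> lk.
  have tg : rtest (fun x : 'rV[R]_d => M * \1_(eball r) x).
    by apply/rtestZ/rtest_indic/bounded_borel_eball.
  have [| | |//| |_ _] := @dominated_convergence _ _ _ k setT measurableT
    (fun n => EFin \o w n) (EFin \o v) (EFin \o (fun x => M * \1_(eball r) x)).
  - by move=> n; apply/measurable_EFinP; have [] := tw n.
  - exact/measurable_EFinP.
  - by apply: aeW => x _; apply: cvg_EFin; [exact: nearW|exact: wv].
  - exact: rtest_integrable.
  - apply: aeW => x n _ /=; rewrite lee_fin indicE.
    have [xr|xr] := pselect (eball r x); first by rewrite mem_set// mulr1.
    by rewrite memNset// mulr0 wr// normr0.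
  move=> h; apply: fine_cvg.
  rewrite /Rintegral fineK; first exact: h.
  by apply: integrable_fin_num => //; exact: rtest_integrable.
by apply: cvgB; exact: H.
Qed.

Lemma rintegral0 b m : rintegral b m (fun=> 0) = 0.
Proof.
have := rintegral_lin b m 1 rtest0 rtest0.
under eq_fun do rewrite mulr0 addr0.
by rewrite mul1r => h; lra.
Qed.

Lemma rintegralD b m u v : rtest u -> rtest v ->
  rintegral b m (fun x => u x + v x) = rintegral b m u + rintegral b m v.
Proof.
move=> tu tv; rewrite -[rintegral b m u]mul1r -rintegral_lin//.
by under eq_fun do rewrite -[u _]mul1r.
Qed.

Lemma rintegralZ b m (a : R) u : rtest u ->
  rintegral b m (fun x => a * u x) = a * rintegral b m u.
Proof.
move=> tu; rewrite -[RHS]addr0 -(rintegral0 b m) -rintegral_lin//; last exact: rtest0.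
by under [in RHS]eq_fun do rewrite addr0.
Qed.

Lemma rintegral_sum b m I (s : seq I) (u : I -> 'rV[R]_d -> R) :
  (forall i, rtest (u i)) ->
  rintegral b m (fun x => \sum_(i <- s) u i x) = \sum_(i <- s) rintegral b m (u i).
Proof.
move=> tu; elim: s => [|i s ih].
  by under eq_fun do rewrite big_nil; rewrite rintegral0 big_nil.
under eq_fun do rewrite big_cons; rewrite rintegralD ?ih ?big_cons//.
exact: rtest_sum.
Qed.

Lemma measurable_cpart b : measurable_fun setT (cpart b).
Proof.
move=> _ Y mY; rewrite setTI.
have := @sub_sigma_algebra _ setT (preimage_set_system setT (@complex_pair R) measurable).
exists (if b then Y `*` setT else setT `*` Y).
  by case: b; exact: measurableX.
by rewrite setTI; apply/seteqP; case: b; split => -[x y] /=; tauto.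
Qed.

Lemma measurable_complex d1 (T : measurableType d1) (f : T -> R[i]) :
  (forall b, measurable_fun setT (fun x => cpart b (f x))) ->
  measurable_fun setT f.
Proof.
move=> mf _ Y [Z mZ <-]; rewrite !setTI.
rewrite -comp_preimage -[X in measurable X]setTI.
have : measurable_fun setT (complex_pair (R:=R) \o f) by
  apply/measurable_fun_pairP; split; [exact: (mf true)|exact: (mf false)].
exact.
Qed.

Lemma measurable_cmval b A : bounded_borel A ->
  measurable_fun setT (fun m => cpart b (m A)).
Proof.
move=> bA; apply: (measurableT_comp (measurable_cpart b)).
move=> _ Y mY; rewrite setTI; apply: sub_sigma_algebra.
by exists A => //; exists Y => //; rewrite setTI.
Qed.

Lemma measurable_rintegral b u : rtest u ->
  measurable_fun setT (fun m => rintegral b m u).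
Proof.
move: u; apply: rtest_ind.
- move=> A bA; under eq_fun do rewrite rintegral_indic//.
  exact: measurable_cmval.
- move=> a u v tu tv mu mv; under eq_fun do rewrite rintegral_lin//.
  by apply: measurable_funD => //; exact: measurable_funM.
- move=> w v M r tw mw wM wr wv.
  apply: (measurable_fun_cvg (h := fun n m => rintegral b m (w n))) => //.
  by move=> m _; have [] := rintegral_cvg b m tw wM wr wv.
Qed.

Lemma rintegral_crestr b (D : set 'rV[R]_d) (mD : measurable D) m u : rtest u ->
  rintegral b (Defs.crestr mD m) u = rintegral b m (fun x => u x * \1_D x).
Proof.
have m1 : measurable_fun setT (\1_D : _ -> R) by exact: measurable_indic.
have b1 : exists M : R, forall x, `|\1_D x : R| <= M.
  by exists 1 => x; rewrite indicE; case: (_ \in _); rewrite ?normr0 ?normr1.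
move: u; apply: rtest_ind.
- move=> A bA; rewrite rintegral_indic// crestrE// -rintegral_indic; last first.
    by apply: (bounded_borelS bA); [exact: measurableI (bA.1) mD|exact: subIsetl].
  by congr rintegral; rewrite indicI.
- move=> a u v tu tv iu iv; rewrite rintegral_lin// iu iv.
  have -> : (fun x => (a * u x + v x) * \1_D x) =
      fun x => a * (u x * \1_D x) + v x * \1_D x by apply/funext => x; ring.
  by apply/esym/rintegral_lin; exact: rtestM.
- move=> w v M r tw ih wM wr wv.
  have [_ h] := rintegral_cvg b (Defs.crestr mD m) tw wM wr wv.
  have [||||_ h'] := @rintegral_cvg b m (fun n x => w n x * \1_D x) (fun x => v x * \1_D x) M r.
  + by move=> n; exact: rtestM.
  + move=> n x; rewrite normrM (le_trans _ (wM n x))// ler_piMr//.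
    by rewrite indicE; case: (_ \in _); rewrite ?normr0 ?normr1.
  + by move=> n x /wr ->; rewrite mul0r.
  + by move=> x; apply: cvgMl; exact: wv.
  by rewrite (funext ih) in h; exact: (cvg_unique _ h h').
Qed.

Definition rbox (r : R) : set 'rV[R]_d := [set x | forall i, `|x ord0 i| <= r].

Lemma eball_rbox (r : R) : eball r `<=` rbox r.
Proof.
move=> x; rewrite /eball /= => xr i.
have r0 : 0 <= r by rewrite (le_trans _ (ltW xr))// sqrtr_ge0.
rewrite (le_trans _ (ltW xr))// -sqrtr_sqr ler_wsqrtr// /dotp (bigD1 i)//= -expr2.
by rewrite lerDl sumr_ge0// => j _; rewrite -expr2 sqr_ge0.
Qed.

Lemma rbox_eball (r : R) : 0 <= r -> rbox r `<=` eball (d%:R * r + 1).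
Proof.
move=> r0 x xr; rewrite /eball /= /enorm.
have h0 : 0 <= d%:R * r by rewrite mulr_ge0.
rewrite -[X in _ < X]ger0_norm ?addr_ge0// -sqrtr_sqr ltr_sqrt; last first.
  by rewrite exprn_gt0// ltr_wpDl.
apply: (@le_lt_trans _ _ (\sum_(i < d) r ^+ 2)).
  apply: ler_sum => i _; rewrite -expr2 -real_normK ?num_real//.
  by rewrite ler_sqr ?nnegrE.
rewrite sumr_const card_ord -mulr_natl.
have [->|d0] := eqVneq d 0%N; first by rewrite !mul0r add0r expr1n ltr01.
have d1 : (1 : R) <= d%:R by rewrite ler1n lt0n.
by rewrite expr2; nra.
Qed.

Lemma rtest_translate u (z : 'rV[R]_d) : rtest u -> rtest (fun x => u (x - z)).
Proof.
move=> [mu [M uM] [r ur]]; split.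
- apply: (measurableT_comp mu); apply: measurable_fun_rV => i.
  rewrite (_ : _ \o _ = fun x : 'rV[R]_d => rV_coord i x - z ord0 i); last first.
    by apply/funext => x; rewrite /= /rV_coord !mxE.
  by apply: measurable_funB => //; exact: measurable_rV_coord.
- by exists M => x.
- pose S := \sum_i `|z ord0 i|.
  exists (d%:R * (`|r| + S) + 1) => x nx; apply: ur => xr; apply: nx.
  apply: rbox_eball; first by rewrite addr_ge0// sumr_ge0.
  move=> i; have := eball_rbox xr i; rewrite !mxE => h.
  rewrite -(subrK (z ord0 i) (x ord0 i)) (le_trans (ler_normD _ _))// lerD//.
    by rewrite (le_trans h)// ler_norm.
  by rewrite /S (bigD1 i)//= lerDl sumr_ge0.
Qed.

Lemma rintegral_translate b (z : 'rV[R]_d) m m' u :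
  (forall B, bounded_borel B -> m' B = m [set y + z | y in B]) -> rtest u ->
  rintegral b m' u = rintegral b m (fun x => u (x - z)).
Proof.
move=> mm'; move: u; apply: rtest_ind.
- move=> A bA; rewrite rintegral_indic// mm'//.
  have E : \1_[set y + z | y in A] = (fun x => \1_A (x - z)) :> (_ -> R).
    apply/funext => x; rewrite !indicE; congr (_ : bool)%:R.
    apply/idP/idP => /set_mem => [[y Ay <-]|Ax]; apply/mem_set; first by rewrite addrK.
    by exists (x - z) => //; rewrite subrK.
  have tA := rtest_translate z (rtest_indic bA).
  rewrite -[in RHS]E rintegral_indic//.
  have [mA _ [r rA]] := tA; split.
    by apply/(measurable_indicP R); rewrite E.
  exists r => x [y Ay <-]; apply: contrapT => /rA; rewrite addrK indicE mem_set//.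
  by move/eqP; rewrite oner_eq0.
- move=> a u v tu tv iu iv; rewrite rintegral_lin// iu iv; apply/esym.
  by apply: rintegral_lin; exact: rtest_translate.
- move=> w v M r tw ih wM wr wv.
  have [_ h] := rintegral_cvg b m' tw wM wr wv.
  have [r' r'P] : exists r' : R, forall x, ~ eball r' x -> ~ eball r (x - z).
    have [_ _ [r' r'P]] := rtest_translate z (rtest_indic (bounded_borel_eball r)).
    exists r' => x /r'P + h'; rewrite indicE mem_set//.
    by move/eqP; rewrite oner_eq0.
  have [||||_ h'] := @rintegral_cvg b m (fun n x => w n (x - z)) (fun x => v (x - z)) M r'.
  + by move=> n; exact: rtest_translate.
  + by move=> n x.
  + by move=> n x /r'P /wr.
  + by move=> x; exact: wv.
  by rewrite (funext ih) in h; exact: (cvg_unique _ h h').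
Qed.

Lemma total_var_ge0 m (B : set 'rV[R]_d) : (0 <= total_var m B)%E.
Proof.
apply: ereal_sup_ubound; exists 0%N, (fun=> set0); split => [[]//|[]//|].
by rewrite big_ord0.
Qed.

(** For a simple function on disjoint sets the bound comes from the definition of [total_var] as a
    supremum. The remainder [w], uniformly small on [B], is controlled by the mass [C] that one
    decomposition gives to [B]. *)
Lemma rintegral_le_total_var b m u (B : set 'rV[R]_d) (K : R) : bounded_borel B ->
  measurable_fun setT u -> (forall x, `|u x| <= K) ->
  (forall x, ~ B x -> u x = 0) ->
  (`|rintegral b m u|%:E <= K%:E * total_var m B)%E.
Proof.
move=> bB mu uK uB.
have tu : rtest u.
  split => //; first by exists K.
  by have [_ [r Br]] := bB; exists r => x xr; apply: uB => /Br.
have K0 : 0 <= K by rewrite (le_trans _ (uK 0)).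
have tv0 := total_var_ge0 m B.
(* An infinite total variation leaves only [K = 0] to be treated, where the right-hand side is [0]
   and [u] vanishes. *)
have := leey (total_var m B); rewrite le_eqVlt => /predU1P[tvE|tvy].
  rewrite tvE; have [K0'|Kn0] := eqVneq K 0; last first.
    by rewrite gt0_muley ?leey// lte_fin lt_neqAle eq_sym Kn0.
  rewrite K0' mul0e (_ : u = fun=> 0) ?rintegral0 ?normr0//.
  by apply/funext => x; apply/eqP; rewrite -normr_le0 -K0'.
have {}tvy : total_var m B = (fine (total_var m B))%:E.
  by rewrite fineK// ge0_fin_numE.
set T := fine _ in tvy.
have T0 : 0 <= T by rewrite -lee_fin -tvy.
rewrite tvy -EFinM lee_fin.
have [mu1 [mu2 [l1 l2 mE E]]] := rintegral_decomp b m.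
have bB' := fun k (lk : locally_finite k) => lk _ bB.
set C := fine (mu1 B) + fine (mu2 B).
have C0 : 0 <= C by rewrite addr_ge0// fine_ge0.
apply/ler_addgt0Pr => e e0.
(* The accuracy [f] is so small that the two errors [f * T] and [f * C] together stay below [e]; the
   [1] keeps the denominator positive. *)
have TC : 0 < T + C + 1 by rewrite ltr_wpDl// addr_ge0.
have e1 : 0 < e / (T + C + 1) by rewrite divr_gt0.
set f := e / _ in e1.
have [n [a [A [bA tA aK Ah]]]] := simple_approx bB mu uK uB e1.
pose s x := \sum_i a i * \1_(A i) x.
have ts : rtest s by apply: rtest_sum => i; apply/rtestZ/rtest_indic; exact: (bA i).1.
pose w x := -1 * s x + u x.
have tw : rtest w by exact: rtest_lin.
have wI k : locally_finite k -> `|\int[k]_x w x| <= f * fine (k B).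
  move=> lk; apply: (le_trans (le_normr_Rintegral _ (rtest_integrable lk tw))) => //.
  have -> : f * fine (k B) = \int[k]_x (f * \1_B x).
    rewrite RintegralZl//; last exact: rtest_integrable (rtest_indic bB).
    by rewrite /Rintegral integral_indic ?setIT//; exact: bB.1.
  apply: le_Rintegral => //.
  - by apply: integrable_norm; exact: rtest_integrable.
  - exact: rtest_integrable (rtestZ _ (rtest_indic bB)).
  - move=> x _; rewrite indicE; have [Bx|Bx] := pselect (B x).
      by rewrite mem_set// mulr1 /w mulN1r addrC; exact: Ah.
    rewrite memNset// mulr0 /w uB// addr0 mulN1r normrN /s big1 ?normr0// => i _.
    by rewrite indicE memNset ?mulr0// => /(bA i).2.
have wB : `|rintegral b m w| <= f * C.
  rewrite E// /C mulrDr (le_trans (ler_normB _ _))// lerD//; exact: wI.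
have sB : `|rintegral b m s| <= (K + f) * T.
  rewrite rintegral_sum; last by move=> i; apply/rtestZ/rtest_indic; exact: (bA i).1.
  apply: (@le_trans _ _ ((K + f) * \sum_(i < n) ComplexField.Normc.normc (m (A i)))).
    rewrite mulr_sumr (le_trans (ler_norm_sum _ _ _))//; apply: ler_sum => i _.
    rewrite rintegralZ; last by apply: rtest_indic; exact: (bA i).1.
    rewrite rintegral_indic; last exact: (bA i).1.
    by rewrite normrM ler_pM// cpart_le_normc.
  apply: ler_wpM2l; first by rewrite addr_ge0// ltW.
  by rewrite -lee_fin -tvy; apply: ereal_sup_ubound; exists n, A.
have -> : rintegral b m u = rintegral b m s + rintegral b m w.
  by rewrite rintegral_lin//; lra.
rewrite (le_trans (ler_normD _ _))//.
have : f * (T + C + 1) = e by rewrite /f divfK// gt_eqF.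
nra.
Qed.

End integral_against_cmeasure.

(** Both integrals are suprema over simple functions below the integrand, so measurability does not
    enter; it is not established for [total_var] as a function of the sample point. *)
Lemma le_integral_nonneg d (T : measurableType d) (R : realType)
    (mu : {measure set T -> \bar R}) (f g : T -> \bar R) :
  (forall x, 0 <= f x)%E -> (forall x, f x <= g x)%E ->
  (\int[mu]_x f x <= \int[mu]_x g x)%E.
Proof.
move=> f0 fg; rewrite !ge0_integralTE//; last by move=> x; exact: le_trans (fg x).
apply: ereal_sup_le => _ [h hf <-]; exists h => // x.
exact: le_trans (fg x).
Qed.

(** Cauchy-Schwarz, by expanding the nonnegative sum of all [(a i - a j) ^+ 2]. *)
Lemma sqr_sum_le (R : realDomainType) (I : finType) (a : I -> R) :
  (\sum_i a i) ^+ 2 <= #|I|%:R * \sum_i a i ^+ 2.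
Proof.
have h : 0 <= \sum_i \sum_j (a i - a j) ^+ 2.
  by apply: sumr_ge0 => i _; apply: sumr_ge0 => j _; exact: sqr_ge0.
have e : \sum_i \sum_j (a i - a j) ^+ 2 =
    (#|I|%:R * \sum_i a i ^+ 2) *+ 2 - ((\sum_i a i) ^+ 2) *+ 2.
  under eq_bigr do under eq_bigr do rewrite sqrrB.
  under eq_bigr do rewrite big_split/= sumrB sumr_const -mulr_natl sumrMnl -mulr_sumr.
  rewrite big_split/= sumrB -mulr_sumr sumr_const -mulr_natl sumrMnl -mulr_suml -expr2.
  by rewrite !mulr2n; ring.
by move: h; rewrite e -mulrnBl pmulrn_lge0// subr_ge0.
Qed.

Lemma integrable_addr d (T : measurableType d) (R : realType)
    (mu : {measure set T -> \bar R}) (f g : T -> R) :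
  mu.-integrable setT (EFin \o f) -> mu.-integrable setT (EFin \o g) ->
  mu.-integrable setT (EFin \o (fun x => f x + g x)).
Proof.
move=> mf mg; rewrite (_ : _ \o _ = (EFin \o f) \+ (EFin \o g))//.
exact: integrableD.
Qed.

Lemma integrable_mulr d (T : measurableType d) (R : realType)
    (mu : {measure set T -> \bar R}) (a : R) (f : T -> R) :
  mu.-integrable setT (EFin \o f) ->
  mu.-integrable setT (EFin \o (fun x => a * f x)).
Proof.
by move=> mf; rewrite (_ : _ \o _ = fun x => a%:E * (EFin \o f) x)%E//; exact: integrableZl.
Qed.

(** * Second moments and the spectral measure *)

Section power_spectrum.
Context {R : realType} {d : nat}.
Implicit Types (u v : 'rV[R]_d -> R).

(** Half-open, so that a cube is tiled by translates of smaller ones without overlap. *)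
Definition cube (N : R) : set 'rV[R]_d := [set x | forall i, - N <= x ord0 i < N].

Lemma measurable_cell (a c : 'I_d -> R) :
  measurable [set x : 'rV[R]_d | forall i, a i <= x ord0 i < c i].
Proof.
rewrite (_ : [set x | _] = \bigcap_(i in [set: 'I_d])
    (rV_coord i @^-1` `[a i, c i[%classic)); last first.
  apply/seteqP; split => [x Ax i _|x Ax i] /=.
    by rewrite in_itv /=; exact: Ax.
  by have := Ax i I; rewrite /= in_itv.
apply: fin_bigcap_measurable => // i _.
by rewrite -[X in measurable X]setTI; apply: measurable_rV_coord.
Qed.

Lemma eball_cube (r N : R) : r < N -> @eball R d r `<=` cube N.
Proof.
move=> rN x xr i; have := eball_rbox xr i; rewrite ler_norml => /andP[h1 h2].
by apply/andP; split; lra.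
Qed.

Lemma cube_eball (N : R) : 0 <= N -> cube N `<=` eball (d%:R * N + 1).
Proof.
move=> N0 x xN; apply: rbox_eball => // i; have /andP[h1 h2] := xN i.
by rewrite ler_norml h1 ltW.
Qed.

Lemma lebesgue_rV_cube (N : R) : 0 <= N ->
  lebesgue_rV d (cube N) = ((2 * N) ^+ d)%:E.
Proof.
move=> N0; pose A (i : 'I_d) : set (measurableTypeR R) := `[- N, N[%classic.
have -> : cube N = [set x | forall i, A i (x ord0 i)].
  by apply/seteqP; split => x /= h i; have := h i; rewrite /A /= in_itv.
rewrite lebesgue_rV_box /A; last by move=> i; exact: measurable_itv.
have E : lebesgue_measure (`[- N, N[%classic : set R) = (2 * N)%:E.
  rewrite lebesgue_measure_itv/= lte_fin.
  have [->|Nn0] := eqVneq N 0; first by rewrite oppr0 ltxx mulr0.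
  have N1 : 0 < N by rewrite lt_neqAle eq_sym Nn0.
  rewrite ifT; last by lra.
  by rewrite -EFinD; congr EFin; lra.
under eq_bigr do rewrite E.
by rewrite prodEFin prodr_const card_ord.
Qed.

Lemma lebesgue_rV_locally_finite : locally_finite (lebesgue_rV d : {measure set 'rV[R]_d -> \bar R}).
Proof.
move=> B [mB [r Br]]; apply: (@le_lt_trans _ _ (lebesgue_rV d (cube (`|r| + 1)))).
  apply: le_measure; rewrite ?inE//; first exact: measurable_cell.
  by apply: (subset_trans Br); apply: eball_cube; have := ler_norm r; lra.
by rewrite lebesgue_rV_cube ?ltry// addr_ge0.
Qed.

Lemma measurable_cos_dotp (k : 'rV[R]_d) : measurable_fun setT (fun x => cos (dotp k x)).
Proof.
apply: (measurableT_comp (f := @cos R)).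
  by apply: continuous_measurable_fun; exact: continuous_cos.
by apply: measurable_dotp; [exact: measurable_cst|exact: measurable_id].
Qed.

Lemma measurable_sin_dotp (k : 'rV[R]_d) : measurable_fun setT (fun x => sin (dotp k x)).
Proof.
apply: (measurableT_comp (f := @sin R)).
  by apply: continuous_measurable_fun; exact: continuous_sin.
by apply: measurable_dotp; [exact: measurable_cst|exact: measurable_id].
Qed.

Lemma normr_cos_le1 (t : R) : `|cos t| <= 1.
Proof. by rewrite ler_norml cos_geN1 cos_le1. Qed.

Lemma normr_sin_le1 (t : R) : `|sin t| <= 1.
Proof. by rewrite ler_norml sin_geN1 sin_le1. Qed.

Lemma rtest_cos (k : 'rV[R]_d) u : rtest u -> rtest (fun x => cos (dotp k x) * u x).
Proof.
move=> tu; under eq_fun do rewrite mulrC; apply: rtestM => //.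
  exact: measurable_cos_dotp.
by exists 1 => x; exact: normr_cos_le1.
Qed.

Lemma rtest_sin (k : 'rV[R]_d) u : rtest u -> rtest (fun x => sin (dotp k x) * u x).
Proof.
move=> tu; under eq_fun do rewrite mulrC; apply: rtestM => //.
  exact: measurable_sin_dotp.
by exists 1 => x; exact: normr_sin_le1.
Qed.

Lemma rtest_lebesgue_integrable u : rtest u ->
  (lebesgue_rV d).-integrable setT (EFin \o u).
Proof. by move=> tu; exact: rtest_integrable lebesgue_rV_locally_finite tu. Qed.

Definition fcos u (k : 'rV[R]_d) : R := \int[lebesgue_rV d]_x (cos (dotp k x) * u x).
Definition fsin u (k : 'rV[R]_d) : R := \int[lebesgue_rV d]_x (sin (dotp k x) * u x).
(** For real [u], the squared modulus of its Fourier transform. *)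
Definition power u (k : 'rV[R]_d) : R := fcos u k ^+ 2 + fsin u k ^+ 2.

Lemma fourier_power u k : rtest u ->
  fourier (fun x => (u x)%:C%C) k * conjc (fourier (fun x => (u x)%:C%C) k) =
  Complex (power u k) 0.
Proof.
move=> tu.
have -> : fourier (fun x => (u x)%:C%C) k = Complex (fcos u k) (- fsin u k).
  rewrite /fourier /cintegral; congr Complex.
    by apply: eq_Rintegral => x _; rewrite /= cosN mulr0 subr0.
  rewrite /fsin -mulN1r -RintegralZl//; last exact/rtest_lebesgue_integrable/rtest_sin.
  by apply: eq_Rintegral => x _; rewrite /= sinN mulr0 add0r mulN1r mulNr.
by rewrite /power /conjc; apply/eqP; rewrite eq_complex /=; apply/andP; split; apply/eqP; ring.
Qed.

End power_spectrum.

Section second_moments.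
Context {R : realType} {d : nat} {disp : measure_display}
  {Omega : measurableType disp} (P : probability Omega R)
  (Phi : {mfun Omega >-> cmeasure R d}).
Implicit Types (u v : 'rV[R]_d -> R) (b : bool).

Definition rphi b u (w : Omega) : R := rintegral b (Phi w) u.

Lemma measurable_rphi b u : rtest u -> measurable_fun setT (rphi b u).
Proof.
move=> tu; apply: (measurableT_comp (measurable_rintegral b tu)).
exact: measurable_funPT.
Qed.

Definition sqm b u : \bar R := (\int[P]_w ((rphi b u w) ^+ 2)%:E)%E.

Let mrphi2 b u : rtest u -> measurable_fun setT (fun w => ((rphi b u w) ^+ 2)%:E).
Proof.
by move=> tu; apply/measurable_EFinP/measurable_funX; exact: measurable_rphi.
Qed.

Let tv2 : \bar R := (\int[P]_w (total_var (Phi w) (eball 1) ^+ 2))%E.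

Lemma sqm_unit_ball b u (K : R) : measurable_fun setT u ->
  (forall x, `|u x| <= K) -> (forall x, ~ eball 1 x -> u x = 0) ->
  (sqm b u <= (K ^+ 2)%:E * tv2)%E.
Proof.
move=> mu uK u1.
have tu : rtest u by split => //; [exists K|exists 1].
have K0 : 0 <= K by rewrite (le_trans _ (uK 0)).
have H w := rintegral_le_total_var b (Phi w) (bounded_borel_eball 1) mu uK u1.
have [K0'|Kn0] := eqVneq K 0.
  rewrite K0' expr0n/= mul0e /sqm integral0_eq// => w _.
  have := H w; rewrite K0' mul0e lee_fin normr_le0 => /eqP; rewrite /rphi => ->.
  by rewrite expr0n.
have Kp : 0 < K by rewrite lt_neqAle eq_sym Kn0.
(* The constant is moved to the side of [rphi b u], whose measurability is known, before the
   integrands are compared. *)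
rewrite -lee_pdivrMl ?exprn_gt0// /sqm -ge0_integralZl_EFin//; last 3 first.
- by move=> w _; rewrite lee_fin sqr_ge0.
- exact: mrphi2.
- by rewrite invr_ge0 exprn_ge0.
apply: le_integral_nonneg => w.
  by rewrite -EFinM lee_fin mulr_ge0 ?sqr_ge0// invr_ge0 exprn_ge0.
rewrite lee_pdivrMl ?exprn_gt0// EFin_expe.
have tv0 := total_var_ge0 (Phi w) (eball 1).
have -> : ((rphi b u w)%:E ^+ 2 = `|rphi b u w|%:E ^+ 2)%E.
  by rewrite -!EFin_expe real_normK ?num_real.
rewrite [leRHS](_ : _ = ((K%:E * total_var (Phi w) (eball 1)) ^+ 2)%E).
  by rewrite lee_sqr ?mule_ge0//; exact: H.
by rewrite !expe2 muleACA.
Qed.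

Variable theta : 'rV[R]_d -> Omega -> Omega.
Hypotheses (htheta : measurable_flow P theta) (hinv : invariant_cm Phi theta).

(** By invariance, translating [u] amounts to moving the sample point by the flow, which preserves
    [P]. *)
Lemma sqm_translate b u (z : 'rV[R]_d) : rtest u ->
  sqm b (fun x => u (x - z)) = sqm b u.
Proof.
move=> tu; have [_ _ mth pth] := htheta.
have mz : measurable_fun setT (theta z).
  exact: (measurable_fun_pair1 z mth).
have E w : rphi b (fun x => u (x - z)) w = rphi b u (theta z w).
  rewrite /rphi -(@rintegral_translate _ _ b z _ (Phi (theta z w)))//.
  by move=> B bB; exact: hinv.
rewrite /sqm; under eq_integral do rewrite E.
rewrite -[LHS](@ge0_integral_pushforward _ _ _ _ _ _ mz P setT
  (fun w => (rphi b u w ^+ 2)%:E))//; last 2 first.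
- exact: mrphi2.
- by move=> w _; rewrite lee_fin sqr_ge0.
by apply: eq_measure_integral => A mA _; exact: pth.
Qed.

(** The cube is cut into cells of side [1/d]. Translated to the origin, a cell lies in the unit
    ball, where [sqm_unit_ball] applies; translation does not change second moments, and
    [sqr_sum_le] adds up the cells. *)
Lemma sqm_cube (hd : (0 < d)%N) b u (K : R) (N : nat) : measurable_fun setT u ->
  (forall x, `|u x| <= K) -> (forall x, ~ cube N%:R x -> u x = 0) ->
  (sqm b u <= ((K * (2 * N * d)%:R ^+ d) ^+ 2)%:E * tv2)%E.
Proof.
move=> mu uK uN.
have K0 : 0 <= K by rewrite (le_trans _ (uK 0)).
have d0 : (0 : R) < d%:R by rewrite ltr0n.
(* Number of cells along each axis: length [2 * N] over side [1/d]. *)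
pose L := (2 * N * d)%N.
have [L0|L0] := posnP L.
  have -> : u = fun=> 0.
    apply/funext => x; apply: uN => /(_ (Ordinal hd)) /andP[h1 h2].
    move: L0 => /eqP; rewrite !muln_eq0 (gtn_eqF hd) orbF /= => /eqP N0.
    by move: h1 h2; rewrite N0; lra.
  rewrite /sqm integral0_eq; last by move=> w _; rewrite /rphi rintegral0 expr0n.
  rewrite mule_ge0 ?lee_fin ?sqr_ge0// integral_ge0// => w _; exact/expe_ge0/total_var_ge0.
pose I := {ffun 'I_d -> 'I_L}.
pose c (z : I) : 'rV[R]_d := \row_i ((z i)%:R / d%:R - N%:R).
pose Q (z : I) := [set x : 'rV[R]_d | forall i, c z ord0 i <= x ord0 i < c z ord0 i + d%:R^-1].
have mQ z : measurable (Q z) by exact: measurable_cell.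
pose uz z x := u x * \1_(Q z) x.
have muz z : measurable_fun setT (uz z).
  by apply: measurable_funM => //; exact: measurable_indic.
have uzK z x : `|uz z x| <= K.
  rewrite /uz normrM (le_trans _ (uK x))// ler_piMr//.
  by rewrite indicE; case: (_ \in _); rewrite ?normr0 ?normr1.
have uE : u = fun x => \sum_z uz z x.
  apply/funext => x; have [xN|xN] := pselect (cube N%:R x); last first.
    by rewrite uN// big1// => z _; rewrite /uz uN// mul0r.
  have h0 i : 0 <= (x ord0 i + N%:R) * d%:R.
    by rewrite mulr_ge0//; have := xN i; lra.
  have zL i : (Num.trunc ((x ord0 i + N%:R) * d%:R) < L)%N.
    rewrite truncn_lt_nat// /L !natrM ltr_pM2r//.
    by have := xN i; lra.
  pose z0 : I := [ffun i => Ordinal (zL i)].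
  have QP z : Q z x <-> z = z0.
    rewrite /Q /=; split.
      move=> xz; apply/ffunP => i; rewrite ffunE; apply/val_inj => /=.
      apply/esym/eqP; rewrite truncn_eq// -ler_pdivrMr// -[X in _ && X]ltr_pdivlMr//.
      by have := xz i; rewrite mxE -natr1 mulrDl mul1r; lra.
    move=> -> i; rewrite mxE ffunE/=.
    have /trunc_itv := h0 i; rewrite -ler_pdivrMr// -[X in _ && X]ltr_pdivlMr//.
    by rewrite -natr1 [(_ + 1) / _]mulrDl mul1r; lra.
  rewrite (bigD1 z0)//= big1 ?addr0 => [|z zz0].
    by rewrite /uz indicE mem_set ?mulr1//; exact/QP.
  by rewrite /uz indicE memNset ?mulr0// => /QP /eqP; rewrite (negbTE zz0).
have tuz z : rtest (uz z).
  split => //; first by exists K.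
  exists (d%:R * N%:R + 1) => x xN; rewrite /uz uN ?mul0r// => h; apply: xN.
  by apply: rbox_eball => // i; have := h i; rewrite ler_norml; lra.
have H z : (sqm b (uz z) <= (K ^+ 2)%:E * tv2)%E.
  pose v x := uz z (x + c z).
  have tv : rtest v.
    have := rtest_translate (- c z) (tuz z).
    by under eq_fun do rewrite opprK.
  have -> : uz z = fun x => v (x - c z).
    by apply/funext => x; rewrite /v subrK.
  rewrite sqm_translate//; apply: sqm_unit_ball.
  - by have [] := tv.
  - by move=> x; exact: uzK.
  (* Coordinates in [[0, 1/d[] have squares below [1/d], and there are [d] of them. *)
  - move=> x x1; rewrite /v /uz indicE memNset ?mulr0// => xQ; apply: x1.
    rewrite /eball /= /enorm -[ltRHS]sqrtr1 ltr_sqrt//.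
    have xi i : 0 <= x ord0 i < d%:R^-1.
      by have := xQ i; rewrite [(x + c z) ord0 i]mxE => /andP[h1 h2]; apply/andP; split; lra.
    apply: (@lt_le_trans _ _ (\sum_(i < d) (d%:R^-1 : R))); last first.
      by rewrite sumr_const card_ord -[_^-1 *+ _]mulr_natr mulVf ?gt_eqF.
    rewrite /dotp; apply: ltr_sum; first by apply/hasP; exists (Ordinal hd); rewrite ?mem_index_enum.
    move=> i _; have /andP[x0 xd] := xi i.
    apply: (@le_lt_trans _ _ (x ord0 i)) => //.
    rewrite ler_piMr// (le_trans (ltW xd))// invf_le1//.
    by rewrite ler1n.
rewrite [X in sqm b X]uE.
apply: (@le_trans _ _ (\int[P]_w (#|I|%:R%:E * \sum_z ((rphi b (uz z) w) ^+ 2)%:E))%E).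
  apply: le_integral_nonneg => w; first by rewrite lee_fin sqr_ge0.
  by rewrite sumEFin -EFinM lee_fin /rphi rintegral_sum//; exact: sqr_sum_le.
rewrite ge0_integralZl_EFin//; last 2 first.
- by move=> w _; apply: sume_ge0 => z _; rewrite lee_fin sqr_ge0.
- by apply: emeasurable_sum => z; exact: mrphi2.
rewrite ge0_integral_sum//; last 2 first.
- by move=> z; exact: mrphi2.
- by move=> z w _; rewrite lee_fin sqr_ge0.
apply: (@le_trans _ _ (#|I|%:R%:E * \sum_(z : I) ((K ^+ 2)%:E * tv2))%E).
  by apply: lee_wpmul2l => //; apply: lee_sum => z _; exact: H.
have t0 : (0 <= tv2)%E by apply: integral_ge0 => w _; exact/expe_ge0/total_var_ge0.
rewrite -ge0_sume_distrl; last by move=> z _; rewrite lee_fin sqr_ge0.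
rewrite sumEFin muleA -EFinM lee_wpmul2r// lee_fin sumr_const -[_ ^+ 2 *+ _]mulr_natl.
by rewrite card_ffun !card_ord natrX exprMn /L expr2; nra.
Qed.

Hypotheses (hsq : locally_abs_square_integrable P Phi) (hd : (0 < d)%N).

Lemma sqm_bound : exists2 C : R, 0 <= C & forall b u (K : R) (N : nat),
  measurable_fun setT u ->
  (forall x, `|u x| <= K) -> (forall x, ~ cube N%:R x -> u x = 0) ->
  (sqm b u <= (C * (K * N%:R ^+ d) ^+ 2)%:E)%E.
Proof.
have t0 : (0 <= tv2)%E by apply: integral_ge0 => w _; exact/expe_ge0/total_var_ge0.
have tE : tv2 = (fine tv2)%:E by rewrite fineK// ge0_fin_numE.
exists (fine tv2 * ((2 * d)%:R ^+ d) ^+ 2).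
  by rewrite mulr_ge0 ?sqr_ge0// fine_ge0.
move=> b u K N mu uK uN; rewrite (le_trans (sqm_cube hd b mu uK uN))//.
rewrite tE -EFinM lee_fin mulnAC (natrM _ _ N) [(_ * N%:R) ^+ d]exprMn.
by rewrite le_eqVlt; apply/orP; left; apply/eqP; ring.
Qed.

Lemma rtest_cube u : rtest u -> exists N : nat, forall x, ~ cube N%:R x -> u x = 0.
Proof.
move=> [mu _ [r ur]]; exists (Num.trunc `|r|).+1 => x xN; apply: ur => xr; apply: xN.
move=> i; have := eball_rbox xr i.
have := truncnS_gt `|r|; have := ler_norm r.
by rewrite ler_norml => h1 h2 /andP[h3 h4]; apply/andP; split; lra.
Qed.

Lemma sqm_lty b u : rtest u -> (sqm b u < +oo)%E.
Proof.
move=> tu; have [mu [K uK] _] := tu; have [N uN] := rtest_cube tu.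
have [C C0 H] := sqm_bound.
by rewrite (le_lt_trans (H b u K N mu uK uN))// ltry.
Qed.

Let isq b u : rtest u -> P.-integrable setT (fun w => ((rphi b u w) ^+ 2)%:E).
Proof.
move=> tu; apply/integrableP; split; first exact: mrphi2.
rewrite (eq_integral (fun w => ((rphi b u w) ^+ 2)%:E)); first exact: sqm_lty.
by move=> w _; rewrite gee0_abs// lee_fin sqr_ge0.
Qed.

Let i1 b u : rtest u -> P.-integrable setT (EFin \o rphi b u).
Proof.
move=> tu; apply: (@le_integrable _ _ _ P setT measurableT _
    (EFin \o (fun w => 1 + rphi b u w ^+ 2))).
- by apply/measurable_EFinP; exact: measurable_rphi.
- move=> w _ /=; rewrite lee_fin [leRHS]ger0_norm ?addr_ge0 ?sqr_ge0//.
  by rewrite -[rphi b u w ^+ 2]real_normK ?num_real//; have := sqr_ge0 (`|rphi b u w| - 1); nra.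
- apply: (@integrable_addr _ _ _ P (cst 1)) => //; last exact: isq.
  exact: finite_measure_integrable_cst.
Qed.

Definition mean b u : R := \int[P]_w rphi b u w.

(** For real [u], the covariance of the complex variable [Phi(u)] with itself: the cross terms of
    real and imaginary part cancel. *)
Definition variance2 u : R := \sum_(b : bool) \int[P]_w ((rphi b u w - mean b u) ^+ 2).

Lemma variance_sqm u : rtest u ->
  variance2 u = \sum_(b : bool) (fine (sqm b u) - mean b u ^+ 2).
Proof.
move=> tu; apply: eq_bigr => b _.
rewrite (@eq_Rintegral _ _ _ P setT (fun w => rphi b u w ^+ 2 +
   ((- 2 * mean b u) * rphi b u w + mean b u ^+ 2))); last by move=> w _; ring.
have ic := finite_measure_integrable_cst P (mean b u ^+ 2) measurableT.
have il := integrable_mulr (- 2 * mean b u) (i1 b tu).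
rewrite RintegralD//; [|exact: isq|exact: integrable_addr].
rewrite RintegralD//.
rewrite RintegralZl//; last exact: i1.
have -> : \int[P]__ (mean b u ^+ 2) = mean b u ^+ 2.
  by rewrite Rintegral_cst// (_ : fine (P setT) = 1) ?mulr1//; rewrite probability_setT.
by rewrite -/(mean b u) /sqm /Rintegral; ring.
Qed.

Lemma variance_le_sqm u : rtest u ->
  variance2 u <= \sum_(b : bool) fine (sqm b u).
Proof.
by move=> tu; rewrite variance_sqm//; apply: ler_sum => b _; rewrite gerBl sqr_ge0.
Qed.

Lemma variance_integrable b u : rtest u ->
  P.-integrable setT (fun w => ((rphi b u w - mean b u) ^+ 2)%:E).
Proof.
move=> tu.
have ic := finite_measure_integrable_cst P (mean b u ^+ 2) measurableT.
have il := integrable_mulr (- 2 * mean b u) (i1 b tu).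
rewrite (_ : (fun w => _) = EFin \o (fun w => rphi b u w ^+ 2 +
   ((- 2 * mean b u) * rphi b u w + mean b u ^+ 2))); last first.
  by apply/funext => w /=; congr EFin; ring.
by apply: integrable_addr; [exact: isq|exact: integrable_addr].
Qed.

Lemma variance_bartlett beta u : bartlett_measure P Phi beta -> rtest u ->
  beta.-integrable setT (EFin \o power u) /\
  variance2 u = (2 * pi) ^- d * \int[beta]_k power u k.
Proof.
move=> [lb H] tu.
have tc : test_function (fun x => (u x)%:C%C).
  have [mu [K uK] [r ur]] := tu; split.
  - by apply: measurable_complex => -[] //=; exact: measurable_cst.
  - by exists K => x /=; rewrite expr0n/= addr0 sqrtr_sqr.
  - by exists r => x /ur ->.
have := H _ _ tc tc => /=.
have -> : (fun k => fourier (fun x => (u x)%:C%C) k * conjc (fourier (fun x => (u x)%:C%C) k)) =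
    fun k => Complex (power u k) 0 by apply/funext => k; rewrite fourier_power.
move=> [[ip _] /(congr1 (fun z => complex.Re z)) E].
split => //; rewrite variance_sqm//.
rewrite big_bool /=.
have XE : (fun w => cmintegral (Phi w) setT (fun x => (u x)%:C%C)) =
    fun w => Complex (rphi true u w) (rphi false u w).
  by apply/funext => w; apply: cpart_eq => -[].
move: E; rewrite XE /ccovariance /cexpectation /cintegral /= mul0r subr0 => <-.
have -> : \int[P]_w (rphi true u w * rphi true u w - rphi false u w * - rphi false u w) =
    \int[P]_w (rphi true u w ^+ 2 + rphi false u w ^+ 2).
  by apply: eq_Rintegral => w _; rewrite mulrN opprK -!expr2.
rewrite RintegralD//; [|exact: isq..].
rewrite -[\int[P]_x complex.Re _]/(mean true u) -[\int[P]_x complex.Im _]/(mean false u).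
by rewrite /sqm /Rintegral; ring.
Qed.

End second_moments.

(** * Translation invariance of Lebesgue measure, and Fubini for real integrands *)

Lemma lebesgue_measure_shift (R : realType) (a : R) (A : set R) : measurable A ->
  lebesgue_measure ((fun x => x + a) @^-1` A) = lebesgue_measure A :> \bar R.
Proof.
move=> mA.
have mf : measurable_fun setT ((fun x => x + a) : measurableTypeR R -> measurableTypeR R).
  by apply: measurable_funD.
pose phi : {mfun measurableTypeR R >-> measurableTypeR R} :=
  HB.pack (fun x : measurableTypeR R => x + a : measurableTypeR R)
    (isMeasurableFun.Build _ _ _ _ (fun x : measurableTypeR R => x + a : measurableTypeR R) mf).
apply/esym; change (lebesgue_measure A = pushforward lebesgue_measure phi A).
apply: lebesgue_measure_unique => //= _ [[p q]] _ <-.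
rewrite /pushforward (_ : _ @^-1` _ = `]p - a, q - a]%classic); last first.
  by apply/seteqP; split => x /=; rewrite !in_itv /= ltrBlDr lerBrDr.
by rewrite !lebesgue_measure_itv/= !lte_fin ltrD2r -!EFinD; congr (if _ then _ else _); congr EFin; lra.
Qed.

Section lebesgue_translation.
Context {R : realType}.

Lemma measurable_shift_rV d (z : 'rV[R]_d) :
  measurable_fun setT (fun x : 'rV[R]_d => x + z).
Proof.
apply: measurable_fun_rV => i.
rewrite (_ : _ \o _ = fun x : 'rV[R]_d => rV_coord i x + z ord0 i); last first.
  by apply/funext => x; rewrite /= /rV_coord !mxE.
by apply: measurable_funD => //; exact: measurable_rV_coord.
Qed.

(** Induction along the recursive definition: on rectangles the shifted product measure splits into
    a shift of the line and a shift in one dimension less, and rectangles determine it. *)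
Lemma lebesgue_rV_shift d (z : 'rV[R]_d) (A : set 'rV[R]_d) : measurable A ->
  lebesgue_rV d ((fun x => x + z) @^-1` A) = lebesgue_rV d A.
Proof.
elim: d z A => [|d IHd] z A mA.
  congr (lebesgue_rV _ _); apply/seteqP; split => x /=;
    by rewrite (_ : x + z = x)//; apply/rowP => -[].
pose z0 := z ord0 ord0; pose z' : 'rV[R]_d := \row_j z ord0 (lift ord0 j).
pose S (p : measurableTypeR R * 'rV[R]_d) : measurableTypeR R * 'rV[R]_d :=
  (p.1 + z0, p.2 + z').
have mS : measurable_fun setT S.
  apply/measurable_fun_pairP; split.
    by apply: measurable_funD => //; exact: measurable_fst.
  apply: (measurableT_comp (measurable_shift_rV z')); exact: measurable_snd.
pose phi : {mfun (measurableTypeR R * 'rV[R]_d)%type >-> (measurableTypeR R * 'rV[R]_d)%type} :=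
  HB.pack S (isMeasurableFun.Build _ _ _ _ S mS).
rewrite /= /cons_measure /pushforward.
have e p : cons_rV (S p) = cons_rV p + z.
  apply/rowP => j; rewrite !mxE; case: unliftP => [i ->|->] //=.
  by rewrite !mxE.
rewrite (_ : _ @^-1` _ = S @^-1` (@cons_rV R d @^-1` A)); last first.
  by apply/seteqP; split => p /=; rewrite e.
have mX : measurable (@cons_rV R d @^-1` A).
  by rewrite -[X in measurable X]setTI; exact: measurable_cons_rV.
apply/esym; apply: (@product_measure_unique _ _ _ _ R
  (@lebesgue_measure R) (lebesgue_rV d) (pushforward (@lebesgue_measure R \x lebesgue_rV d)%E phi)) => //.
move=> B C mB mC; rewrite /pushforward.
transitivity ((@lebesgue_measure R \x lebesgue_rV d)%E
  (((fun x => x + z0) @^-1` B) `*` ((fun x => x + z') @^-1` C))).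
  by congr product_measure1.
rewrite product_measure1E; last 2 first.
- rewrite -[X in measurable X]setTI.
  by apply: (measurable_funD (f := id) (g := cst z0)).
- by rewrite -[X in measurable X]setTI; exact: measurable_shift_rV.
by congr (_ * _)%E; [exact: lebesgue_measure_shift|exact: IHd].
Qed.

Lemma Rintegral_shift d (z : 'rV[R]_d) (u : 'rV[R]_d -> R) : rtest u ->
  \int[lebesgue_rV d]_x u (x - z) = \int[lebesgue_rV d]_x u x.
Proof.
move=> tu; have tz := rtest_translate z tu.
pose phi : {mfun 'rV[R]_d >-> 'rV[R]_d} :=
  HB.pack (fun x : 'rV[R]_d => x + z)
    (isMeasurableFun.Build _ _ _ _ (fun x : 'rV[R]_d => x + z) (measurable_shift_rV z)).
rewrite /Rintegral; congr fine.
pose mu := pushforward (lebesgue_rV d) (phi : 'rV[R]_d -> 'rV[R]_d).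
transitivity (\int[mu]_x (u (x - z))%:E)%E.
  by apply: eq_measure_integral => A mA _; exact/esym/lebesgue_rV_shift.
rewrite integral_pushforward//; last 2 first.
- by apply/measurable_EFinP; have [] := tz.
- rewrite (_ : _ \o _ = EFin \o u); first exact: rtest_lebesgue_integrable.
  by apply/funext => x /=; rewrite addrK.
by rewrite preimage_setT; apply: eq_integral => x _ /=; rewrite addrK.
Qed.

End lebesgue_translation.

Section real_fubini.
Context d1 d2 (T1 : measurableType d1) (T2 : measurableType d2) (R : realType).
Variables (m1 : {sigma_finite_measure set T1 -> \bar R})
  (m2 : {sigma_finite_measure set T2 -> \bar R}).

Lemma measurable_Rintegral2 (h : T1 -> T2 -> R) :
  measurable_fun setT (fun z : T1 * T2 => h z.1 z.2) ->
  measurable_fun setT (fun x => \int[m2]_y h x y).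
Proof.
move=> mh; apply: (measurableT_comp (f := fine)) => //.
pose f (z : T1 * T2) := (h z.1 z.2)%:E.
have mf : measurable_fun setT f by exact/measurable_EFinP.
rewrite (_ : (fun x => _) = fun x => (\int[m2]_y (f^\+ (x, y)) - \int[m2]_y (f^\- (x, y)))%E); last first.
  apply/funext => x; rewrite [LHS]integralE.
  by congr (_ - _)%E; apply: eq_integral => y _; rewrite /f ?funeposE ?funenegE.
apply: emeasurable_funB.
- by apply: (measurable_fun_fubini_tonelli_F (m2 := m2) (f^\+)%E) => //; exact: measurable_funepos.
- by apply: (measurable_fun_fubini_tonelli_F (m2 := m2) (f^\-)%E) => //; exact: measurable_funeneg.
Qed.

Lemma Rintegral_fubini (h : T1 -> T2 -> R) :
  (m1 \x m2)%E.-integrable setT (fun z => (h z.1 z.2)%:E) ->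
  (forall x, m2.-integrable setT (fun y => (h x y)%:E)) ->
  (forall y, m1.-integrable setT (fun x => (h x y)%:E)) ->
  \int[m1]_x \int[m2]_y h x y = \int[m2]_y \int[m1]_x h x y.
Proof.
move=> ih i2 i1; rewrite /Rintegral; congr fine.
have := Fubini ih => /= E.
transitivity (\int[m1]_x \int[m2]_y (h x y)%:E)%E.
  by apply: eq_integral => x _; rewrite fineK//; exact: integrable_fin_num.
by rewrite E; apply: eq_integral => y _; rewrite fineK//; exact: integrable_fin_num.
Qed.

End real_fubini.

(** * Smoothed monomials *)

Section averaging.
Context {R : realType} {d : nat}.
Implicit Types (u : 'rV[R]_d -> R) (v k : 'rV[R]_d).

Let I01 : set (measurableTypeR R) := `[0, 1]%classic.

Let mI01 : measurable I01. Proof. exact: measurable_itv. Qed.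

Let ind_ge0 (s : R) : 0 <= \1_I01 s :> R.
Proof. by rewrite indicE. Qed.

Let ind_le1 (s : R) : \1_I01 s <= 1 :> R.
Proof. by rewrite indicE; case: (_ \in _). Qed.

(** The convolution of [u] with the uniform distribution on the segment from [0] to [v]. *)
Definition average v u (x : 'rV[R]_d) : R :=
  \int[lebesgue_measure]_s (\1_I01 s * u (x - s *: v)).

Let i01 : lebesgue_measure.-integrable setT (EFin \o (\1_I01 : R -> R)).
Proof.
exact: integrable_indic_itv.
Qed.

Let int01 : \int[lebesgue_measure]_s (\1_I01 s : R) = 1.
Proof.
have E : lebesgue_measure (`[0, 1]%classic : set R) = 1%E.
  by rewrite lebesgue_measure_itv/= lte01 oppr0 adde0.
by rewrite /Rintegral integral_indic// setIT; exact: (congr1 fine E).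
Qed.

Let bdd_integrable (f : R -> R) (M : R) : measurable_fun setT f ->
  (forall s, `|f s| <= M) ->
  lebesgue_measure.-integrable setT (EFin \o (fun s => \1_I01 s * f s)).
Proof.
move=> mf fM; apply: (le_integrable _ _ _ (integrable_mulr M i01)) => //.
  apply/measurable_EFinP/measurable_funM => //; exact: measurable_indic.
move=> s _ /=; rewrite lee_fin normrM (le_trans _ (ler_norm _))//.
by rewrite ger0_norm// mulrC ler_wpM2r.
Qed.

Let mshear v : measurable_fun setT
  (fun z : 'rV[R]_d * measurableTypeR R => z.1 - z.2 *: v).
Proof.
apply: measurable_fun_rV => i.
rewrite (_ : _ \o _ = fun z : 'rV[R]_d * measurableTypeR R =>
    rV_coord i z.1 - z.2 * v ord0 i); last first.
  by apply/funext => x; rewrite /= /rV_coord !mxE.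
apply: measurable_funB.
  apply: (measurableT_comp (measurable_rV_coord i)); exact: measurable_fst.
by apply: measurable_funM => //; exact: measurable_snd.
Qed.

Let mkern v u : measurable_fun setT u -> measurable_fun setT
  (fun z : 'rV[R]_d * measurableTypeR R => \1_I01 z.2 * u (z.1 - z.2 *: v)).
Proof.
move=> mu; apply: measurable_funM; last exact: measurableT_comp mu (mshear v).
apply: (measurableT_comp (measurable_indic mI01)); exact: measurable_snd.
Qed.

Let msec v u x : measurable_fun setT u ->
  measurable_fun setT (fun s : R => u (x - s *: v)).
Proof.
move=> mu; apply: (measurableT_comp mu).
exact: (measurable_fun_pair2 x (mshear v)).
Qed.

Lemma average_bound v u (K : R) : measurable_fun setT u ->
  (forall x, `|u x| <= K) -> forall x, `|average v u x| <= K.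
Proof.
move=> mu uK x.
have i := bdd_integrable (msec v x mu) (fun s => uK _).
rewrite (le_trans (le_normr_Rintegral measurableT i))//.
have -> : K = \int[lebesgue_measure]_s (K * \1_I01 s).
  by rewrite RintegralZl// int01 mulr1.
apply: le_Rintegral => //; first exact: integrable_norm i.
  exact: integrable_mulr.
by move=> s _; rewrite normrM ger0_norm// mulrC ler_wpM2r.
Qed.

(* The value of [average v u] only depends on the segment [[x - v, x]]. *)
Lemma average_local v u w (x : 'rV[R]_d) :
  (forall s, 0 <= s <= 1 -> u (x - s *: v) = w (x - s *: v)) ->
  average v u x = average v w x.
Proof.
move=> uw; apply: eq_Rintegral => s _; rewrite indicE.
have [/set_mem|] := boolP (s \in I01); last by rewrite !mul0r.
by rewrite /I01 /= in_itv /= => /uw ->.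
Qed.

Lemma average_cube v u (N V : R) : (forall i, `|v ord0 i| <= V) ->
  (forall x, ~ cube N x -> u x = 0) ->
  forall x, ~ cube (N + V) x -> average v u x = 0.
Proof.
move=> vV uN x xN; rewrite /average (_ : (fun s => _) = cst 0).
  by rewrite /Rintegral integral0.
apply/funext => s; rewrite indicE.
have [/set_mem|] := boolP (s \in I01); last by rewrite mul0r.
rewrite /I01 /= in_itv /= => /andP[s0 s1]; rewrite mul1r uN// => h; apply: xN => i.
have := h i; rewrite !mxE; have := vV i; rewrite ler_norml => /andP[h1 h2] /andP[h3 h4].
apply/andP; split; nra.
Qed.

Lemma rtest_average v u : rtest u -> rtest (average v u).
Proof.
move=> tu; have [mu [K uK] _] := tu; have [N uN] := rtest_cube tu; split.
- have H := @measurable_Rintegral2 _ _ 'rV[R]_d (measurableTypeR R) R lebesgue_measure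
    (fun x s => \1_I01 s * u (x - s *: v)) (mkern v mu).
  exact: H.
- by exists K; exact: average_bound.
- pose V := \sum_i `|v ord0 i|.
  have vV i : `|v ord0 i| <= V by rewrite /V (bigD1 i)//= lerDl sumr_ge0.
  have V0 : 0 <= V by rewrite sumr_ge0.
  exists (d%:R * (N%:R + V) + 1) => x xN; apply: (average_cube vV uN) => h.
  by apply: xN; apply: cube_eball => //; rewrite addr_ge0.
Qed.

(** Moves the average from [u] to [g]. With [g] a cosine or a sine, the addition formulas then turn
    averaging into multiplication in frequency space. *)
Lemma fubini_average v u (g : 'rV[R]_d -> R) : rtest u -> measurable_fun setT g ->
  (forall x, `|g x| <= 1) ->
  \int[lebesgue_rV d]_x (g x * average v u x) =
  \int[lebesgue_measure]_s (\1_I01 s * \int[lebesgue_rV d]_x (g (x + s *: v) * u x)).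
Proof.
move=> tu mg g1; have [mu [K uK] _] := tu; have [N uN] := rtest_cube tu.
have K0 : 0 <= K by rewrite (le_trans _ (uK 0)).
pose h x s := g x * (\1_I01 s * u (x - s *: v)).
have mh : measurable_fun setT (fun z : 'rV[R]_d * measurableTypeR R => h z.1 z.2).
  apply: measurable_funM; last exact: mkern.
  exact: (measurableT_comp mg measurable_fst).
have hK x s : `|h x s| <= K.
  rewrite /h normrM (le_trans (ler_piMl _ (g1 x)))// normrM ger0_norm//.
  by rewrite (le_trans (ler_piMl _ (ind_le1 s))).
pose V := \sum_i `|v ord0 i|.
have vV i : `|v ord0 i| <= V by rewrite /V (bigD1 i)//= lerDl sumr_ge0.
have V0 : 0 <= V by rewrite sumr_ge0.
pose A : set ('rV[R]_d * measurableTypeR R) := cube (N%:R + V) `*` I01.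
have mA : measurable A by apply: measurableX => //; exact: measurable_cell.
have hA x s : ~ A (x, s) -> h x s = 0.
  move=> nA; rewrite /h indicE; have [/set_mem sI|] := boolP (s \in I01); last by rewrite mul0r mulr0.
  rewrite uN ?mulr0// => xN; apply: nA; split => //= i.
  have := xN i; rewrite !mxE; have := vV i; rewrite ler_norml => /andP[h1 h2] /andP[h3 h4].
  move: sI; rewrite /I01 /= in_itv/= => /andP[s0 s1].
  by apply/andP; split; nra.
have ih : (lebesgue_rV d \x lebesgue_measure)%E.-integrable setT
    (fun z : 'rV[R]_d * measurableTypeR R => (h z.1 z.2)%:E).
  rewrite (_ : (fun z => _) = (EFin \o (fun z => h z.1 z.2)) \_ A); last first.
    apply/funext => -[x s]; rewrite patchE; case: ifPn => //= /negP xA.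
    by rewrite hA// => xsA; apply: xA; rewrite inE.
  apply/(integrable_mkcond _ mA).
  apply: measurable_bounded_integrable => //; last 2 first.
  - exact: measurable_funTS.
  - exists K; split; first exact: num_real.
    by move=> y Ky z _ /=; rewrite (le_trans (hK _ _))// ltW.
  have e : (lebesgue_rV d \x lebesgue_measure)%E A =
      (lebesgue_rV d (cube (N%:R + V)) * lebesgue_measure I01)%E.
    by apply: product_measure1E => //; exact: measurable_cell.
  apply: (@le_lt_trans _ _ ((lebesgue_rV d \x lebesgue_measure)%E A)) => //.
  rewrite e lebesgue_rV_cube ?addr_ge0//.
  have -> : lebesgue_measure I01 = 1%E by rewrite /I01 lebesgue_measure_itv/= lte01 oppr0 adde0.
  by rewrite mule1 ltry.
have i2 x : lebesgue_measure.-integrable setT (fun s : measurableTypeR R => (h x s)%:E).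
  exact: integrable_mulr (bdd_integrable (msec v x mu) (fun s => uK _)).
have tw s : rtest (fun y => g (y + s *: v) * u y).
  under eq_fun do rewrite mulrC; apply: rtestM => //.
    exact: (measurableT_comp mg (measurable_shift_rV (s *: v))).
  by exists 1 => x.
have hE s : (fun x => h x s) =
    fun x => \1_I01 s * (fun y => g (y + s *: v) * u y) (x - s *: v).
  by apply/funext => x; rewrite /h subrK; ring.
have i1 s : (lebesgue_rV d).-integrable setT (fun x => (h x s)%:E).
  rewrite (_ : (fun x => _) = EFin \o (fun x => h x s))// hE.
  apply/integrable_mulr/rtest_lebesgue_integrable.
  exact: (rtest_translate (s *: v) (tw s)).
have := Rintegral_fubini ih i2 i1.
rewrite (_ : \int[lebesgue_rV d]_x \int[lebesgue_measure]_y h x y =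
    \int[lebesgue_rV d]_x (g x * average v u x)); last first.
  apply: eq_Rintegral => x _; rewrite /average -RintegralZl//.
  exact: (bdd_integrable (msec v x mu) (fun s => uK _)).
move=> ->; apply: eq_Rintegral => s _.
rewrite -(Rintegral_shift (s *: v) (tw s)) -RintegralZl//; first by rewrite -hE.
exact: rtest_lebesgue_integrable (rtest_translate (s *: v) (tw s)).
Qed.

(** With [avg_sin], the real and imaginary part of the mean of [e^(ist)] over [[0, 1]]: up to
    conjugation, the Fourier multiplier of an average. *)
Definition avg_cos (t : R) : R := \int[lebesgue_measure]_s (\1_I01 s * cos (s * t)).
Definition avg_sin (t : R) : R := \int[lebesgue_measure]_s (\1_I01 s * sin (s * t)).

Let mcos t : measurable_fun setT (fun s : R => cos (s * t)).
Proof.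
apply: (measurableT_comp (f := @cos R)).
  by apply: continuous_measurable_fun; exact: continuous_cos.
by apply: measurable_funM => //; exact: measurable_cst.
Qed.

Let msin t : measurable_fun setT (fun s : R => sin (s * t)).
Proof.
apply: (measurableT_comp (f := @sin R)).
  by apply: continuous_measurable_fun; exact: continuous_sin.
by apply: measurable_funM => //; exact: measurable_cst.
Qed.

Let icos t := bdd_integrable (mcos t) (fun s => normr_cos_le1 (s * t)).
Let isin t := bdd_integrable (msin t) (fun s => normr_sin_le1 (s * t)).

Lemma avg_lin (a c t : R) :
  \int[lebesgue_measure]_s (\1_I01 s * (a * cos (s * t) + c * sin (s * t))) =
  a * avg_cos t + c * avg_sin t.
Proof.
rewrite /avg_cos /avg_sin -!RintegralZl// -RintegralD//; [|exact: integrable_mulr..].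
by apply: eq_Rintegral => s _; ring.
Qed.

(** With [c] and [s] the two averages, [c^2 + s^2] is the mean of [c cos + s sin], and this
    integrand is at most [(c^2 + s^2 + 1) / 2]. *)
Lemma avg_symbol_le1 (t : R) : avg_cos t ^+ 2 + avg_sin t ^+ 2 <= 1.
Proof.
set c := avg_cos t; set s := avg_sin t.
have E : c ^+ 2 + s ^+ 2 =
    \int[lebesgue_measure]_x (\1_I01 x * (c * cos (x * t) + s * sin (x * t))).
  by rewrite avg_lin !expr2.
have H : c ^+ 2 + s ^+ 2 <= \int[lebesgue_measure]_x ((c ^+ 2 + s ^+ 2 + 1) / 2 * \1_I01 x).
  rewrite {1}E; apply: le_Rintegral => //.
  - rewrite (_ : _ \o _ = EFin \o (fun x => c * (\1_I01 x * cos (x * t)) + s * (\1_I01 x * sin (x * t)))).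
      by apply: integrable_addr; exact: integrable_mulr.
    by apply/funext => x /=; congr EFin; ring.
  - exact: integrable_mulr.
  - move=> x _; rewrite mulrC ler_wpM2r//.
    have := sqr_ge0 (c - cos (x * t)); have := sqr_ge0 (s - sin (x * t)).
    by have := cos2Dsin2 (x * t); nra.
by move: H; rewrite RintegralZl// int01 mulr1; lra.
Qed.

Let avgE (f : R -> R) : \int[lebesgue_measure]_s (\1_I01 s * f s) =
  \int[lebesgue_measure]_(s in `[0, 1]) f s.
Proof.
rewrite [RHS]Rintegral_mkcond; apply: eq_Rintegral => s _.
by rewrite patchE indicE; case: (_ \in _); rewrite ?mul1r ?mul0r.
Qed.

Let FTC01 (F f : R -> R) : (forall x : R, is_derive x (1 : R) F (f x)) -> continuous f ->
  \int[lebesgue_measure]_(s in `[0, 1]) f s = F 1 - F 0.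
Proof.
move=> dF cf.
have cF : continuous F.
  move=> x; apply: differentiable_continuous; apply/derivable1_diffP.
  exact: (@ex_derive _ _ _ _ _ _ _ (dF x)).
rewrite /Rintegral (@continuous_FTC2 _ f F)//.
- exact: continuous_subspaceT.
- split.
  + by move=> x _; exact: (@ex_derive _ _ _ _ _ _ _ (dF x)).
  + by apply: cvg_at_right_filter; exact: cF.
  + by apply: cvg_at_left_filter; exact: cF.
- by move=> x _; rewrite derive1E; exact: (@derive_val _ _ _ _ _ _ _ (dF x)).
Qed.

(** The averages are [sin t / t] and [(1 - cos t) / t], whose squares add up to
    [2 (1 - cos t) / t^2]. *)
Lemma avg_symbol_decay (t : R) : t != 0 ->
  avg_cos t ^+ 2 + avg_sin t ^+ 2 <= 4 / t ^+ 2.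
Proof.
move=> t0.
have c1 : continuous (fun s : R => s * t) by move=> x; apply: mulrr_continuous.
have -> : avg_cos t = sin t / t.
  rewrite /avg_cos avgE.
  have dF (x : R) : is_derive x (1 : R) (fun s : R => sin (s * t) / t) (cos (x * t)).
    apply: is_derive_eq.
    by rewrite /GRing.scale /=; field.
  rewrite (FTC01 dF); first by rewrite mul1r mul0r sin0 mul0r subr0.
  by move=> x; apply: continuous_comp; [exact: c1|exact: continuous_cos].
have -> : avg_sin t = (1 - cos t) / t.
  rewrite /avg_sin avgE.
  have dF (x : R) : is_derive x (1 : R) (fun s : R => - cos (s * t) / t) (sin (x * t)).
    apply: is_derive_eq.
    by rewrite /GRing.scale /=; field.
  rewrite (FTC01 dF); first by rewrite mul1r mul0r cos0; ring.
  by move=> x; apply: continuous_comp; [exact: c1|exact: continuous_sin].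
rewrite !expr_div_n -mulrDl ler_wpM2r ?invr_ge0 ?sqr_ge0//.
by have := cos2Dsin2 t; have := cos_geN1 t; nra.
Qed.

Lemma power_average v u k : rtest u ->
  power (average v u) k =
  power u k * (avg_cos (dotp k v) ^+ 2 + avg_sin (dotp k v) ^+ 2).
Proof.
move=> tu; set t := dotp k v.
have kE x s : dotp k (x + s *: v) = dotp k x + s * t.
  rewrite /t /dotp mulr_sumr -big_split/=; apply: eq_bigr => i _.
  by rewrite !mxE; ring.
have ic := rtest_lebesgue_integrable (rtest_cos k tu).
have isn := rtest_lebesgue_integrable (rtest_sin k tu).
have -> : power (average v u) k = (fcos u k * avg_cos t - fsin u k * avg_sin t) ^+ 2 +
    (fsin u k * avg_cos t + fcos u k * avg_sin t) ^+ 2.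
  rewrite /power; congr (_ ^+ 2 + _ ^+ 2).
    rewrite {1}/fcos fubini_average//; [|exact: measurable_cos_dotp|by move=> x; exact: normr_cos_le1].
    rewrite -mulNr -avg_lin; apply: eq_Rintegral => s _; congr (_ * _).
    rewrite mulNr [_ * cos _]mulrC [fsin u k * _]mulrC /fcos /fsin -!RintegralZl// -RintegralB//; [|exact: integrable_mulr..].
    by apply: eq_Rintegral => x _; rewrite kE cosD; ring.
  rewrite {1}/fsin fubini_average//; [|exact: measurable_sin_dotp|by move=> x; exact: normr_sin_le1].
  rewrite -avg_lin; apply: eq_Rintegral => s _; congr (_ * _).
  rewrite [_ * cos _]mulrC [fcos u k * _]mulrC /fcos /fsin -!RintegralZl// -RintegralD//; [|exact: integrable_mulr..].
  by apply: eq_Rintegral => x _; rewrite kE sinD; ring.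
by rewrite /power; ring.
Qed.

End averaging.

(** * Monomials, their cut-offs and their iterated averages *)

Section polynomial_test_functions.
Context {R : realType} {d : nat}.
Implicit Types (u : 'rV[R]_d -> R) (v k x : 'rV[R]_d) (l : seq 'I_d).

(** A multi-index is a list of coordinates with repetition: the degree is the length, and
    multiplication by a coordinate is a [cons]. *)
Definition monomial l x : R := \prod_(i <- l) x ord0 i.

Definition polynomial (s : seq (R * seq 'I_d)) x : R :=
  \sum_(p <- s) p.1 * monomial p.2 x.

Lemma polynomial_cons p s x :
  polynomial (p :: s) x = p.1 * monomial p.2 x + polynomial s x.
Proof. by rewrite /polynomial big_cons. Qed.

Lemma monomial_cons i l x : monomial (i :: l) x = x ord0 i * monomial l x.
Proof. by rewrite /monomial big_cons. Qed.

Lemma measurable_monomial l : measurable_fun setT (monomial l).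
Proof.
elim: l => [|i l ih]; rewrite /monomial.
  by under eq_fun do rewrite big_nil; exact: measurable_cst.
by under eq_fun do rewrite big_cons; apply: measurable_funM => //; exact: measurable_rV_coord.
Qed.

(** An entry [(e, (a, l'))] of [s] stands for the term [t^e a x^l']. The powers of [t] are kept
    apart because [t] is integrated out afterwards. *)
Lemma monomial_shift v l : exists s : seq (nat * (R * seq 'I_d)),
  all (fun p => (size p.2.2 < size l)%N) s /\
  forall x t, monomial l (x - t *: v) =
    monomial l x + \sum_(p <- s) t ^+ p.1 * (p.2.1 * monomial p.2.2 x).
Proof.
elim: l => [|i l [s [sl sE]]].
  by exists [::]; split => // x t; rewrite big_nil addr0 /monomial !big_nil.
exists ([seq (p.1, (p.2.1, i :: p.2.2)) | p <- s] ++ (1%N, (- v ord0 i, l)) ::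
        [seq (p.1.+1, (- v ord0 i * p.2.1, p.2.2)) | p <- s]); split.
  rewrite all_cat /= ltnSn /= !all_map; apply/andP; split.
    by apply: sub_all sl => p /=; rewrite ltnS.
  by apply: sub_all sl => p /= h; rewrite ltnS ltnW.
move=> x t; rewrite {1 2}/monomial !big_cons -!/(monomial _ _) sE.
rewrite big_cat big_cons !big_map /= !mxE expr1 mulrDl mulrDr -addrA; congr (_ + _).
rewrite mulr_sumr mulrDr mulr_sumr; congr (_ + (_ + _)).
- by apply: eq_bigr => p _; rewrite /monomial big_cons; ring.
- by rewrite /monomial; ring.
- by apply: eq_bigr => p _; rewrite exprS; ring.
Qed.

Lemma polynomial_shift v (q : nat) (s : seq (R * seq 'I_d)) :
  all (fun p => (size p.2 < q)%N) s ->
  exists s' : seq (nat * (R * seq 'I_d)),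
  all (fun p => (size p.2.2 < q)%N) s' /\
  forall x t, polynomial s (x - t *: v) =
    \sum_(p <- s') t ^+ p.1 * (p.2.1 * monomial p.2.2 x).
Proof.
elim: s => [_|[c l] s ih /= /andP[lq sq]].
  by exists [::]; split => // x t; rewrite /polynomial !big_nil.
have [s1 [s1q s1E]] := ih sq; have [s2 [s2l s2E]] := monomial_shift v l.
exists ((0%N, (c, l)) :: [seq (p.1, (c * p.2.1, p.2.2)) | p <- s2] ++ s1); split.
  rewrite /= lq all_cat all_map s1q andbT.
  by apply: sub_all s2l => p /= h; exact: ltn_trans lq.
move=> x t; rewrite polynomial_cons s1E s2E.
rewrite big_cons big_cat big_map /= expr0 mul1r mulrDr -addrA; congr (_ + (_ + _)).
by rewrite mulr_sumr; apply: eq_bigr => p _; ring.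
Qed.

Let I01 : set (measurableTypeR R) := `[0, 1]%classic.

Let ipow (e : nat) : lebesgue_measure.-integrable setT
  (EFin \o (fun s : measurableTypeR R => \1_I01 s * s ^+ e)).
Proof.
have mI : measurable I01 by exact: measurable_itv.
apply: (le_integrable _ _ _ (@integrable_indic_itv R 0 1 true false)) => //.
  apply/measurable_EFinP/measurable_funM; first exact: measurable_indic.
  exact: exprn_measurable.
move=> s _ /=; rewrite lee_fin !indicE; have [/set_mem|] := boolP (s \in I01); last first.
  by rewrite mul0r normr0.
rewrite /I01 /= in_itv /= => /andP[s0 s1].
by rewrite mul1r normr1 ger0_norm ?exprn_ge0// exprn_ile1.
Qed.

(** Integration over the shift replaces each [t^e] by the constant [m e], with [m 0 = 1]: the
    leading monomial keeps its coefficient and only terms of lower degree change. *)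
Lemma average_polynomial v l (s : seq (R * seq 'I_d)) :
  all (fun p => (size p.2 < size l)%N) s ->
  exists2 s' : seq (R * seq 'I_d), all (fun p => (size p.2 < size l)%N) s' &
  forall x, average v (fun y => monomial l y + polynomial s y) x =
    monomial l x + polynomial s' x.
Proof.
move=> sl.
have [s1 [s1l s1E]] := polynomial_shift v sl; have [s2 [s2l s2E]] := monomial_shift v l.
pose m e := \int[lebesgue_measure]_s (\1_I01 s * s ^+ e) : R.
exists [seq (m p.1 * p.2.1, p.2.2) | p <- s2 ++ s1].
  by rewrite all_map all_cat; apply/andP.
move=> x; rewrite /average.
transitivity (\int[lebesgue_measure]_t (monomial l x * (\1_I01 t * t ^+ 0) +
   \sum_(p <- s2 ++ s1) (p.2.1 * monomial p.2.2 x) * (\1_I01 t * t ^+ p.1))).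
  apply: eq_Rintegral => t _; rewrite s1E s2E -addrA -big_cat /= expr0 mulrDr mulr_sumr.
  by congr (_ + _); [ring|apply: eq_bigr => p _; ring].
have isum (r : seq (nat * (R * seq 'I_d))) : lebesgue_measure.-integrable setT (EFin \o
    (fun t => \sum_(p <- r) (p.2.1 * monomial p.2.2 x) * (\1_I01 t * t ^+ p.1))).
  elim: r => [|p r ih].
    under [X in EFin \o X]eq_fun do rewrite big_nil.
    by have := integrable_mulr 0 (ipow 0); under [X in EFin \o X]eq_fun do rewrite mul0r.
  under [X in EFin \o X]eq_fun do rewrite big_cons.
  by apply: integrable_addr => //; exact: integrable_mulr (ipow _).
have Esum (r : seq (nat * (R * seq 'I_d))) : \int[lebesgue_measure]_t
    (\sum_(p <- r) (p.2.1 * monomial p.2.2 x) * (\1_I01 t * t ^+ p.1)) =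
    \sum_(p <- r) (p.2.1 * monomial p.2.2 x) * m p.1.
  elim: r => [|p r ih].
    under eq_Rintegral do rewrite big_nil.
    by rewrite big_nil /Rintegral integral0.
  under eq_Rintegral do rewrite big_cons.
  rewrite RintegralD; [|by []|exact: integrable_mulr (ipow _)|exact: isum].
  by rewrite RintegralZl//= ?big_cons ?ih.
rewrite RintegralD; [|by []|exact: integrable_mulr (ipow _)|exact: isum].
rewrite RintegralZl//= Esum; congr (_ + _).
  rewrite (_ : \int[_]_x _ = 1) ?mulr1//.
  under eq_Rintegral do rewrite expr0 mulr1.
  rewrite /Rintegral integral_indic//; last exact: measurable_itv.
  rewrite setIT.
  have E : lebesgue_measure (`[0, 1]%classic : set R) = 1%E.
    by rewrite lebesgue_measure_itv/= lte01 oppr0 adde0.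
  exact: (congr1 fine E).
by rewrite /polynomial big_map; apply: eq_bigr => p _ /=; ring.
Qed.

(* [avg_dirs T n] lists [n e_j] with multiplicity [T], for every basis vector [e_j]. *)
Definition avg_dirs (T n : nat) : seq 'rV[R]_d :=
  flatten [seq nseq T (\row_i ((i == j)%:R * n%:R)) | j : 'I_d].

Definition averages (vs : seq 'rV[R]_d) u : 'rV[R]_d -> R := foldr average u vs.

Definition cut_monomial l (N : nat) x : R := monomial l x * \1_(cube N%:R) x.

(* The cut-off is taken so wide that it is not seen on the cube of size [n]. *)
Definition smooth_monomial l (T n : nat) : 'rV[R]_d -> R :=
  averages (avg_dirs T n) (cut_monomial l ((d * T).+1 * n)).

Lemma size_avg_dirs T n : size (avg_dirs T n) = (d * T)%N.
Proof.
rewrite /avg_dirs size_flatten /shape -map_comp.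
rewrite (eq_map (g := fun=> T)); last by move=> j /=; rewrite size_nseq.
by rewrite sumnE big_map big_enum /= sum_nat_const card_ord.
Qed.

Lemma avg_dirs_le T n v : v \in avg_dirs T n -> forall i, `|v ord0 i| <= n%:R.
Proof.
move=> /flattenP[_ /mapP[j _ ->]] /nseqP[-> _] i; rewrite mxE normrM !normr_nat.
by case: (i == j); rewrite ?mul1r ?mul0r.
Qed.

Lemma monomial_bound l x (N : R) : (forall i, `|x ord0 i| <= N) ->
  `|monomial l x| <= N ^+ size l.
Proof.
move=> xN; elim: l => [|i l ih]; first by rewrite /monomial big_nil normr1.
by rewrite monomial_cons normrM exprS ler_pM.
Qed.

Lemma cut_monomial_bound l (N : nat) x : `|cut_monomial l N x| <= N%:R ^+ size l.
Proof.
rewrite /cut_monomial indicE.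
have [/set_mem xN|] := boolP (x \in _); last by rewrite mulr0 normr0 exprn_ge0.
rewrite mulr1; apply: monomial_bound => i.
by have /andP[h1 h2] := xN i; rewrite ler_norml h1 ltW.
Qed.

Lemma cut_monomial_out l (N : nat) x : ~ cube N%:R x -> cut_monomial l N x = 0.
Proof. by move=> xN; rewrite /cut_monomial indicE memNset ?mulr0. Qed.

Lemma rtest_cut_monomial l N : rtest (cut_monomial l N).
Proof.
have mc : measurable (@cube R d N%:R) by exact: measurable_cell.
split.
- apply: measurable_funM; first exact: measurable_monomial.
  exact: measurable_indic.
- by exists (N%:R ^+ size l) => x; exact: cut_monomial_bound.
- exists (d%:R * N%:R + 1) => x xN; apply: cut_monomial_out => h; apply: xN.
  exact: cube_eball.
Qed.

Lemma rtest_averages vs u : rtest u -> rtest (averages vs u).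
Proof. by move=> tu; elim: vs => //= v vs; exact: rtest_average. Qed.

(** An average looks back along its direction by at most [n] in each coordinate, so each average
    costs [n] of the cube on which the function is known to be polynomial. *)
Lemma averages_polynomial l vs u (N n : nat) :
  (forall v, v \in vs -> forall i, `|v ord0 i| <= n%:R) ->
  (forall x, cube (N + size vs * n)%:R x -> u x = monomial l x) ->
  exists2 s : seq (R * seq 'I_d), all (fun p => (size p.2 < size l)%N) s &
    forall x, cube N%:R x -> averages vs u x = monomial l x + polynomial s x.
Proof.
elim: vs N => [|v vs ih] N vsn uN /=.
  exists [::] => // x xN; rewrite uN ?mul0n ?addn0//.
  by rewrite /polynomial big_nil addr0.
have [||s sl sE] := ih (N + n)%N.
- by move=> w wvs; apply: vsn; rewrite inE wvs orbT.
- by move=> x xN; apply: uN; rewrite /= mulSn addnA.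
have [s' s'l s'E] := average_polynomial v sl.
exists s' => // x xN; rewrite -s'E; apply: average_local => t /andP[t0 t1].
apply: sE => i; rewrite !mxE; have /andP[h1 h2] := xN i.
have := vsn v (mem_head _ _) i; rewrite ler_norml => /andP[h3 h4].
by rewrite natrD; apply/andP; split; nra.
Qed.

Lemma rtest_smooth_monomial l T n : rtest (smooth_monomial l T n).
Proof. by apply: rtest_averages; exact: rtest_cut_monomial. Qed.

Lemma smooth_monomial_polynomial l T n :
  exists2 s : seq (R * seq 'I_d), all (fun p => (size p.2 < size l)%N) s &
  forall x, cube n%:R x -> smooth_monomial l T n x = monomial l x + polynomial s x.
Proof.
apply: averages_polynomial; first exact: avg_dirs_le.
move=> x; rewrite size_avg_dirs -mulSn => xN.
by rewrite /cut_monomial indicE mem_set// mulr1.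
Qed.

Definition symbol (t : R) : R := avg_cos t ^+ 2 + avg_sin t ^+ 2.

Lemma symbol_ge0 t : 0 <= symbol t.
Proof. by rewrite addr_ge0// sqr_ge0. Qed.

Lemma power_averages vs u k : rtest u ->
  power (averages vs u) k = power u k * \prod_(v <- vs) symbol (dotp k v).
Proof.
move=> tu; elim: vs => [|v vs ih] /=; first by rewrite big_nil mulr1.
by rewrite power_average ?ih ?big_cons /symbol; [ring|exact: rtest_averages].
Qed.

Lemma avg_dirs_symbol T n k : \prod_(v <- avg_dirs T n) symbol (dotp k v) =
  \prod_(j < d) symbol (n%:R * k ord0 j) ^+ T.
Proof.
rewrite /avg_dirs big_flatten big_map big_enum /=; apply: eq_bigr => j _.
rewrite big_nseq_cond /= iter_mulr_1 //; congr (symbol _ ^+ _).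
rewrite /dotp (bigD1 j)//= big1 ?addr0 => [|i ij]; rewrite mxE ?eqxx.
  by rewrite /= mul1r mulrC.
by rewrite (negbTE ij) mul0r mulr0.
Qed.

Lemma enorm_coord_le (hd : (0 < d)%N) (k : 'rV[R]_d) (r : R) : 0 <= r -> r <= enorm k ->
  exists j, r / d%:R <= `|k ord0 j|.
Proof.
move=> r0 rk; apply: contrapT => /forallNP h.
have d0 : (0 : R) < d%:R by rewrite ltr0n.
have {}h j : `|k ord0 j| < r / d%:R by rewrite ltNge; apply/negP/h.
have rd0 : 0 <= r / d%:R by rewrite divr_ge0.
move: rk; apply/negP; rewrite -ltNge /enorm -[ltRHS]ger0_norm// -sqrtr_sqr.
have r1 : 0 < r.
  by have := h (Ordinal hd); rewrite ltNge; case: ltgtP r0 => // <-; rewrite mul0r normr_ge0.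
rewrite ltr_sqrt ?exprn_gt0//.
apply: (@lt_le_trans _ _ (\sum_(j < d) (r / d%:R) ^+ 2)).
  apply: ltr_sum; first by apply/hasP; exists (Ordinal hd); rewrite ?mem_index_enum.
  by move=> j _; rewrite -expr2 -real_normK ?num_real// ltr_pXn2r ?nnegrE.
rewrite sumr_const card_ord -[_ *+ d]mulr_natr expr_div_n.
have -> : r ^+ 2 / d%:R ^+ 2 * d%:R = r ^+ 2 * d%:R^-1 by field; rewrite gt_eqF.
by rewrite ler_piMr ?sqr_ge0// invf_le1// ler1n.
Qed.

Lemma avg_dirs_symbol_le1 T n k : \prod_(v <- avg_dirs T n) symbol (dotp k v) <= 1.
Proof.
rewrite avg_dirs_symbol; apply: prodr_ile1 => j _.
by rewrite exprn_ge0 ?symbol_ge0// exprn_ile1 ?symbol_ge0// avg_symbol_le1.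
Qed.

(** Some coordinate of [k] has modulus at least [r / d]; the [T] averages along this axis give the
    decay, and the other factors are at most [1]. This is why every axis occurs in [avg_dirs]. *)
Lemma avg_dirs_symbol_decay (hd : (0 < d)%N) T n k (r : R) : (0 < n)%N -> 0 < r ->
  r <= enorm k ->
  \prod_(v <- avg_dirs T n) symbol (dotp k v) <= (4 * d%:R ^+ 2 / (n%:R * r) ^+ 2) ^+ T.
Proof.
move=> n0 r0 rk; have [j kj] := enorm_coord_le hd (ltW r0) rk.
have d0 : (0 : R) < d%:R by rewrite ltr0n.
have n0' : (0 : R) < n%:R by rewrite ltr0n.
have s01 i : 0 <= symbol (n%:R * k ord0 i) ^+ T <= 1.
  by rewrite exprn_ge0 ?symbol_ge0// exprn_ile1 ?symbol_ge0// avg_symbol_le1.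
rewrite avg_dirs_symbol (bigD1 j)//=.
apply: (@le_trans _ _ (symbol (n%:R * k ord0 j) ^+ T)).
  by rewrite ler_piMr//; [case/andP: (s01 j)|exact: prodr_ile1].
apply: lerXn2r; rewrite ?nnegrE ?symbol_ge0//.
  by rewrite divr_ge0 ?sqr_ge0// mulr_ge0 ?sqr_ge0.
have kj0 : 0 < `|k ord0 j| by rewrite (lt_le_trans _ kj)// divr_gt0.
have nk0 : n%:R * k ord0 j != 0 by rewrite mulf_eq0 negb_or gt_eqF//= -normr_gt0.
apply: (le_trans (avg_symbol_decay nk0)).
rewrite -mulrA ler_wpM2l// ler_pdivlMr ?exprn_gt0 ?mulr_gt0//.
rewrite mulrC ler_pdivrMr; last by rewrite lt0r sqr_ge0 sqrf_eq0 nk0.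
rewrite !exprMn -[X in _ <= _ * (_ * X)]real_normK ?num_real//.
have : r <= d%:R * `|k ord0 j| by rewrite mulrC -ler_pdivrMr.
move=> h; have : r ^+ 2 <= (d%:R * `|k ord0 j|) ^+ 2.
  by rewrite lerXn2r ?nnegrE ?mulr_ge0// ltW.
rewrite exprMn => h2.
by rewrite [leRHS]mulrCA ler_wpM2l// sqr_ge0.
Qed.

Lemma power_le u k (K : R) (N : nat) : rtest u -> (forall x, `|u x| <= K) ->
  (forall x, ~ cube N%:R x -> u x = 0) ->
  `|fcos u k| <= K * (2 * N%:R) ^+ d /\ `|fsin u k| <= K * (2 * N%:R) ^+ d.
Proof.
move=> tu uK uN.
have K0 : 0 <= K by rewrite (le_trans _ (uK 0)).
have mc : measurable (@cube R d N%:R) by exact: measurable_cell.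
have bc : bounded_borel (@cube R d N%:R).
  by split => //; exists (d%:R * N%:R + 1); exact: cube_eball.
have H (g : 'rV[R]_d -> R) : (forall x, `|g x| <= 1) -> rtest (fun x => g x * u x) ->
    `|\int[lebesgue_rV d]_x (g x * u x)| <= K * (2 * N%:R) ^+ d.
  move=> g1 tg; have i := rtest_lebesgue_integrable tg.
  rewrite (le_trans (le_normr_Rintegral measurableT i))//.
  have -> : K * (2 * N%:R) ^+ d = \int[lebesgue_rV d]_x (K * \1_(cube N%:R) x).
    rewrite RintegralZl//; last exact: rtest_lebesgue_integrable (rtest_indic bc).
    rewrite /Rintegral integral_indic// setIT; congr (_ * _).
    exact: (esym (congr1 fine (@lebesgue_rV_cube R d N%:R (ler0n _ _)))).
  apply: le_Rintegral => //; first exact: integrable_norm i.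
    exact: integrable_mulr (rtest_lebesgue_integrable (rtest_indic bc)).
  move=> x _; rewrite normrM indicE; have [xN|xN] := pselect (cube N%:R x).
    by rewrite mem_set// mulr1 (le_trans _ (uK x))// ler_piMl.
  by rewrite uN// normr0 mulr0 mulr_ge0.
split; apply: H; [by move=> x; exact: normr_cos_le1|exact: rtest_cos|
  by move=> x; exact: normr_sin_le1|exact: rtest_sin].
Qed.

End polynomial_test_functions.

(* With truncated subtraction, [(i - s) + (s - i)] is the distance from i to s. *)
Lemma sum_half_dist (R : realFieldType) (s N : nat) :
  \sum_(i < N) (2^-1 : R) ^+ ((i - s) + (s - i)) <= 3.
Proof.
have H0 n : (n <= s)%N -> \sum_(i < n) (2^-1 : R) ^+ ((i - s) + (s - i)) <= 2^-1 ^+ (s - n).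
  elim: n => [_|n ih ns]; first by rewrite big_ord0 exprn_ge0.
  rewrite big_ord_recr /= (eqP (ltnW ns : (n - s == 0)%N)) add0n.
  apply: (le_trans (lerD (ih (ltnW ns)) (lexx _))).
  rewrite -[(s - n)%N]prednK ?subn_gt0// subnS exprS.
  by rewrite le_eqVlt; apply/orP; left; apply/eqP; field.
have H1 n : \sum_(i < s + n) (2^-1 : R) ^+ ((i - s) + (s - i)) <= 3 - 2 * 2^-1 ^+ n.
  elim: n => [|n ih].
    by rewrite addn0 expr0 (le_trans (H0 _ (leqnn s)))// subnn expr0; lra.
  rewrite addnS big_ord_recr /= addKn (eqP (leq_addr n s : (s - (s + n) == 0)%N)) addn0.
  by apply: (le_trans (lerD ih (lexx _))); rewrite exprS; lra.
have p0 n : (0 : R) <= 2^-1 ^+ n by rewrite exprn_ge0.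
have [Ns|/ltnW sN] := leqP N s.
  rewrite (le_trans (H0 _ Ns))// (@le_trans _ _ 1)//; last by lra.
  by rewrite exprn_ile1// ?invr_ge0// invf_le1// ler1n.
by rewrite -(subnKC sN) (le_trans (H1 _))//; have := p0 (N - s)%N; lra.
Qed.

Local Ltac nng := do ?[by []|exact: sqr_ge0|exact: ltW|apply: mulr_ge0|apply: addr_ge0|apply: exprn_ge0].

(** * Superposition of dyadic scales *)

Section multiscale.
Context {R : realType} {d : nat}.
Implicit Types (u : 'rV[R]_d -> R) (k x : 'rV[R]_d).
Variables (l : seq 'I_d) (rho : nat).
Hypotheses (hd : (0 < d)%N) (rho0 : (0 < rho)%N).

(** Degree plus dimension: the transform of the monomial cut off at scale [n] has size [n^D]. One
    average more than [D] along each axis, hence [T], leaves a geometric gain over that growth. *)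
Let D := (size l + d)%N.
Let T := D.+1.

(** [rho] will be the size of a cube containing [B], so that at every scale the smoothed monomial is
    a polynomial on [B]. *)
Definition scale (i : nat) : nat := (rho * 2 ^ i)%N.
Definition fscale (i : nat) : 'rV[R]_d -> R := smooth_monomial l T (scale i).
Definition gscale (i : nat) : 'rV[R]_d -> R := cut_monomial l ((d * T).+1 * scale i).

Lemma rtest_fscale i : rtest (fscale i). Proof. exact: rtest_smooth_monomial. Qed.
Lemma rtest_gscale i : rtest (gscale i). Proof. exact: rtest_cut_monomial. Qed.

Let c : R := ((d * T).+1 * rho)%:R.

Let cE i : ((d * T).+1 * scale i)%:R = c * 2 ^+ i :> R.
Proof. by rewrite /scale mulnA natrM natrX. Qed.

Lemma gscale_bound i x : `|gscale i x| <= (c * 2 ^+ i) ^+ size l.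
Proof. by rewrite -cE; exact: cut_monomial_bound. Qed.

Lemma gscale_out i x : ~ cube (c * 2 ^+ i) x -> gscale i x = 0.
Proof. by rewrite -cE; exact: cut_monomial_out. Qed.

Definition symbols i k : R := \prod_(v <- avg_dirs T (scale i)) symbol (dotp k v).

Let symbols_ge0 i k : 0 <= symbols i k.
Proof. by apply: prodr_ge0 => v _; exact: symbol_ge0. Qed.

Lemma power_fscale i k : power (fscale i) k = power (gscale i) k * symbols i k.
Proof. by rewrite /fscale /smooth_monomial power_averages//; exact: rtest_cut_monomial. Qed.

(** The constant in the trivial bound [A 2^(iD)] for either part of the transform of [gscale i]:
    supremum times volume of the cube. *)
Let A : R := locked (c ^+ size l * (2 * c) ^+ d).

Lemma power_gscale i k : power (gscale i) k <= 2 * (A * 2 ^+ (i * D)) ^+ 2.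
Proof.
have [|] := power_le k (rtest_gscale i) (gscale_bound i) (N := (d * T).+1 * scale i).
  by move=> x; rewrite cE; exact: gscale_out.
rewrite cE (_ : _ * _ = A * 2 ^+ (i * D)); last first.
  by rewrite /A -lock /D mulnDr exprD !exprM !exprMn; ring.
move=> h1 h2; rewrite /power mulr_natl mulr2n -[X in X + _ <= _]real_normK ?num_real//.
rewrite -[X in _ + X <= _]real_normK ?num_real//.
by apply: lerD; rewrite lerXn2r ?nnegrE// (le_trans _ h1).
Qed.

Variable delta : R.
Hypothesis delta0 : 0 < delta.

(** With [r = delta / 2^(s+1)], the quotient raised to the power [T] in [symbols_decay] is
    [b / 2^(i-s)] for [s < i]. *)
Let b : R := locked (4 * d%:R / (rho%:R * delta)).

Let A0 : 0 <= A. Proof. by rewrite /A -lock mulr_ge0 ?exprn_ge0// mulr_ge0. Qed.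
Let b0 : 0 <= b. Proof. by rewrite /b -lock divr_ge0// mulr_ge0// ltW. Qed.

Let B : R := locked (2 * A * (1 + b ^+ T)).

Let B0 : 0 <= B.
Proof. by rewrite /B -lock; do !apply: mulr_ge0 => //; rewrite addr_ge0 ?exprn_ge0. Qed.

Lemma symbols_decay i k (r : R) : 0 < r -> r <= enorm k ->
  symbols i k <= ((2 * d%:R / (rho%:R * r * 2 ^+ i)) ^+ T) ^+ 2.
Proof.
move=> r0 rk; apply: (le_trans (avg_dirs_symbol_decay hd T _ r0 rk)).
  by rewrite /scale muln_gt0 rho0 expn_gt0.
rewrite -exprM mulnC exprM /scale natrM natrX.
rewrite (_ : 4 * _ / _ = (2 * d%:R / (rho%:R * r * 2 ^+ i)) ^+ 2)//.
by rewrite expr_div_n; congr (_ / _); ring.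
Qed.

(** The matching scale is [i = s]. Below it, the trivial bound [2^(iD)] is smaller than [2^(sD)] by
    a factor of at least [2^(s-i)], as [D >= 1]. Above it, the averages contribute [T = D + 1]
    factors [2^-(i-s)]: [D] of them turn [2^(iD)] into [2^(sD)], and the last one is the geometric
    gain. *)
Lemma fscale_shell i s k : ((i <= s)%N \/ delta * 2^-1 ^+ s.+1 <= enorm k) ->
  power (fscale i) k <= (B * 2 ^+ (s * D) * 2^-1 ^+ ((i - s) + (s - i))) ^+ 2.
Proof.
have p0 n : (0 : R) <= 2^-1 ^+ n by rewrite exprn_ge0.
have q0 n : (0 : R) < 2 ^+ n by rewrite exprn_gt0.
have bT : 0 <= b ^+ T by rewrite exprn_ge0.
move=> h; have [is_|si] := leqP i s.
  rewrite (eqP (is_ : (i - s == 0)%N)) add0n.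
  apply: (@le_trans _ _ (2 * (A * 2 ^+ (i * D)) ^+ 2)).
    rewrite power_fscale (le_trans _ (power_gscale i k))//.
    by rewrite ler_piMr ?avg_dirs_symbol_le1// /power addr_ge0// sqr_ge0.
  apply: (@le_trans _ _ ((2 * A * 2 ^+ (i * D)) ^+ 2)).
    by rewrite -mulrA [leRHS]exprMn ler_wpM2r ?sqr_ge0//; lra.
  apply: lerXn2r; rewrite ?nnegrE; [by rewrite !mulr_ge0// ltW|by rewrite !mulr_ge0// ltW|].
  have D1 : (s * D = i * D + (s - i) * D.-1 + (s - i))%N.
    by rewrite -[X in (_ + X)%N]muln1 -addnA -mulnDr addn1 prednK ?addn_gt0 ?hd ?orbT// -mulnDl subnKC.
  rewrite D1 !exprD /B -lock.
  have -> : 2 * A * (1 + b ^+ T) * (2 ^+ (i * D) * 2 ^+ ((s - i) * D.-1) * 2 ^+ (s - i)) * 2^-1 ^+ (s - i)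
     = (2 * A * 2 ^+ (i * D)) * ((1 + b ^+ T) * 2 ^+ ((s - i) * D.-1)).
    by rewrite exprVn; field; rewrite gt_eqF.
  rewrite ler_peMr ?mulr_ge0 ?(ltW (q0 _))//.
  have e1 : (1 : R) <= 2 ^+ ((s - i) * D.-1) by rewrite exprn_ege1// ler1n.
  by nra.
case: h => [is_|rk]; first by rewrite ltnNge is_ in si.
have r0 : 0 < delta * 2^-1 ^+ s.+1 by rewrite mulr_gt0// exprn_gt0.
rewrite (eqP (ltnW si : (s - i == 0)%N)) addn0.
rewrite power_fscale.
apply: (le_trans (ler_pM _ (symbols_ge0 i k) (power_gscale i k) (symbols_decay i r0 rk))).
  by rewrite /power addr_ge0// sqr_ge0.
rewrite -[leLHS]mulrA -exprMn.
have E : A * 2 ^+ (i * D) * (2 * d%:R / (rho%:R * (delta * 2^-1 ^+ s.+1) * 2 ^+ i)) ^+ T =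
    A * b ^+ T * (2 ^+ (s * D) * 2^-1 ^+ (i - s)).
  have -> : 2 * d%:R / (rho%:R * (delta * 2^-1 ^+ s.+1) * 2 ^+ i) = b * 2^-1 ^+ (i - s).
    rewrite -[in 2 ^+ i](subnKC (ltnW si)) exprD exprS !exprVn /b -lock; field.
    by rewrite !gt_eqF// ltr0n.
  have key : 2 ^+ (i * D) * (2^-1 ^+ (i - s)) ^+ T = 2 ^+ (s * D) * 2^-1 ^+ (i - s) :> R.
    rewrite -{1}(subnKC (ltnW si)) mulnDl exprD -mulrA; congr (_ * _).
    by rewrite -!exprM !exprVn /T mulnS exprD; field; rewrite !gt_eqF.
  by rewrite exprMn -key; ring.
rewrite E /B -lock.
set X := 2 ^+ (s * D); set Y := _ ^+ (i - s).
have X0 : 0 <= X by rewrite /X exprn_ge0.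
have Y0 : 0 <= Y by exact: p0.
apply: (@le_trans _ _ ((2 * (A * b ^+ T * (X * Y))) ^+ 2)).
  by rewrite [leRHS]exprMn ler_wpM2r ?sqr_ge0//; lra.
rewrite lerXn2r ?nnegrE ?mulr_ge0// ?addr_ge0//.
have : 0 <= A * (X * Y) by rewrite !mulr_ge0.
nra.
Qed.

Definition multi (N : nat) x : R := \sum_(i < N) fscale i x.

Lemma rtest_multi N : rtest (multi N).
Proof. by apply: rtest_sum => i; exact: rtest_fscale. Qed.

Lemma fcos_multi N k : fcos (multi N) k = \sum_(i < N) fcos (fscale i) k.
Proof.
rewrite /multi; elim: N => [|N ih].
  rewrite big_ord0 /fcos; under eq_Rintegral do rewrite big_ord0 mulr0.
  by rewrite /Rintegral integral0.
rewrite big_ord_recr /= -ih /fcos -RintegralD//.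
- by apply: eq_Rintegral => x _; rewrite big_ord_recr mulrDr.
- exact/rtest_lebesgue_integrable/rtest_cos/rtest_multi.
- exact/rtest_lebesgue_integrable/rtest_cos/rtest_fscale.
Qed.

Lemma fsin_multi N k : fsin (multi N) k = \sum_(i < N) fsin (fscale i) k.
Proof.
rewrite /multi; elim: N => [|N ih].
  rewrite big_ord0 /fsin; under eq_Rintegral do rewrite big_ord0 mulr0.
  by rewrite /Rintegral integral0.
rewrite big_ord_recr /= -ih /fsin -RintegralD//.
- by apply: eq_Rintegral => x _; rewrite big_ord_recr mulrDr.
- exact/rtest_lebesgue_integrable/rtest_sin/rtest_multi.
- exact/rtest_lebesgue_integrable/rtest_sin/rtest_fscale.
Qed.

(** The case [s = N] is the innermost ball, where [enorm k] has no lower bound but every scale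
    [i < N] is below the matching one. The constant is [2 * 3^2]: the [3] comes from
    [sum_half_dist], the [2] from cosine and sine. *)
Lemma power_multi_shell N s k : (s <= N)%N ->
  (s = N \/ delta * 2^-1 ^+ s.+1 <= enorm k) ->
  power (multi N) k <= 18 * B ^+ 2 * 2 ^+ (s * D) ^+ 2.
Proof.
move=> sN h.
have H (g : nat -> R) : (forall i, (i < N)%N -> g i ^+ 2 <= power (fscale i) k) ->
    (\sum_(i < N) g i) ^+ 2 <= 9 * B ^+ 2 * 2 ^+ (s * D) ^+ 2.
  move=> gp; have p0 : 0 <= B * 2 ^+ (s * D) by rewrite mulr_ge0 ?exprn_ge0.
  have : `|\sum_(i < N) g i| <= 3 * (B * 2 ^+ (s * D)).
    apply: (@le_trans _ _ (\sum_(i < N) (B * 2 ^+ (s * D) * 2^-1 ^+ ((i - s) + (s - i))))).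
      rewrite (le_trans (ler_norm_sum _ _ _))//; apply: ler_sum => i _.
      rewrite -ler_sqr ?nnegrE ?mulr_ge0 ?exprn_ge0// real_normK ?num_real//.
      apply: (le_trans (gp _ (ltn_ord i))); apply: fscale_shell.
      by case: h => [->|]; [left; exact: ltnW|right].
    by rewrite -mulr_sumr mulrC ler_wpM2r// sum_half_dist.
  rewrite -ler_sqr ?nnegrE ?mulr_ge0// real_normK ?num_real// => /le_trans; apply.
  by rewrite !exprMn; lra.
rewrite /power fcos_multi fsin_multi.
have -> : 18 * B ^+ 2 * 2 ^+ (s * D) ^+ 2 =
  9 * B ^+ 2 * 2 ^+ (s * D) ^+ 2 + 9 * B ^+ 2 * 2 ^+ (s * D) ^+ 2 by ring.
apply: lerD.
  by apply: (H (fun i => fcos (fscale i) k)) => i _; rewrite /power lerDl sqr_ge0.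
by apply: (H (fun i => fsin (fscale i) k)) => i _; rewrite /power lerDr sqr_ge0.
Qed.

(* The frequencies off the ball of radius [delta] are not controlled by the
   small-ball hypothesis; there the decay in [i] of the symbols pays for the
   growth of the second moments of the unsmoothed functions [gscale i]. *)
Lemma power_multi_far N k : delta <= enorm k ->
  power (multi N) k <= N%:R * \sum_(i < N)
     power (gscale i) k * ((2 * d%:R / (rho%:R * delta * 2 ^+ i)) ^+ T) ^+ 2.
Proof.
move=> dk.
apply: (@le_trans _ _ (N%:R * \sum_(i < N) power (fscale i) k)); last first.
  rewrite ler_wpM2l//; apply: ler_sum => i _; rewrite power_fscale ler_wpM2l//.
    by rewrite /power addr_ge0// sqr_ge0.
  exact: symbols_decay.
rewrite /power fcos_multi fsin_multi big_split/= mulrDr.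
by apply: lerD; have := @sqr_sum_le R 'I_N; rewrite card_ord; exact.
Qed.

(** Each shell is enlarged to a ball, since the hypothesis on [beta] will speak of balls; the last
    sum covers [delta <= enorm k]. *)
Lemma power_multi_le N k :
  power (multi N) k <=
    \sum_(s < N.+1) (18 * B ^+ 2 * 2 ^+ (s * D) ^+ 2) * \1_(eball (delta * 2^-1 ^+ s)) k +
    N%:R * \sum_(i < N)
      ((2 * d%:R / (rho%:R * delta * 2 ^+ i)) ^+ T) ^+ 2 * power (gscale i) k.
Proof.
have pw0 u : 0 <= power u k by rewrite /power addr_ge0// sqr_ge0.
have S0 : 0 <= N%:R * \sum_(i < N)
      ((2 * d%:R / (rho%:R * delta * 2 ^+ i)) ^+ T) ^+ 2 * power (gscale i) k.
  by rewrite mulr_ge0// sumr_ge0// => i _; rewrite mulr_ge0// sqr_ge0.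
have S1 (s : 'I_N.+1) : 0 <= (18 * B ^+ 2 * 2 ^+ (s * D) ^+ 2) * \1_(eball (delta * 2^-1 ^+ s)) k.
  by rewrite !mulr_ge0 ?sqr_ge0.
have [kd|kd] := ltP (enorm k) delta; last first.
  apply: (le_trans (power_multi_far N kd)).
  under eq_bigr do rewrite mulrC.
  by rewrite lerDr sumr_ge0.
(* The largest [s <= N] for which [k] lies in the ball of radius [delta / 2^s] names the shell of
   [k]. *)
pose Q s := (s <= N)%N && (enorm k < delta * 2^-1 ^+ s).
have Q0 : exists s, Q s by exists 0%N; rewrite /Q /= expr0 mulr1.
have QN s : Q s -> (s <= N)%N by case/andP.
case: (ex_maxnP Q0 QN) => s /andP[sN ks] smax.
have sh : s = N \/ delta * 2^-1 ^+ s.+1 <= enorm k.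
  have [sN'|sN'] := eqVneq s N; first by left.
  right; rewrite leNgt; apply/negP => h.
  have : Q s.+1 by rewrite /Q h andbT ltn_neqAle sN' sN.
  by move/smax; rewrite ltnn.
apply: (le_trans (power_multi_shell sN sh)).
rewrite (bigD1 (Ordinal (sN : (s < N.+1)%N)))//= indicE mem_set// mulr1 -addrA.
by rewrite lerDl addr_ge0// sumr_ge0.
Qed.

Context {disp : measure_display} {Omega : measurableType disp}
  (P : probability Omega R) (Phi : {mfun Omega >-> cmeasure R d})
  (theta : 'rV[R]_d -> Omega -> Omega).
Hypotheses (htheta : measurable_flow P theta) (hinv : invariant_cm Phi theta)
  (hsq : locally_abs_square_integrable P Phi).

(** On the ball of radius [delta / 2^s] the factor [2^(2sD)] of [power_multi_le] cancels the mass
    [O(2^(-2sD))], so each of the [N + 1] balls contributes a constant. Far from the origin the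
    symbols leave a convergent geometric series, and only the factor [N] of Cauchy-Schwarz
    remains. *)
Lemma variance_multi (beta : {measure set 'rV[R]_d -> \bar R}) (K : R) :
  bartlett_measure P Phi beta -> 0 <= K ->
  (forall e, 0 < e <= delta -> fine (beta (eball e)) <= K * (e ^+ D) ^+ 2) ->
  exists2 C, 0 <= C & forall N, variance2 P Phi (multi N) <= C * N.+1%:R.
Proof.
move=> hb K0 betaK.
have [lb _] := hb.
have [Cs Cs0 sqmC] := sqm_bound htheta hinv hsq hd.
pose p2 : R := (2 * pi) ^- d.
have p20 : 0 < p2 by rewrite /p2 invr_gt0 exprn_gt0// mulr_gt0// pi_gt0.
(* The second moments of both parts, hence the [2], come from [sqm_bound]; division by [p2] turns a
   variance into a spectral integral. *)
pose G : R := 2 * Cs * (c ^+ size l * c ^+ d) ^+ 2 / p2.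
have c0 : 0 <= c by rewrite /c.
have G0 : 0 <= G by rewrite /G divr_ge0 ?(ltW p20)// mulr_ge0 ?sqr_ge0// mulr_ge0.
have intg i : beta.-integrable setT (EFin \o power (gscale i)) /\
    \int[beta]_k power (gscale i) k <= G * (2 ^+ (i * D)) ^+ 2.
  have [ig vg] := variance_bartlett htheta hinv hsq hd hb (rtest_gscale i).
  split => //.
  rewrite -(ler_pM2l p20) -vg.
  apply: (le_trans (variance_le_sqm htheta hinv hsq hd (rtest_gscale i))).
  have Hb bb : fine (sqm P Phi bb (gscale i)) <= Cs * ((c * 2 ^+ i) ^+ size l * (c * 2 ^+ i) ^+ d) ^+ 2.
    have [mg _ _] := rtest_gscale i.
    have := sqmC bb (gscale i) _ ((d * T).+1 * scale i)%N mg (gscale_bound i).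
    rewrite cE => /(_ (gscale_out (i:=i))) h.
    rewrite -lee_fin fineK//; apply/fin_numPlt; rewrite (le_lt_trans h) ?ltry// andbT.
    rewrite (@lt_le_trans _ _ 0%E)// /sqm integral_ge0// => w _.
    by rewrite lee_fin sqr_ge0.
  rewrite big_bool /=; apply: (le_trans (lerD (Hb true) (Hb false))).
  rewrite le_eqVlt; apply/orP; left; apply/eqP.
  by rewrite /G /D mulnDr exprD !exprM !exprMn; field; rewrite gt_eqF.
pose b1 : R := 2 * d%:R / (rho%:R * delta).
pose a i : R := ((2 * d%:R / (rho%:R * delta * 2 ^+ i)) ^+ T) ^+ 2.
have a0 i : 0 <= a i by rewrite /a sqr_ge0.
(* [sum_half_dist] at [s = 0] will serve as the geometric series, whence the form of the
   exponent. *)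
have aE i : a i * (G * (2 ^+ (i * D)) ^+ 2) <= (b1 ^+ T) ^+ 2 * G * 2^-1 ^+ ((i - 0) + (0 - i)).
  have q0 n : (2 : R) ^+ n != 0 by rewrite gt_eqF// exprn_gt0.
  rewrite subn0 sub0n addn0.
  have -> : a i = (b1 ^+ T) ^+ 2 * (2^-1 ^+ i) ^+ 2 / (2 ^+ (i * D)) ^+ 2.
    rewrite /a (_ : _ / _ = b1 * 2^-1 ^+ i); last first.
      by rewrite /b1 exprVn; field; rewrite q0 !gt_eqF// ltr0n.
    rewrite (_ : (b1 * 2^-1 ^+ i) ^+ T = b1 ^+ T * 2^-1 ^+ i / 2 ^+ (i * D)).
      by rewrite expr_div_n [(b1 ^+ T * _) ^+ 2]exprMn.
    by rewrite exprMn {2}/T [(2^-1 ^+ i) ^+ _]exprS -[(2^-1 ^+ i) ^+ D]exprM [2^-1 ^+ (i * D)]exprVn mulrA.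
  have -> : (b1 ^+ T) ^+ 2 * (2^-1 ^+ i) ^+ 2 / (2 ^+ (i * D)) ^+ 2 * (G * (2 ^+ (i * D)) ^+ 2) =
     (b1 ^+ T) ^+ 2 * G * (2^-1 ^+ i) ^+ 2 by field; rewrite q0.
  apply: ler_wpM2l; first by nng.
  rewrite expr2 ler_piMl ?exprn_ge0//.
  by rewrite exprn_ile1// ?invr_ge0// invf_le1// ler1n.
pose C : R := p2 * (18 * B ^+ 2 * K * (delta ^+ D) ^+ 2 + 3 * ((b1 ^+ T) ^+ 2 * G)).
exists C.
  by rewrite /C; nng.
move=> N.
have [iF ->] := variance_bartlett htheta hinv hsq hd hb (rtest_multi N).
rewrite -/p2 /C -[leRHS]mulrA; apply: ler_wpM2l; first exact: ltW.
have iE s : beta.-integrable setT (EFin \o (\1_(eball (delta * 2^-1 ^+ s)) : 'rV[R]_d -> R)).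
  exact: rtest_integrable lb (rtest_indic (bounded_borel_eball _)).
have isum I (r : seq I) (w : I -> R) (h : I -> 'rV[R]_d -> R) :
    (forall i, beta.-integrable setT (EFin \o h i)) ->
    beta.-integrable setT (EFin \o (fun k => \sum_(i <- r) w i * h i k)) /\
    \int[beta]_k (\sum_(i <- r) w i * h i k) = \sum_(i <- r) w i * \int[beta]_k h i k.
  move=> ih; elim: r => [|i r [ir Er]].
    split.
      under [X in EFin \o X]eq_fun do rewrite big_nil.
      exact: integrable0.
    under eq_Rintegral do rewrite big_nil.
    by rewrite big_nil /Rintegral integral0.
  have iw := integrable_mulr (w i) (ih i).
  split; first by under [X in EFin \o X]eq_fun do rewrite big_cons; exact: integrable_addr.
  under eq_Rintegral do rewrite big_cons.
  by rewrite RintegralD// RintegralZl// Er big_cons.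
have [i1 E1] := isum _ (index_enum 'I_N.+1) (fun s : 'I_N.+1 => 18 * B ^+ 2 * 2 ^+ (s * D) ^+ 2)
  (fun s : 'I_N.+1 => \1_(eball (delta * 2^-1 ^+ s))) (fun s => iE s).
have [i2 E2] := isum _ (index_enum 'I_N) (fun i : 'I_N => a i)
  (fun i : 'I_N => power (gscale i)) (fun i : 'I_N => (intg i).1).
apply: (le_trans (le_Rintegral measurableT iF (integrable_addr i1 (integrable_mulr N%:R i2))
  (fun k _ => power_multi_le N k))).
rewrite RintegralD//; last exact: integrable_mulr.
rewrite RintegralZl// E1 E2 [leRHS]mulrDl; apply: lerD.
  apply: (@le_trans _ _ (\sum_(s < N.+1) (18 * B ^+ 2 * K * (delta ^+ D) ^+ 2))); last first.
    by rewrite sumr_const card_ord -[_ *+ _]mulr_natr.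
  apply: ler_sum => s _.
  have q0 n : (2 : R) ^+ n != 0 by rewrite gt_eqF// exprn_gt0.
  have -> : \int[beta]_x \1_(eball (delta * 2^-1 ^+ s)) x = fine (beta (eball (delta * 2^-1 ^+ s))).
    by rewrite /Rintegral integral_indic ?setIT//; exact: measurable_eball.
  apply: (@le_trans _ _ (18 * B ^+ 2 * 2 ^+ (s * D) ^+ 2 * (K * ((delta * 2^-1 ^+ s) ^+ D) ^+ 2))).
    apply: ler_wpM2l; first by nng.
    rewrite betaK// mulr_gt0 ?exprn_gt0//=.
    by rewrite ler_piMr ?(ltW delta0)// exprn_ile1// ?invr_ge0// invf_le1// ler1n.
  rewrite le_eqVlt; apply/orP; left; apply/eqP.
  have -> : (delta * 2^-1 ^+ s) ^+ D = delta ^+ D / 2 ^+ (s * D).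
    by rewrite exprMn -[(2^-1 ^+ s) ^+ D]exprM [2^-1 ^+ (s * D)]exprVn.
  by field; rewrite q0.
apply: (@le_trans _ _ (N%:R * (3 * ((b1 ^+ T) ^+ 2 * G)))); last first.
  by rewrite mulrC; apply: ler_wpM2l; [nng|rewrite ler_nat].
rewrite ler_wpM2l//; apply: (@le_trans _ _ (\sum_(i < N) (b1 ^+ T) ^+ 2 * G * 2^-1 ^+ ((i - 0) + (0 - i)))).
  apply: ler_sum => i _; apply: le_trans (aE i).
  by rewrite ler_wpM2l//; exact: (intg i).2.
by rewrite -mulr_sumr mulrC; apply: ler_wpM2r; [nng|exact: sum_half_dist].
Qed.

End multiscale.

(** * Moments are determined from outside *)

Section determined.
Context {R : realType} {disp : measure_display} {Omega : measurableType disp}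
  (P : probability Omega R) {disp' : measure_display} {E : measurableType disp'}
  (h : Omega -> E).
Implicit Types X Y Z : Omega -> R.

(* The sigma-algebra generated by [h] is not completed, hence the version [Y]. *)
Definition determined X : Prop := exists Y : Omega -> R,
  measurable_fun setT (Y : g_sigma_algebra_preimageType h -> R) /\
  {ae P, forall w, X w = Y w}.

Lemma determined_comp (f : E -> R) : measurable_fun setT f -> determined (f \o h).
Proof.
move=> mf; exists (f \o h); split; last exact: aeW.
move=> _ Y mY; exists (f @^-1` Y); last by rewrite !setTI comp_preimage.
by rewrite -[X in measurable X]setTI; exact: mf.
Qed.

Lemma determined_cst (a : R) : determined (cst a).
Proof. by exists (cst a); split; [exact: measurable_cst|exact: aeW]. Qed.

Lemma determined_lin (a : R) X Y : determined X -> determined Y ->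
  determined (fun w => a * X w + Y w).
Proof.
move=> [X' [mX XX']] [Y' [mY YY']]; exists (fun w => a * X' w + Y' w); split.
  by apply: measurable_funD => //; exact: measurable_funM.
by apply: filterS2 XX' YY' => w -> ->.
Qed.

Lemma determinedZ (a : R) X : determined X -> determined (fun w => a * X w).
Proof.
move=> dX; have := determined_lin a dX (determined_cst 0).
by under eq_fun do rewrite /cst addr0.
Qed.

Lemma determinedD X Y : determined X -> determined Y -> determined (fun w => X w + Y w).
Proof.
move=> dX dY; have := determined_lin 1 dX dY.
by under eq_fun do rewrite mul1r.
Qed.

Lemma determined_cvg (Z : nat -> Omega -> R) X : (forall n, determined (Z n)) ->
  {ae P, forall w, Z n w @[n --> \oo] --> X w} -> determined X.
Proof.
move=> /choice[Y /all_and2[mY ZY]] ZX.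
(* The upper limit is defined and measurable everywhere, also on the null set where the versions may
   diverge. *)
exists (fun w => fine (limn_esup (fun n => (Y n w)%:E))); split.
  apply: (measurableT_comp (f := fine)) => //.
  by apply: measurable_fun_limn_esup => n; apply/measurable_EFinP; exact: mY.
have {}ZY : {ae P, forall w, forall n, Z n w = Y n w} by apply/ae_foralln.
apply: filterS2 ZX ZY => w ZX ZY.
have : (Y n w)%:E @[n --> \oo] --> (X w)%:E.
  apply: cvg_EFin; first exact: nearW.
  by apply: cvg_trans ZX; apply: near_eq_cvg; apply: nearW => n; rewrite /= ZY.
by move=> /cvg_limn_einf_sup[_ ->].
Qed.

Lemma cvg0_of_summable (f : nat -> R) : (forall n, 0 <= f n) ->
  (\sum_(n <oo) (f n)%:E < +oo)%E -> f n @[n --> \oo] --> (0 : R).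
Proof.
move=> f0 fS; apply: (@cvg_series_cvg_0 R R^o).
apply: nondecreasing_is_cvgn.
  by apply/nondecreasing_seqP => n; rewrite /series /= big_nat_recr//= lerDl.
exists (fine (\sum_(n <oo) (f n)%:E)) => _ [n _ <-].
rewrite -lee_fin fineK; last first.
  by rewrite ge0_fin_numE//; apply: nneseries_ge0 => n' _ _; rewrite lee_fin.
rewrite /series /= -sumEFin; apply: nneseries_lim_ge => m _ _; exact: f0.
Qed.

(** The squared distances are summable in expectation, so their series is almost surely finite and
    the whole sequence [Z n] converges almost surely. *)
Lemma determined_L2 (Z : nat -> Omega -> R) X (r : R) : measurable_fun setT X ->
  (forall n, measurable_fun setT (Z n)) -> (forall n, determined (Z n)) ->
  (forall n, (\int[P]_w ((X w - Z n w) ^+ 2)%:E <= (r / (2 ^ n.+1)%:R)%:E)%E) ->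
  determined X.
Proof.
move=> mX mZ dZ XZ; apply: (determined_cvg dZ).
have m2 n : measurable_fun setT (fun w => ((X w - Z n w) ^+ 2)%:E).
  by apply/measurable_EFinP/measurable_funX/measurable_funB.
have p2 n w : (0 <= ((X w - Z n w) ^+ 2)%:E)%E by rewrite lee_fin sqr_ge0.
have int_lty : (\int[P]_w (\sum_(n <oo) ((X w - Z n w) ^+ 2)%:E) < +oo)%E.
  rewrite integral_nneseries//.
  apply: (@le_lt_trans _ _ (\sum_(n <oo) (r / (2 ^ (n + 1))%:R)%:E)%E).
    apply: lee_nneseries => n _; first by move=> _; exact: integral_ge0.
    by rewrite addn1.
  rewrite (_ : limn _ = r%:E) ?ltry//; apply: cvg_lim => //.
  have := @cvg_geometric_eseries_half R r 0.
  rewrite expr0 divr1 eseriesEnat; apply: cvg_trans.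
  by apply: near_eq_cvg; apply: nearW => n.
have : P.-integrable setT (fun w => \sum_(n <oo) ((X w - Z n w) ^+ 2)%:E)%E.
  apply/integrableP; split.
    by apply: ge0_emeasurable_sum => // n w _ _; exact: p2.
  under eq_integral do rewrite gee0_abs ?nneseries_ge0//.
  exact: int_lty.
move=> /(integrable_ae measurableT); apply: filterS => w /(_ I) fin.
have : (X w - Z n w) ^+ 2 @[n --> \oo] --> (0 : R).
  apply: cvg0_of_summable; first by move=> n; exact: sqr_ge0.
  by rewrite ltey_eq fin.
move=> c0; apply/cvgrPdist_lt => e e0.
have e2 : 0 < e ^+ 2 by rewrite exprn_gt0.
move/cvgrPdist_lt : c0 => /(_ _ e2); apply: filterS => n.
rewrite sub0r normrN ger0_norm ?sqr_ge0// -[(_ - _) ^+ 2]real_normK ?num_real//.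
by rewrite ltr_pXn2r// nnegrE// ltW.
Qed.

End determined.

Lemma ae_forall_countable d (T : measurableType d) (R : realType)
    (mu : {measure set T -> \bar R}) (I : countType) (Q : I -> T -> Prop) :
  (forall i, {ae mu, forall x, Q i x}) -> {ae mu, forall x, forall i, Q i x}.
Proof.
move=> h.
have : {ae mu, forall x, forall n, if unpickle n is Some i then Q i x else True}.
  apply/ae_foralln => n; case: (unpickle n) => [i|]; first exact: h.
  exact: aeW.
by apply: filterS => x H i; have := H (pickle i); rewrite pickleK.
Qed.

Section rigidity.
Context {R : realType} {d : nat} {disp : measure_display}
  {Omega : measurableType disp} (P : probability Omega R)
  (Phi : {mfun Omega >-> cmeasure R d}).
Implicit Types (u : 'rV[R]_d -> R) (b : bool) (l : seq 'I_d).

Lemma determined_restr b (D : set 'rV[R]_d) (mD : measurable D) u : rtest u ->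
  determined P (fun w => Defs.crestr mD (Phi w)) (rphi Phi b (fun x => u x * \1_D x)).
Proof.
move=> tu; have := determined_comp P (fun w => Defs.crestr mD (Phi w)) (measurable_rintegral b tu).
rewrite (_ : _ \o _ = rphi Phi b (fun x => u x * \1_D x))//.
by apply/funext => w; rewrite /= rintegral_crestr.
Qed.

Definition monomial_on (B : set 'rV[R]_d) l x : R := monomial l x * \1_B x.

Lemma rtest_monomial_on B l : bounded_borel B -> rtest (monomial_on B l).
Proof.
move=> [mB [r Br]]; split.
- apply: measurable_funM; first exact: measurable_monomial.
  exact: measurable_indic.
- exists (`|r| ^+ size l) => x; rewrite /monomial_on indicE.
  have [/set_mem xB|] := boolP (x \in B); last by rewrite mulr0 normr0 exprn_ge0.
  rewrite mulr1; apply: monomial_bound => i.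
  by rewrite (le_trans (eball_rbox (Br _ xB) i))// ler_norm.
- by exists r => x xr; rewrite /monomial_on indicE memNset ?mulr0// => /Br.
Qed.

(** The form in which the spectral hypotheses are used. Uniformity of order [2p + d] corresponds to
    [D = p + d], as [e^d e^(2p+d) = (e^(p+d))^2]. *)
Definition small_spectrum (D : nat) : Prop :=
  exists (beta : {measure set 'rV[R]_d -> \bar R}) (K delta : R),
  [/\ bartlett_measure P Phi beta, 0 <= K, 0 < delta &
      forall e, 0 < e <= delta -> fine (beta (eball e)) <= K * (e ^+ D) ^+ 2].

Lemma small_spectrumS (D D' : nat) : (D' <= D)%N ->
  small_spectrum D -> small_spectrum D'.
Proof.
move=> DD [beta [K [delta [hb K0 d0 H]]]].
(* Radii are kept below [1], where the larger exponent gives the smaller power. *)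
exists beta, K, (Num.min delta 1); split => //; first by rewrite lt_min d0 ltr01.
move=> e; rewrite le_min => /andP[e0 /andP[ed e1]].
apply: (le_trans (H _ _)); first by rewrite e0 ed.
rewrite ler_wpM2l// ler_sqr ?nnegrE ?exprn_ge0 ?(ltW e0)//.
by rewrite ler_wiXn2l// ltW.
Qed.

Variables (theta : 'rV[R]_d -> Omega -> Omega).
Hypotheses (htheta : measurable_flow P theta) (hinv : invariant_cm Phi theta)
  (hsq : locally_abs_square_integrable P Phi) (hd : (0 < d)%N).

(** Each of the [N] scales contributes the monomial once, up to lower degree. This factor [N] is
    what beats a standard deviation of order [sqrt N]. *)
Lemma multi_polynomial l (rho N : nat) (B : set 'rV[R]_d) : B `<=` cube rho%:R ->
  exists s : seq (R * seq 'I_d), all (fun p => (size p.2 < size l)%N) s /\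
  forall x, B x -> multi l rho N x = N%:R * monomial l x + polynomial s x.
Proof.
move=> Brho; elim: N => [|N [s [sl sE]]].
  exists [::]; split => // x _.
  by rewrite /multi big_ord0 mul0r add0r /polynomial big_nil.
have [s' s'l s'E] := @smooth_monomial_polynomial R d l (size l + d).+1 (scale rho N).
exists (s ++ s'); split; first by rewrite all_cat sl.
move=> x xB; rewrite /multi big_ord_recr /= -/(multi l rho N x) sE// /fscale s'E.
  by rewrite /polynomial big_cat /= -natr1; ring.
move=> i; have /andP[h1 h2] := Brho _ xB i.
have : (rho%:R : R) <= (scale rho N)%:R by rewrite ler_nat leq_pmulr// expn_gt0.
by move=> h; apply/andP; split; lra.
Qed.

Lemma moment_determined (p : nat) (B : set 'rV[R]_d) (bB : bounded_borel B) b l :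
  small_spectrum (p + d) -> (size l <= p)%N ->
  determined P (fun w => Defs.crestr (measurableC bB.1) (Phi w))
    (rphi Phi b (monomial_on B l)).
Proof.
move=> hs; have [n] := ubnP (size l); elim: n l => // n ih l; rewrite ltnS => ln lp.
have [beta [K [delta [hb K0 d0 H]]]] : small_spectrum (size l + d).
  by apply: small_spectrumS hs; rewrite leq_add2r.
have [rho rho0 Brho] : exists2 rho : nat, (0 < rho)%N & B `<=` cube rho%:R.
  have [_ [r Br]] := bB; exists (Num.trunc `|r|).+1 => //.
  apply: (subset_trans Br); apply: eball_cube.
  by rewrite (le_lt_trans (ler_norm r))// truncnS_gt.
have [C C0 HC] := variance_multi hd rho0 d0 htheta hinv hsq hb K0 H.
have [s /all_and2[sl sE]] := choice (fun N => @multi_polynomial l rho N B Brho).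
have mB := bB.1; pose mCB := measurableC bB.1.
have tX l' := rtest_monomial_on l' bB.
have tF N : rtest (multi l rho N : 'rV[R]_d -> R) by exact: rtest_multi.
have ind1 (D : set 'rV[R]_d) : exists M : R, forall x : 'rV[R]_d, `|\1_D x : R| <= M.
  by exists 1 => x; rewrite indicE; case: (_ \in _); rewrite ?normr0 ?normr1.
have tFD N D (mD : measurable D) : rtest (fun x : 'rV[R]_d => multi l rho N x * \1_D x : R).
  by apply: rtestM => //; exact: measurable_indic.
(* [L] gathers the moments of lower degree on [B], known by induction; [O] is the integral over the
   complement, a function of the restriction. *)
pose L N w := \sum_(q <- s N) q.1 * rphi Phi b (monomial_on B q.2) w.
pose O N := rphi Phi b (fun x => multi l rho N x * \1_(~` B) x).
have split N w : rphi Phi b (multi l rho N) w =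
    N%:R * rphi Phi b (monomial_on B l) w + L N w + O N w.
  rewrite /rphi /L /O.
  rewrite (_ : multi l rho N = fun x => (N%:R * monomial_on B l x +
      \sum_(q <- s N) q.1 * monomial_on B q.2 x) + multi l rho N x * \1_(~` B) x).
    have tS : rtest (fun x => \sum_(q <- s N) q.1 * monomial_on B q.2 x).
      by apply: rtest_sum => q; exact: rtestZ.
    rewrite rintegralD; [|by apply: rtestD => //; exact: rtestZ|exact: tFD].
    rewrite rintegralD//; last exact: rtestZ.
    rewrite rintegralZ// rintegral_sum; last by move=> q; exact: rtestZ.
    congr (_ + _ + _); first by apply: eq_bigr => q _; rewrite rintegralZ.
    congr (rintegral b (Phi w) _); apply/funext => x.
    have [xB|xB] := pselect (B x).
      by rewrite indicE memNset ?mulr0//; apply.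
    rewrite indicE mem_set// !mulr1 /monomial_on indicE memNset// mulr0 mulr0 big1 ?add0r// => q _.
    by rewrite mulr0 mulr0.
  apply/funext => x; rewrite /monomial_on; have [xB|xB] := pselect (B x).
    rewrite sE// [\1_(~` B) x]indicE memNset ?mulr0 ?addr0; last by apply.
    rewrite indicE mem_set// mulr1; congr (_ + _).
    by apply: eq_bigr => q _; rewrite mulr1.
  rewrite [\1_(~` B) x]indicE mem_set// mulr1 [\1_B x]indicE memNset// mulr0 mulr0 big1 ?add0r// => q _.
  by rewrite mulr0 mulr0.
(* along [N = 2 ^ n'] the squared distances are summable *)
pose Z n' w := (2 ^ n')%:R^-1 * (mean P Phi b (multi l rho (2 ^ n')) +
   -1 * (L (2 ^ n')%N w + O (2 ^ n')%N w)).
have mL N : measurable_fun setT (L N).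
  by apply: measurable_sum => q; apply: measurable_funM => //; exact: measurable_rphi.
have mO N : measurable_fun setT (O N) by apply: measurable_rphi; exact: tFD.
have dL N : determined P (fun w => Defs.crestr mCB (Phi w)) (L N).
  rewrite /L; have := sl N; elim: (s N) => [_|q r ihr /= /andP[ql rl]].
    by under [X in determined _ _ X]eq_fun do rewrite big_nil; exact: determined_cst.
  under [X in determined _ _ X]eq_fun do rewrite big_cons.
  apply: determined_lin; last exact: ihr.
  apply: ih; first exact: leq_trans ql ln.
  by rewrite (leq_trans (ltnW ql)).
(* For [N = 2^n'] the squared distance is at most [C (N + 1) / N^2 <= 2 C / N], which is
   [4 C / 2^(n'+1)]. *)
apply: (@determined_L2 _ _ _ _ _ _ _ Z _ (4 * C)).
- exact: measurable_rphi.
- move=> n'; apply: measurable_funM => //; apply: measurable_funD => //.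
  by apply: measurable_funM => //; exact: measurable_funD.
- move=> n'; apply: determinedZ; apply: determinedD; first exact: determined_cst.
  apply: determinedZ; apply: determinedD => //.
  exact: determined_restr.
- move=> n'; set N := (2 ^ n')%N.
  have N0 : (N%:R : R) != 0 by rewrite pnatr_eq0 -lt0n expn_gt0.
  have Np : (0 : R) < N%:R by rewrite ltr0n expn_gt0.
  have E w : rphi Phi b (monomial_on B l) w - Z n' w =
      N%:R^-1 * (rphi Phi b (multi l rho N) w - mean P Phi b (multi l rho N)).
    by rewrite /Z -/N split; field.
  under eq_integral do rewrite E exprMn EFinM.
  have iv := variance_integrable htheta hinv hsq hd b (tF N).
  rewrite ge0_integralZl_EFin ?sqr_ge0//; last 2 first.
  + by move=> w _; rewrite lee_fin sqr_ge0.
  + exact: (measurable_int _ iv).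
  have -> : (\int[P]_w ((rphi Phi b (multi l rho N) w - mean P Phi b (multi l rho N)) ^+ 2)%:E)%E =
      (\int[P]_w ((rphi Phi b (multi l rho N) w - mean P Phi b (multi l rho N)) ^+ 2))%:E.
    by rewrite /Rintegral fineK//; exact: integrable_fin_num iv.
  rewrite -EFinM lee_fin.
  apply: (@le_trans _ _ (N%:R^-1 ^+ 2 * (C * N.+1%:R))).
    rewrite ler_wpM2l ?sqr_ge0// (le_trans _ (HC N))// /variance2 big_bool.
    have nn b' : 0 <= \int[P]_w (rphi Phi b' (multi l rho N) w - mean P Phi b' (multi l rho N)) ^+ 2.
      by apply: Rintegral_ge0 => w _; exact: sqr_ge0.
    by case: (b); [have := nn false|have := nn true]; set x := (X in 0 <= X) => x0;
      [rewrite lerDl|rewrite lerDr].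
  rewrite expnS natrM -/N -natr1.
  have -> : 4 * C / (2 * N%:R) = N%:R^-1 ^+ 2 * (C * (N%:R + N%:R)) by field.
  rewrite ler_wpM2l ?sqr_ge0// ler_wpM2l// lerD2l ler1n expn_gt0//.
Qed.

Lemma rigid_of_small_spectrum (p : nat) : small_spectrum (p + d) -> rigid P Phi p.
Proof.
move=> hs B bB q qp.
have H (Ib : q.-tuple 'I_d * bool) := moment_determined bB Ib.2 (l := Ib.1) hs.
have {}H Ib : determined P (fun w => Defs.crestr (measurableC bB.1) (Phi w))
    (rphi Phi Ib.2 (monomial_on B (Ib.1 : q.-tuple 'I_d))).
  by apply: H; rewrite size_tuple.
have [Y /all_and2[mY YE]] := choice H.
exists (fun w => [ffun I : q.-tuple 'I_d => Complex (Y (I, true) w) (Y (I, false) w)]); split.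
  move=> I; rewrite /restr_measurable.
  rewrite (_ : (fun w => _) = fun w => Complex (Y (I, true) w) (Y (I, false) w)).
    by apply: measurable_complex => -[]; exact: mY.
  by apply/funext => w; rewrite ffunE.
have : {ae P, forall w, forall Ib, rphi Phi Ib.2 (monomial_on B (Ib.1 : q.-tuple 'I_d)) w = Y Ib w}.
  exact: ae_forall_countable.
apply: filterS => w YEw; apply/ffunP => I; rewrite !ffunE.
rewrite cmintegral_restrict.
have -> : (fun x => (((fun x => \prod_(j < q) x ord0 (tnth I j)) \_ B) x)%:C%C) =
    fun x : 'rV[R]_d => (monomial_on B I x)%:C%C.
  apply/funext => x; congr (_%:C)%C; rewrite patchE /monomial_on /monomial indicE.
  by case: (x \in B); rewrite ?mulr0// mulr1 big_tuple.
apply: cpart_eq => -[] /=.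
- exact: (YEw (I, true)).
- exact: (YEw (I, false)).
Qed.

End rigidity.

(** * From moments to Borel sets *)

(* The iterates are polynomials in [t], so the sign function is a bounded
   pointwise limit of polynomials on [-1, 1]. *)
Lemma sign_iteration (R : realType) (t : R) : -1 <= t <= 1 ->
  iter n (fun g => g * (3 - g ^+ 2) / 2) t @[n --> \oo] --> Num.sg t.
Proof.
set T := fun g : R => _.
(* [T] is the Newton-Schulz iteration for the sign function. On []0, 1]] both
   [T g - g = g (1 - g^2) / 2] and [1 - T g = (1 - g)^2 (2 + g) / 2] are nonnegative. *)
have step (g : R) : 0 < g <= 1 -> g <= T g <= 1.
  move=> /andP[g0 g1].
  have h1 : 0 <= g * ((1 - g) * (1 + g)) by rewrite !mulr_ge0//; lra.
  have h2 : 0 <= (1 - g) ^+ 2 * (2 + g) by rewrite mulr_ge0 ?sqr_ge0//; lra.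
  by rewrite /T; apply/andP; split; lra.
have pos (s : R) : 0 < s <= 1 -> iter n T s @[n --> \oo] --> (1 : R).
  move=> /andP[s0 s1].
  have H n : s <= iter n T s <= 1.
    elim: n => [|n /andP[h1 h2]]; first by rewrite lexx s1.
    rewrite iterS; have /andP[h3 ->] : iter n T s <= T (iter n T s) <= 1.
      by apply: step; rewrite h2 (lt_le_trans s0).
    by rewrite (le_trans h1).
  have nd : nondecreasing_seq (fun n => iter n T s).
    apply/nondecreasing_seqP => n; have /andP[h1 h2] := H n.
    have /andP[h3 _] : iter n T s <= T (iter n T s) <= 1.
      by apply: step; rewrite h2 (lt_le_trans s0).
    by rewrite iterS.
  have cv : cvgn (fun n => iter n T s).
    by apply: nondecreasing_is_cvgn => //; exists 1 => _ [n _ <-]; case/andP: (H n).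
  set L := limn (fun n => iter n T s) in cv.
  have cL : iter n T s @[n --> \oo] --> L by exact: cv.
  have cT : T (iter n T s) @[n --> \oo] --> T L.
    apply: cvgM; last exact: cvg_cst.
    apply: cvgM => //; apply: cvgB; first exact: cvg_cst.
    by apply: (@cvgM _ _ _ _ _ _ L L).
  have TL : T L = L.
    apply: (cvg_unique _ cT) => //.
    have := cL; rewrite -(cvg_shiftS (fun n => iter n T s)); apply: cvg_trans.
    by apply: near_eq_cvg; apply: nearW.
  have Ls : s <= L.
    by apply: limr_ge => //; apply: nearW => n; case/andP: (H n).
  suff -> : 1 = L by [].
  (* The fixed points of [T] are [-1], [0] and [1], and the limit [L] is positive. *)
  move: TL; rewrite /T => TL.
  have L0 : 0 < L by lra.
  have : L * (1 - L) * (1 + L) = 0.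
    by rewrite (_ : _ * _ = 2 * (L * (3 - L ^+ 2) / 2 - L)); [rewrite TL; ring|field].
  by move=> /eqP; rewrite !mulf_eq0 => /orP[/orP[]|] /eqP; lra.
move=> /andP[t1 t2]; have [t0|t0|->] := ltgtP t 0; last 1 first.
- rewrite sgr0; have -> : (fun n => iter n T 0) = cst 0.
    apply/funext => n; rewrite /cst; elim: n => // n ih.
    by rewrite iterS ih /T !mul0r.
  exact: cvg_cst.
- rewrite ltr0_sg//; have -> : (fun n => iter n T t) = fun n => - iter n T (- t).
    apply/funext => n; elim: n => [|n ih]; first by rewrite opprK.
    by rewrite !iterS ih /T; ring.
  by apply: cvgN; apply: pos; apply/andP; split; lra.
- by rewrite gtr0_sg//; apply: pos; rewrite t0.
Qed.

Lemma sign_iteration_le1 (R : realType) (t : R) n : -1 <= t <= 1 ->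
  `|iter n (fun g => g * (3 - g ^+ 2) / 2) t| <= 1.
Proof.
rewrite -ler_norml => t1; elim: n => // n ih; rewrite iterS.
move: ih; set g := iter n _ _; rewrite !ler_norml => /andP[g1 g2].
have h1 : 0 <= (1 - g) ^+ 2 * (2 + g) by rewrite mulr_ge0 ?sqr_ge0//; lra.
have h2 : 0 <= (1 + g) ^+ 2 * (2 - g) by rewrite mulr_ge0 ?sqr_ge0//; lra.
by apply/andP; split; lra.
Qed.

Lemma measurable_sgr (R : realType) : measurable_fun setT (@Num.sg R).
Proof.
rewrite (_ : Num.sg = fun x : R => if x < 0 then -1 else if 0 < x then 1 else 0).
  do 2 (apply: measurable_fun_ifT => //; first exact: measurable_fun_ltr).
apply/funext => x; case: ltgtP => [/ltr0_sg|/gtr0_sg|->]//; exact: sgr0.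
Qed.

Lemma cvg_norm_le (R : realType) (f : nat -> R) (l K : R) :
  (forall n, `|f n| <= K) -> f n @[n --> \oo] --> l -> `|l| <= K.
Proof.
move=> fK /cvg_norm fl; rewrite -(cvg_lim _ fl)//.
by apply: limr_le; [apply/cvg_ex; exists `|l| |exact: nearW].
Qed.

Section determined_sets.
Context {R : realType} {d : nat} {disp : measure_display}
  {Omega : measurableType disp} (P : probability Omega R)
  (Phi : {mfun Omega >-> cmeasure R d}) {disp' : measure_display}
  {E : measurableType disp'} (h : Omega -> E) (b : bool).
Variables (B : set 'rV[R]_d) (bB : bounded_borel B).
Implicit Types (u v f g : 'rV[R]_d -> R) (A : set 'rV[R]_d).

Local Opaque rintegral.

(** Bounds are on [B] only: coordinate functions are unbounded on the whole space, and the
    integrands all vanish off [B]. *)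
Definition bounded_on u := exists K : R, forall x, B x -> `|u x| <= K.

(* Asking for all monomial weights makes this class stable under multiplication
   by coordinates; its multipliers then form an algebra closed under bounded
   pointwise limits. *)
Record moments_determined u : Prop := MomentsDetermined {
  _ : measurable_fun setT u;
  _ : bounded_on u;
  _ : forall l, determined P h (rphi Phi b (fun x => u x * monomial_on B l x)) }.

Record multiplier f : Prop := Multiplier {
  _ : measurable_fun setT f;
  _ : bounded_on f;
  _ : forall u, moments_determined u -> moments_determined (fun x => f x * u x) }.

Lemma rtest_on u l : measurable_fun setT u -> bounded_on u ->
  rtest (fun x => u x * monomial_on B l x).
Proof.
move=> mu [K uK]; have [mm [M mM] [r mr]] := rtest_monomial_on l bB; split.
- exact: measurable_funM.
- exists (`|K| * M) => x; have [xB|xB] := pselect (B x).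
    by rewrite normrM ler_pM// (le_trans (uK _ xB))// ler_norm.
  rewrite /monomial_on indicE memNset// mulr0 mulr0 normr0.
  by rewrite mulr_ge0// (le_trans (normr_ge0 _) (mM x)).
- by exists r => x /mr ->; rewrite mulr0.
Qed.

Lemma bounded_on_lin (a : R) u v : bounded_on u -> bounded_on v ->
  bounded_on (fun x => a * u x + v x).
Proof.
move=> [K uK] [M vM]; exists (`|a| * K + M) => x xB.
by rewrite (le_trans (ler_normD _ _))// lerD ?vM// normrM ler_wpM2l// uK.
Qed.

Lemma bounded_onM u v : bounded_on u -> bounded_on v ->
  bounded_on (fun x => u x * v x).
Proof.
by move=> [K uK] [M vM]; exists (K * M) => x xB; rewrite normrM ler_pM ?uK ?vM.
Qed.

Lemma moments_determined_cst1 :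
  (forall l, determined P h (rphi Phi b (monomial_on B l))) ->
  moments_determined (cst 1).
Proof.
move=> dB; split; first exact: measurable_cst.
- by exists 1 => x _; rewrite normr1.
- by move=> l; under [X in rphi _ _ X]eq_fun do rewrite mul1r; exact: dB.
Qed.

Lemma moments_determined_lin (a : R) u v :
  moments_determined u -> moments_determined v ->
  moments_determined (fun x => a * u x + v x).
Proof.
move=> [mu bu du] [mv bv dv]; split.
- by apply: measurable_funD => //; exact: measurable_funM.
- exact: bounded_on_lin.
- move=> l; have := determined_lin a (du l) (dv l).
  rewrite (_ : (fun w => _) = rphi Phi b (fun x => (a * u x + v x) * monomial_on B l x))//.
  apply/funext => w; rewrite /rphi -rintegral_lin; [|exact: rtest_on..].
  by congr (rintegral b (Phi w) _); apply/funext => x; ring.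
Qed.

Lemma moments_determined_cvg (f : nat -> 'rV[R]_d -> R) g (K : R) :
  (forall n, moments_determined (f n)) -> measurable_fun setT g ->
  (forall n x, B x -> `|f n x| <= K) ->
  (forall x, B x -> f n x @[n --> \oo] --> g x) -> moments_determined g.
Proof.
move=> df mg fK fg; split => //.
  by exists K => x xB; apply: cvg_norm_le (fg _ xB) => n; exact: fK.
move=> l; have [_ [M mM] [r mr]] := rtest_monomial_on l bB.
apply: (@determined_cvg _ _ _ _ _ _ _
  (fun n => rphi Phi b (fun x => f n x * monomial_on B l x))).
  by move=> n; have [_ _] := df n; exact.
apply: aeW => w; apply: (rintegral_cvg b (Phi w) (M := `|K| * M) (r := r) _ _ _ _).2.
- by move=> n; have [mf bf _] := df n; exact: rtest_on.
- move=> n x; have [xB|xB] := pselect (B x).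
    by rewrite normrM ler_pM// (le_trans (fK n _ xB))// ler_norm.
  rewrite /monomial_on indicE memNset// mulr0 mulr0 normr0.
  by rewrite mulr_ge0// (le_trans (normr_ge0 _) (mM x)).
- by move=> n x /mr ->; rewrite mulr0.
- move=> x; have [xB|xB] := pselect (B x).
    by apply: cvgM; [exact: fg|exact: cvg_cst].
  rewrite /monomial_on indicE memNset// mulr0.
  by under eq_fun do rewrite mulr0; rewrite mulr0; exact: cvg_cst.
Qed.

Lemma multiplierM f g : multiplier f -> multiplier g -> multiplier (fun x => f x * g x).
Proof.
move=> [mf bf df] [mg bg dg]; split; first exact: measurable_funM.
  exact: bounded_onM.
move=> u /dg /df; by under eq_fun do rewrite mulrA.
Qed.

Lemma multiplier_cst (a : R) : multiplier (cst a).
Proof.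
split; [exact: measurable_cst|by exists `|a| |move=> u du].
 (* [a * u] is written as [(a - 1) * u + u], to fit the available form of linear combination. *)
 have := moments_determined_lin (a - 1) du du.
by rewrite (_ : (fun x => _) = fun x => cst a x * u x)//; apply/funext => x /=; ring.
Qed.

Lemma multiplier_lin (a : R) f g : multiplier f -> multiplier g ->
  multiplier (fun x => a * f x + g x).
Proof.
move=> [mf bf df] [mg bg dg]; split.
- by apply: measurable_funD => //; exact: measurable_funM.
- exact: bounded_on_lin.
- move=> u du; have := moments_determined_lin a (df _ du) (dg _ du).
  by under eq_fun do rewrite mulrA -mulrDl.
Qed.

Lemma multiplier_coord j : multiplier (rV_coord j).
Proof.
have mj := @measurable_rV_coord R d j.
have bj : bounded_on (rV_coord j).
  have [_ [r Br]] := bB; exists r => x xB.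
  exact: (eball_rbox (Br _ xB) j).
split => // u [mu bu du]; split; first exact: measurable_funM.
- exact: bounded_onM.
- move=> l; rewrite (_ : (fun x => _) = fun x => u x * monomial_on B (j :: l) x)//.
  by apply/funext => x; rewrite /monomial_on /monomial big_cons /rV_coord; ring.
Qed.

Lemma multiplier_cvg (f : nat -> 'rV[R]_d -> R) g (K : R) :
  (forall n, multiplier (f n)) -> measurable_fun setT g ->
  (forall n x, B x -> `|f n x| <= K) ->
  (forall x, B x -> f n x @[n --> \oo] --> g x) -> multiplier g.
Proof.
move=> df mg fK fg; split => //.
  by exists K => x xB; apply: cvg_norm_le (fg _ xB) => n; exact: fK.
move=> u du; have [mu [M uM] _] := du.
apply: (@moments_determined_cvg (fun n x => f n x * u x) _ (K * M)).
- by move=> n; have [_ _] := df n; exact.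
- exact: measurable_funM.
- by move=> n x xB; rewrite normrM ler_pM ?fK ?uM.
- by move=> x xB; apply: cvgM; [exact: fg|exact: cvg_cst].
Qed.

(** An affine function of the coordinate, scaled into [[-1, 1]] on [B], is a multiplier. The
    iterates of [sign_iteration] are polynomials in it, so its sign [sg] is a multiplier too, and
    [(sg + sg^2) / 2] is the indicator of the open half-space. *)
Lemma multiplier_halfspace j (c : R) : multiplier \1_(rV_coord j @^-1` `]c, +oo[).
Proof.
have [_ [r Br]] := bB.
pose K := `|r| + `|c| + 1; have K0 : 0 < K by rewrite ltr_wpDl// addr_ge0.
pose t x : R := K^-1 * rV_coord j x + cst (- (c / K)) x.
have tE x : t x = (rV_coord j x - c) / K by rewrite /t /cst; ring.
have tB x : B x -> -1 <= t x <= 1.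
  move=> xB; rewrite -ler_norml tE normrM normfV (gtr0_norm K0) ler_pdivrMr// mul1r.
  rewrite (le_trans (ler_normB _ _))// /K -addrA lerD//.
    by rewrite (le_trans (eball_rbox (Br _ xB) j))// ler_norm.
  by rewrite lerDl.
pose T (g : R) := g * (3 - g ^+ 2) / 2.
have mt : multiplier t by apply: multiplier_lin; [exact: multiplier_coord|exact: multiplier_cst].
have miter n : multiplier (fun x => iter n T (t x)).
  elim: n => // n ih.
  have -> : (fun x => iter n.+1 T (t x)) = fun x =>
      iter n T (t x) * (- 2^-1 * (iter n T (t x) * iter n T (t x)) + cst (3 / 2) x).
    by apply/funext => x; rewrite iterS /T /cst; field.
  apply: multiplierM => //; apply: multiplier_lin; last exact: multiplier_cst.
  exact: multiplierM.
have ms : multiplier (fun x => Num.sg (rV_coord j x - c)).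
  apply: (@multiplier_cvg _ _ 1 miter).
  - apply: (measurableT_comp (@measurable_sgr R)).
    by apply: measurable_funB => //; exact: measurable_rV_coord.
  - by move=> n x /tB; exact: sign_iteration_le1.
  - move=> x xB; have -> : Num.sg (rV_coord j x - c) = Num.sg (t x).
      by rewrite tE sgrM (gtr0_sg (_ : 0 < K^-1)) ?invr_gt0// mulr1.
    exact: sign_iteration (tB _ xB).
pose sg x := Num.sg (rV_coord j x - c).
rewrite (_ : \1__ = fun x => 2^-1 * sg x + (2^-1 * (sg x * sg x) + cst 0 x)).
  apply: multiplier_lin => //; apply: multiplier_lin; last exact: multiplier_cst.
  exact: multiplierM.
apply/funext => x; rewrite /cst addr0 indicE /sg.
have [xc|xc] := pselect ((rV_coord j @^-1` `]c, +oo[) x).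
  rewrite mem_set// gtr0_sg; last by move: xc; rewrite /= in_itv /= andbT subr_gt0.
  by rewrite !mulr1 [RHS](_ : _ = 1)//; field.
rewrite memNset//; have : rV_coord j x - c <= 0.
  by rewrite subr_le0 leNgt; apply/negP => h'; apply: xc; rewrite /= in_itv /= h'.
rewrite le_eqVlt => /orP[/eqP ->|/ltr0_sg ->]; first by rewrite sgr0 !mulr0 addr0.
by rewrite mulrNN mulr1 mulrN1 mulr1 addNr.
Qed.

(** The sets whose indicator is a multiplier form a sigma-algebra: complements by linearity,
    countable unions because the indicator of the complement is a limit of finite products bounded
    by [1]. The half-spaces belong to it and generate the Borel sets. *)
Lemma multiplier_indic A : measurable A -> multiplier \1_A.
Proof.
pose S : set (set 'rV[R]_d) := [set A | multiplier \1_A].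
have SC A' : S A' -> S (~` A').
  move=> SA; rewrite /S /= (_ : \1_(~` A') = fun x => -1 * \1_A' x + cst 1 x).
    by apply: multiplier_lin => //; exact: multiplier_cst.
  apply/funext => x; rewrite /cst !indicE in_setC.
  by case: (x \in A'); rewrite /= ?mulr0 ?add0r// mulr1 addNr.
have S0 : S set0.
  by rewrite /S /= indic0; exact: multiplier_cst.
have SU (F : (set 'rV[R]_d)^nat) : (forall n, S (F n)) -> S (\bigcup_n F n).
  move=> SF; pose f n x : R := \prod_(k < n) \1_(~` F k) x.
  have mF : measurable (\bigcup_n F n).
    apply: bigcup_measurable => n _.
    have [mf _ _] := SF n; have := mf measurableT [set 1] (measurable_set1 1).
    rewrite setTI (_ : _ @^-1` _ = F n)//; apply/seteqP; split => x /=; rewrite indicE.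
      by have [/set_mem//|_ /eqP] := boolP (x \in F n); rewrite eq_sym oner_eq0.
    by move=> xF; rewrite mem_set.
  rewrite -[\bigcup_n F n]setCK; apply: (SC).
  apply: (@multiplier_cvg f _ 1).
  - elim=> [|n ih]; rewrite /f.
      by under eq_fun do rewrite big_ord0; exact: multiplier_cst.
    under eq_fun do rewrite big_ord_recr /=.
    by apply: multiplierM => //; apply: SC.
  - by apply: measurable_indic; exact: measurableC.
  - move=> n x _; rewrite /f normr_prod; apply: prodr_ile1 => k _.
    by rewrite normr_ge0 indicE /=; case: (_ \in _); rewrite ?normr0 ?normr1 ?ler01.
  - move=> x _; have [[n _ xF]|xF] := pselect ((\bigcup_n F n) x).
      rewrite indicE memNset; last by apply; exists n.
      apply: cvg_near_cst; exists n.+1 => // m /= nm; apply/eqP.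
      rewrite /f prodf_seq_eq0; apply/hasP; exists (Ordinal nm) => /=.
        by rewrite mem_index_enum.
      by rewrite indicE memNset//=; apply.
    rewrite indicE mem_set//; apply: cvg_near_cst; apply: nearW => m; apply/eqP.
    rewrite /f big1// => k _; rewrite indicE mem_set// => xk.
    by apply: xF; exists k.
have sigS (D : set (set 'rV[R]_d)) : D `<=` S -> <<s D >> `<=` S.
  move=> DS; apply: smallest_sub => //; split => // A' SA'.
  by rewrite setTD; exact: SC.
apply: sigS; rewrite -bigcup_seq => A' [j _ [Y mY <-]].
rewrite setTI.
pose S' := [set Y : set R | S (rV_coord j @^-1` Y)].
suff : measurable `<=` S' by exact.
have -> : (measurable : set (set R)) = _ := measurable_realfun.RGenOInfty.measurableE R.
apply: smallest_sub.
  split.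
  - by rewrite /S' /= preimage_set0.
  - by move=> A0 /=; rewrite /S' /= setTD preimage_setC; exact: SC.
  - by move=> F SF; rewrite /S' /= preimage_bigcup; exact: SU.
by move=> _ [c ->]; exact: multiplier_halfspace.
Qed.

Lemma determined_cmval A :
  (forall l, determined P h (rphi Phi b (monomial_on B l))) -> measurable A ->
  determined P h (fun w => cpart b (Phi w (A `&` B))).
Proof.
move=> dB mA; have [_ _ df] := multiplier_indic mA.
have [_ _ /(_ [::])] := df _ (moments_determined_cst1 dB).
rewrite (_ : rphi _ _ _ = fun w => cpart b (Phi w (A `&` B)))//.
apply/funext => w; rewrite -rintegral_indic.
  rewrite /rphi; congr (rintegral b (Phi w) _); apply/funext => x.
  by rewrite /monomial_on /monomial big_nil /cst mulr1 mul1r indicI.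
apply: bounded_borelS bB _ _; last by move=> x [].
by apply: measurableI => //; exact: bB.1.
Qed.

End determined_sets.

(** * From determined values to a random measure *)

Section ternary.
Context {R : realType}.
Implicit Types (e : nat -> bool) (r : R).

(** The base-[3] digits are [0] and [2], so the values lie in the Cantor set. Unlike binary
    expansions these are unique: a value is at most [1/3] or at least [2/3], and comparison with
    [1/2] reads off the leading digit. *)
Fixpoint ternary_sum n e : R :=
  if n is m.+1 then (2 * (e 0)%:R + ternary_sum m (fun k => e k.+1)) / 3 else 0.

Definition ternary e : R := limn (ternary_sum ^~ e).

(** The iterated map deletes the leading ternary digit. *)
Definition digit r (n : nat) : bool :=
  2^-1 < iter n (fun s => 3 * s - 2 * (2^-1 < s)%R%:R) r.

Lemma ternary_sum_bound n e : 0 <= ternary_sum n e <= 1.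
Proof.
elim: n e => [|n ih] e /=; first by rewrite lexx ler01.
have /andP[h1 h2] := ih (fun k => e k.+1).
by case: (e 0) => /=; apply/andP; split; lra.
Qed.

Lemma cvg_ternary e : ternary_sum n e @[n --> \oo] --> ternary e.
Proof.
apply: nondecreasing_is_cvgn; last first.
  by exists 1 => _ [n _ <-]; case/andP: (ternary_sum_bound n e).
apply/nondecreasing_seqP => n; elim: n e => [|n ih] e.
  by case/andP: (ternary_sum_bound 1 e).
by rewrite [leLHS]/= [leRHS]/=; have := ih (fun k => e k.+1); rewrite /=; lra.
Qed.

Lemma ternary_bound e : 0 <= ternary e <= 1.
Proof.
have c : ternary_sum n e @[n --> \oo] --> ternary e := @cvg_ternary e; have H n := ternary_sum_bound n e.
apply/andP; split.
  by apply: limr_ge; [exact: c|apply: nearW => n; case/andP: (H n)].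
by apply: limr_le; [exact: c|apply: nearW => n; case/andP: (H n)].
Qed.

Lemma ternaryE e : ternary e = (2 * (e 0)%:R + ternary (fun k => e k.+1)) / 3.
Proof.
have h1 : ternary_sum n.+1 e @[n --> \oo] --> ternary e.
  by rewrite (cvg_shiftS (ternary_sum ^~ e)); exact: cvg_ternary.
apply: (cvg_unique _ h1) => //=.
apply: cvgM; last exact: cvg_cst.
by apply: cvgD; [exact: cvg_cst|exact: cvg_ternary].
Qed.

Lemma digit_ternary e n : digit (ternary e) n = e n.
Proof.
rewrite /digit; set T := fun s => _.
have test e' : (2^-1 < ternary e') = e' 0.
  have := ternary_bound (fun k => e' k.+1); rewrite [ternary e']ternaryE => /andP[h1 h2].
  by case: (e' 0) => /=; [apply/idP; lra|apply/negbTE; rewrite -leNgt; lra].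
have -> : iter n T (ternary e) = ternary (fun k => e (n + k)%N).
  elim: n => // n ih; rewrite iterS ih /T test [in LHS]ternaryE addn0.
  rewrite (_ : (fun k => e (n.+1 + k)%N) = fun k => e (n + k.+1)%N); first by field.
  by apply/funext => k; rewrite addnS.
by rewrite test addn0.
Qed.

Lemma measurable_ternary d (T : measurableType d) (E : nat -> T -> bool) :
  (forall n, measurable_fun setT (E n)) ->
  measurable_fun setT (fun x => ternary (E ^~ x)).
Proof.
move=> mE; have m n E' : (forall n, measurable_fun setT (E' n)) ->
    measurable_fun setT (fun x : T => ternary_sum n (E' ^~ x)).
  elim: n E' => [|n ih] E' mE'; first exact: measurable_cst.
  apply: measurable_funM => //; apply: measurable_funD; last exact: ih.
  apply: measurable_funM => //.
  exact: (measurableT_comp (f := fun b : bool => b%:R : R)).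
apply: (measurable_fun_cvg (fun n => m n E mE)) => x _; exact: cvg_ternary.
Qed.

Lemma measurable_digit n : measurable_fun setT (digit ^~ n).
Proof.
pose F (s : R) := 3 * s - 2 * (2^-1 < s)%R%:R.
have mF : measurable_fun setT F.
  apply: measurable_funB; first exact: measurable_funM.
  apply: measurable_funM => //.
  apply: (measurableT_comp (f := fun b : bool => b%:R : R)) => //.
  exact: measurable_fun_ltr.
apply: measurable_fun_ltr => //; rewrite -/F; elim: n => [|n ih]; first exact: measurable_id.
exact: (measurableT_comp mF ih).
Qed.

End ternary.

(* The digits of [enc x] are the truth values of [q < x_j] over all pairs (j, q)
   with q rational. *)
Lemma rV_embedding (R : realType) (d : nat) :
  exists (enc : 'rV[R]_d -> R) (dec : R -> 'rV[R]_d),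
  [/\ measurable_fun setT enc, measurable_fun setT dec, cancel enc dec &
      forall x, 0 <= enc x <= 1].
Proof.
pose E n (x : 'rV[R]_d) : bool :=
  if unpickle n is Some (j, q) then ratr (q : rat) < x ord0 (j : 'I_d) else false.
(* A coordinate is recovered as the supremum of the rationals that the digits place below it. On
   numbers that encode no point, [fine] still supplies some value. *)
pose sup_digits (j : 'I_d) (r : R) : \bar R := ereal_sup (range (fun n =>
  if unpickle n is Some (j', q) then
    if ((j' : 'I_d) == j) && digit r n then (ratr (q : rat) : R)%:E else -oo%E
  else -oo%E)).
exists (fun x => ternary (E ^~ x)), (fun r => \row_j fine (sup_digits j r)).
split.
- apply: measurable_ternary => n; rewrite /E; case: unpickle => [[j q]|]; last exact: measurable_cst.
  by apply: measurable_fun_ltr => //; exact: measurable_rV_coord.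
- apply: measurable_fun_rV => j.
  rewrite (_ : _ \o _ = fine \o sup_digits j); last first.
    by apply/funext => r; rewrite /= /rV_coord mxE.
  apply: measurableT_comp => //.
  pose u n (r : R) : \bar R := if unpickle n is Some (j', q) then
    if ((j' : 'I_d) == j) && digit r n then (ratr (q : rat) : R)%:E else -oo%E else -oo%E.
  have mu n : measurable_fun setT (u n).
    rewrite /u; case: unpickle => [[j' q]|]; last exact: measurable_cst.
    apply: measurable_fun_ifT => //; apply: measurable_and => //.
    exact: measurable_digit.
  have := @measurable_fun_esups _ _ R setT u mu 0.
  rewrite (_ : (fun x => _) = sup_digits j)//.
  apply/funext => r; rewrite /esups /sup_digits /sdrop; congr ereal_sup.
  by apply/seteqP; split => [_ [n _ <-]|_ [n _ <-]]; exists n.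
- move=> x; apply/rowP => j; rewrite mxE.
  suff -> : sup_digits j (ternary (E ^~ x)) = (x ord0 j)%:E by [].
  apply/eqP; rewrite eq_le; apply/andP; split.
    apply: ge_ereal_sup => _ [n _ <-].
    case En : (unpickle n) => [[j' q]|]; last exact: leNye.
    rewrite digit_ternary {1}/E En; case: ifP => [/andP[/eqP -> xq]|_]; last exact: leNye.
    by rewrite lee_fin ltW.
  apply/lee_subgt0Pr => e e0; rewrite -EFinB.
  have [q] := @rat_in_itvoo R (x ord0 j - e) (x ord0 j) ltac:(by rewrite ltrBlDr ltrDl).
  rewrite in_itv /= => /andP[q1 q2].
  apply: (@le_trans _ _ (ratr q)%:E); first by rewrite lee_fin ltW.
  apply: ereal_sup_ubound; exists (pickle (j, q)) => //.
  by rewrite pickleK eqxx digit_ternary /E pickleK q2.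
- by move=> x; exact: ternary_bound.
Qed.

Section right_limit.
Context {R : realType}.
Implicit Types (v : rat -> R) (s : R).

Lemma rat_seq_right s : exists t : nat -> rat,
  [/\ forall n, s < ratr (t n), forall n, (t n.+1 <= t n)%R &
      (ratr (t n) : R) @[n --> \oo] --> s].
Proof.
have H n : exists q : rat, s + n.+2%:R^-1 < ratr q < s + n.+1%:R^-1.
  have [q] := @rat_in_itvoo R (s + n.+2%:R^-1) (s + n.+1%:R^-1)
    ltac:(by rewrite ltrD2l ltf_pV2 ?posrE// ltr_nat).
  by rewrite in_itv /=; exists q.
have [t tE] := choice H; exists t.
have st n : s < ratr (t n).
  by case/andP: (tE n) => + _; apply: lt_trans; rewrite ltrDl invr_gt0.
split => // [n|].
  rewrite -(ler_rat R) ltW//; case/andP: (tE n) => h _; case/andP: (tE n.+1) => _ h'.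
  exact: lt_trans h' h.
apply: (squeeze_cvgr (f := cst s) (h := fun n => s + n.+1%:R^-1)).
- by apply: nearW => n; rewrite /cst (ltW (st n)) ltW//; case/andP: (tE n).
- exact: cvg_cst.
- rewrite -[X in _ --> X]addr0; apply: cvgD; first exact: cvg_cst.
  exact: cvg_harmonic.
Qed.

(** Only rational arguments enter, because only countably many values are available outside one null
    set. *)
Definition right_limit v s : R := inf [set v t | t in [set t | s < ratr t]].

Lemma right_limit_has_inf v s : {homo v : x y / x <= y} ->
  has_inf [set v t | t in [set t | s < ratr t]].
Proof.
move=> hv; split.
  by have [t [st _ _]] := rat_seq_right s; exists (v (t 0%N)), (t 0%N) => //=.
have [q] := @rat_in_itvoo R (s - 1) s ltac:(by rewrite ltrBlDr ltrDl).
rewrite in_itv /= => /andP[_ qs]; exists (v q) => _ [t /= st <-].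
by apply: hv; rewrite -(ler_rat R) ltW// (lt_trans qs).
Qed.

Lemma right_limit_cvg v s (t : nat -> rat) : {homo v : x y / x <= y} ->
  (forall n, s < ratr (t n)) -> (ratr (t n) : R) @[n --> \oo] --> s ->
  v (t n) @[n --> \oo] --> right_limit v s.
Proof.
move=> hv st ts; apply/cvgrPdist_lt => e e0.
have hi := right_limit_has_inf s hv.
have [_ [q /= sq <-] qe] := inf_adherent e0 hi.
have : \forall n \near \oo, ratr (t n) < ratr q :> R.
  by have := cvgr_lt s ts (ratr q) sq; exact.
apply: filterS => n tq.
have h1 : right_limit v s <= v (t n) by apply: ge_inf; [exact: hi.2|exists (t n) => //=; exact: st].
have h2 : v (t n) <= v q by apply: hv; rewrite -(ler_rat R) ltW.
rewrite ler0_norm ?subr_le0// opprB ltrBlDr addrC.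
exact: le_lt_trans h2 qe.
Qed.

Lemma right_limit_nondecreasing v : {homo v : x y / x <= y} ->
  nondecreasing (right_limit v).
Proof.
move=> hv s s' ss'; apply: lb_le_inf; first exact: (right_limit_has_inf s' hv).1.
move=> _ [t /= s't <-]; apply: ge_inf; first exact: (right_limit_has_inf s hv).2.
by exists t => //=; exact: le_lt_trans ss' s't.
Qed.

Lemma right_limit_right_continuous v : {homo v : x y / x <= y} ->
  right_continuous (right_limit v).
Proof.
move=> hv s; apply/cvgrPdist_lt => e e0.
have hi := right_limit_has_inf s hv.
have [_ [q /= sq <-] qe] := inf_adherent e0 hi.
have : \forall x \near s^'+, s < x < ratr q.
  near=> x; apply/andP; split; near: x; [exact: nbhs_right_gt|exact: nbhs_right_lt].
apply: filterS => x /andP[sx xq].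
have h1 : right_limit v s <= right_limit v x by apply: right_limit_nondecreasing => //; exact: ltW.
have h2 : right_limit v x <= v q.
  by apply: ge_inf; [exact: (right_limit_has_inf x hv).2|exists q].
rewrite ler0_norm ?subr_le0// opprB ltrBlDr addrC.
exact: le_lt_trans h2 qe.
Unshelve. all: by end_near. Qed.

Definition right_cumulative v (hv : {homo v : x y / x <= y}) : cumulative R R :=
  HB.pack (right_limit v) (isCumulative.Build R _ R (right_limit v)
    (right_limit_nondecreasing hv) (right_limit_right_continuous hv)).

End right_limit.

(** * Bounded variation on the rationals and Lebesgue-Stieltjes measures *)

Section variation.
Context {R : realType}.
Implicit Types (y : rat -> R) (x t : rat) (s : seq rat).

Fixpoint variation_along y x s : R :=
  if s is z :: s' then `|y z - y x| + variation_along y z s' else 0.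

Definition bounded_variation_rat y : Prop := exists M : R, forall x s,
  path <=%R x s -> variation_along y x s <= M.

(** Chains may start anywhere to the left of [t], so this is the variation over []-oo, t]]. All
    chains end at [t], so that they can be prolonged to any later point. *)
Definition variation y t : R := sup [set variation_along y p.1 (rcons p.2 t) |
  p in [set p : rat * seq rat | path <=%R p.1 (rcons p.2 t)]].

Lemma variation_along_rcons y x s t :
  variation_along y x (rcons s t) = variation_along y x s + `|y t - y (last x s)|.
Proof. by elim: s x => [|z s ih] x /=; rewrite ?addr0 ?add0r// ih addrA. Qed.

Lemma variation_has_sup y t : bounded_variation_rat y ->
  has_sup [set variation_along y p.1 (rcons p.2 t) |
    p in [set p : rat * seq rat | path <=%R p.1 (rcons p.2 t)]].
Proof.
move=> [M yM]; split; first by exists (variation_along y t [:: t]), (t, [::]) => //=; rewrite lexx.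
by exists M => _ [[x s] /= xs <-]; exact: yM.
Qed.

(* Both [variation y] and [variation y - y] are thus nondecreasing. *)
Lemma variation_le y t t' : bounded_variation_rat y -> t <= t' ->
  variation y t + `|y t' - y t| <= variation y t'.
Proof.
move=> by_ tt'; rewrite -lerBrDr; apply: ge_sup.
  exact: (variation_has_sup t by_).1.
move=> _ [[x s] /= xs <-]; rewrite lerBrDr.
apply: ub_le_sup; first exact: (variation_has_sup t' by_).2.
exists (x, rcons s t) => /=.
  by rewrite [X in is_true X]rcons_path xs last_rcons.
by rewrite [in LHS]variation_along_rcons last_rcons.
Qed.

Lemma variation_nondecreasing y : bounded_variation_rat y ->
  {homo variation y : s t / s <= t}.
Proof.
by move=> hy s t st; apply: le_trans (variation_le hy st); rewrite lerDl.
Qed.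

Lemma variationB_nondecreasing y : bounded_variation_rat y ->
  {homo (fun t => variation y t - y t) : s t / s <= t}.
Proof.
move=> hy s t st; have := variation_le hy st.
by have := ler_norm (y t - y s); lra.
Qed.

Lemma bounded_variation_diff (f g : rat -> R) (K : R) :
  {homo f : s t / s <= t} -> {homo g : s t / s <= t} ->
  (forall t, 0 <= f t <= K) -> (forall t, 0 <= g t <= K) ->
  bounded_variation_rat (fun t => f t - g t).
Proof.
move=> hf hg fK gK; exists (K + K) => x s xs.
apply: (@le_trans _ _ ((f (last x s) - f x) + (g (last x s) - g x))).
  elim: s x xs => [|z s ih] x /=; first by rewrite !subrr addr0.
  move=> /andP[xz zs]; have := ih _ zs; have := hf _ _ xz; have := hg _ _ xz.
  set a := last z s; set V := variation_along _ _ _ => h1 h2 h3.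
  have : `|f z - g z - (f x - g x)| <= (f z - f x) + (g z - g x).
    by rewrite ler_norml; apply/andP; split; lra.
  by lra.
have /andP[_ h1] := fK (last x s); have /andP[_ h2] := gK (last x s).
have /andP[h3 _] := fK x; have /andP[h4 _] := gK x.
by lra.
Qed.

Section measurability.
Context {d : measure_display} {T : measurableType d} (Y : rat -> T -> R).
Hypothesis mY : forall t, measurable_fun setT (Y t).

Lemma measurable_variation_along x s :
  measurable_fun setT (fun w => variation_along (Y ^~ w) x s).
Proof.
elim: s x => [|z s ih] x /=; first exact: measurable_cst.
apply: measurable_funD; last exact: ih.
by apply: measurableT_comp => //; exact: measurable_funB.
Qed.

(** Rational chains are countably many and the bound may be taken in [nat], so the condition is a
    countable union of countable intersections. *)
Lemma measurable_bounded_variation :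
  measurable [set w | bounded_variation_rat (Y ^~ w)].
Proof.
rewrite (_ : [set _ | _] = \bigcup_(M : nat) \bigcap_(p : rat * seq rat)
  [set w | path <=%R p.1 p.2 -> variation_along (Y ^~ w) p.1 p.2 <= M%:R]).
  apply: bigcup_measurable => M _; rewrite -[X in measurable X]setCK.
  apply: measurableC; rewrite setC_bigcap.
  apply: countable_bigcupT_measurable; first exact: countableP.
  move=> [x s] /=; apply: measurableC.
  case: (path _ x s); last by rewrite (_ : [set _ | _] = setT)//; apply/seteqP; split.
  rewrite (_ : [set _ | _] = (fun w => variation_along (Y ^~ w) x s) @^-1` `]-oo, M%:R]).
    by rewrite -[X in measurable X]setTI; exact: measurable_variation_along.
  by apply/seteqP; split => w /=; rewrite in_itv /=; [exact|move=> h _].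
apply/seteqP; split => [w [M wM]|w [M _ wM]].
  exists (Num.trunc `|M|).+1 => // -[x s] _ /= xs.
  rewrite (le_trans (wM _ _ xs))// (le_trans (ler_norm M))// ltW//.
  exact: truncnS_gt.
by exists M%:R => x s xs; exact: (wM (x, s) I).
Qed.

Lemma measurable_variation t : (forall w, bounded_variation_rat (Y ^~ w)) ->
  measurable_fun setT (fun w => variation (Y ^~ w) t).
Proof.
move=> hY.
(* The default [0] belongs to the set of variations anyway, by the trivial chain from [t] to [t], so
   the supremum is unchanged. *)
pose u n w : R := if (unpickle n : option (rat * seq rat)) is Some p then
  if path <=%R p.1 (rcons p.2 t) then variation_along (Y ^~ w) p.1 (rcons p.2 t) else 0
  else 0.
have mu n : measurable_fun setT (u n).
  rewrite /u; case: unpickle => [[x s]|] /=; last exact: measurable_cst.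
  case: (path <=%R x (rcons s t)); last exact: measurable_cst.
  exact: measurable_variation_along.
have E w : range (u ^~ w) = [set variation_along (Y ^~ w) p.1 (rcons p.2 t) |
  p in [set p : rat * seq rat | path <=%R p.1 (rcons p.2 t)]].
  have z : [set variation_along (Y ^~ w) p.1 (rcons p.2 t) |
    p in [set p : rat * seq rat | path <=%R p.1 (rcons p.2 t)]] 0.
    by exists (t, [::]) => /=; rewrite ?lexx// subrr normr0 addr0.
  apply/seteqP; split=> [_ [n _ <-]|_ [p /= ps <-]].
    rewrite /u; case: unpickle => [p|]//; case: ifP => // ps.
    by exists p.
  by exists (pickle p) => //; rewrite /u pickleK ps.
have := measurable_fun_sups (D := setT) (h := u) 0 _ mu.
rewrite (_ : (fun w => sups _ 0) = fun w => variation (Y ^~ w) t); last first.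
  apply/funext => w; rewrite /variation -E /sups; congr sup.
  by apply/seteqP; split => [_ [n _ <-]|_ [n _ <-]]; exists n.
by apply => w _; rewrite E; exact: (variation_has_sup t (hY w)).2.
Qed.

End measurability.
End variation.

Lemma lebesgue_stieltjes_measure_itv (R : realType) (f : cumulative R R) (a b : R) :
  a <= b -> lebesgue_stieltjes_measure f `]a, b] = (f b - f a)%:E.
Proof.
move=> ab; rewrite /lebesgue_stieltjes_measure /measure_extension.
rewrite measurable_mu_extE /=; last exact: is_ocitv.
exact: wlength_itv_bnd.
Qed.

Lemma measurable_measure_family d d' (T : measurableType d) (S : measurableType d')
    (R : realType) (mu : T -> {measure set S -> \bar R}) (G : set (set S)) :
  measurable = <<s G >> -> setI_closed G ->
  (forall w, (mu w setT < +oo)%E) ->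
  measurable_fun setT (fun w => fine (mu w setT)) ->
  (forall A, G A -> measurable_fun setT (fun w => fine (mu w A))) ->
  forall A, measurable A -> measurable_fun setT (fun w => fine (mu w A)).
Proof.
move=> mG GI muoo mT mA A; rewrite [X in X A -> _]mG.
have fin w B : measurable B -> mu w B \is a fin_num.
  move=> mB; rewrite ge0_fin_numE//; apply: le_lt_trans (muoo w).
  by apply: le_measure => //; rewrite inE.
apply: (@dynkin_induction _ _ G (fun A => measurable_fun setT (fun w => fine (mu w A))) mG GI) => // [B mB mmB|F mF tF mmF].
- rewrite (_ : (fun w => _) = fun w => fine (mu w setT) - fine (mu w B)).
    exact: measurable_funB.
  apply/funext => w; rewrite -setTD measureD ?setTI//; last by rewrite -ge0_fin_numE// fin.
  by rewrite fineB// fin.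
- apply: (@measurable_fun_cvg _ _ _ _ (fun n w => \sum_(k < n) fine (mu w (F k)))).
    by move=> n; apply: measurable_sum => k; exact: mmF.
  move=> w _; have := @measure_semi_sigma_additive _ _ _ (mu w) F mF tF (bigcupT_measurable _ mF).
  rewrite -(fineK (fin w _ (bigcupT_measurable _ mF))) => /fine_cvgP[_].
  apply: cvg_trans; apply: near_eq_cvg; apply: nearW => n /=.
  rewrite -(big_mkord xpredT (fun k => fine (mu w (F k)))) sum_fine// => k _.
  exact: fin.
Qed.

Definition ray (R : realType) (s : R) : set (measurableTypeR R) := `]-oo, s]%classic.

Lemma cumulative_interval (R : realType) (k : {measure set (measurableTypeR R) -> \bar R}) (a b : R) :
  (k setT < +oo)%E -> a <= b ->
  fine (k `]a, b]%classic) = fine (k (ray b)) - fine (k (ray a)).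
Proof.
move=> koo ab; have fin (B : set R) : measurable B -> k B \is a fin_num.
  move=> mB; rewrite ge0_fin_numE//; apply: le_lt_trans koo.
  by apply: le_measure => //; rewrite inE.
have -> : ray b = ray a `|` `]a, b]%classic.
  by rewrite -itv_bndbnd_setU// bnd_simp.
rewrite measureU//; last 2 first.
- exact: measurable_itv.
- apply/seteqP; split => // x [] /=; rewrite /ray /= !in_itv /= => h /andP[h' _].
  by move: h'; rewrite ltNge h.
by rewrite fineD ?fin//; [rewrite addrAC subrr add0r|exact: measurable_itv].
Qed.

Lemma cvg_cumulative (R : realType) (k : {measure set (measurableTypeR R) -> \bar R})
    (s : R) (t : nat -> R) : (k setT < +oo)%E ->
  (forall n, s < t n) -> (forall n, t n.+1 <= t n) -> t n @[n --> \oo] --> s ->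
  fine (k (ray (t n))) @[n --> \oo] --> fine (k (ray s)).
Proof.
move=> koo st tt ts; have fin (B : set R) : measurable B -> k B \is a fin_num.
  move=> mB; rewrite ge0_fin_numE//; apply: le_lt_trans koo.
  by apply: le_measure => //; rewrite inE.
have E : ray s = \bigcap_n ray (t n).
  apply/seteqP; split => [x /= xs n _|x xt].
    by move: xs; rewrite /ray /= !in_itv /= => /le_trans; apply; exact: ltW.
  rewrite /ray /= in_itv /= leNgt; apply/negP => sx.
  have [n _ /(_ n (leqnn _)) /=] := cvgr_lt s ts x sx.
  by rewrite ltNge; have := xt n I; rewrite /ray /= in_itv /= => ->.
have mI (r : R) : measurable (ray r) by exact: measurable_itv.
have : k (ray (t n)) @[n --> \oo] --> k (ray s).
  rewrite E; apply: nonincreasing_cvg_mu => //.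
  - by rewrite -ge0_fin_numE//; exact: fin (mI _).
  - by rewrite -E; exact: mI.
  - apply/nonincreasing_seqP => n; apply/subsetPset => x; rewrite /ray /= !in_itv /=.
    by move=> /le_trans; apply.
by rewrite -(fineK (fin _ (mI s))) => /fine_cvgP[_].
Qed.

(** As in [diff_integral_eq], moving terms across gives two positive measures, to which uniqueness
    on a class stable under intersection applies. *)
Lemma measure_diff_unique d (T : measurableType d) (R : realType)
    (m1 m2 k1 k2 : {measure set T -> \bar R}) (G : set (set T)) (g : (set T)^nat) :
  measurable = <<s G >> -> setI_closed G -> (forall i, G (g i)) ->
  \bigcup_k g k = setT ->
  (m1 setT < +oo)%E -> (m2 setT < +oo)%E -> (k1 setT < +oo)%E -> (k2 setT < +oo)%E ->
  (forall A, G A -> fine (m1 A) - fine (m2 A) = fine (k1 A) - fine (k2 A)) ->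
  forall A, measurable A -> fine (m1 A) - fine (m2 A) = fine (k1 A) - fine (k2 A).
Proof.
move=> mG GI Gg gT m1oo m2oo k1oo k2oo E A mA.
have fin (k : {measure set T -> \bar R}) (B : set T) : (k setT < +oo)%E ->
    measurable B -> k B \is a fin_num.
  move=> koo mB; rewrite ge0_fin_numE//; apply: le_lt_trans koo.
  by apply: le_measure => //; rewrite inE.
have mGB B : G B -> measurable B by rewrite mG => GB; exact: sub_sigma_algebra.
have : measure_add m1 k2 A = measure_add m2 k1 A.
  apply: (@measure_unique _ _ _ _ _ mG GI Gg gT (measure_add m1 k2) (measure_add m2 k1)) => // [B GB|n].
    transitivity (m1 B + k2 B)%E; first exact: measure_addE.
    transitivity (m2 B + k1 B)%E; last by apply/esym; exact: measure_addE.
    rewrite -(fineK (fin m1 _ m1oo (mGB _ GB))) -(fineK (fin m2 _ m2oo (mGB _ GB))).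
    rewrite -(fineK (fin k1 _ k1oo (mGB _ GB))) -(fineK (fin k2 _ k2oo (mGB _ GB))).
    by rewrite -!EFinD; congr (_%:E); have := E _ GB; lra.
  apply: (@le_lt_trans _ _ (m1 (g n) + k2 (g n))%E); last first.
    by rewrite lte_add_pinfty// -ge0_fin_numE// fin//; exact: mGB.
  by rewrite le_eqVlt; apply/orP; left; apply/eqP; exact: measure_addE.
rewrite !measure_addE -(fineK (fin m1 _ m1oo mA)) -(fineK (fin m2 _ m2oo mA)).
rewrite -(fineK (fin k1 _ k1oo mA)) -(fineK (fin k2 _ k2oo mA)) -!EFinD => -[].
by rewrite !fineK ?fin//; lra.
Qed.

(** The measures exist for every [w] and depend measurably on it, whatever [Y] is; the last clause
    identifies them where [Y] is a difference of distribution functions. The two are separated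
    because in the application the latter holds only almost surely. The restriction to []-1, 1]]
    makes the Lebesgue-Stieltjes measures finite, and this interval contains the values of the
    encoding, [0] included. *)
Lemma signed_measure_of_cdf d (T : measurableType d) (R : realType)
    (Y : rat -> T -> R) : (forall t, measurable_fun setT (Y t)) ->
  exists mu nu : T -> {measure set (measurableTypeR R) -> \bar R},
  [/\ forall w, (mu w setT < +oo)%E /\ (nu w setT < +oo)%E,
      forall A, measurable A -> measurable_fun setT (fun w => fine (mu w A)) /\
        measurable_fun setT (fun w => fine (nu w A)) &
      forall w (k1 k2 : {measure set (measurableTypeR R) -> \bar R}),
        (k1 setT < +oo)%E -> (k2 setT < +oo)%E ->
        (forall t, Y t w = fine (k1 (ray (ratr t))) - fine (k2 (ray (ratr t)))) ->
        forall A, measurable A -> fine (mu w A) - fine (nu w A) =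
          fine (k1 (A `&` `]-1, 1]%classic)) - fine (k2 (A `&` `]-1, 1]%classic))].
Proof.
move=> mY.
pose D := [set w | bounded_variation_rat (Y ^~ w)].
have mD : measurable D := measurable_bounded_variation mY.
(* off [D] the value is irrelevant, since [Y] is then not a difference of
   distribution functions *)
pose Z t w := Y t w * \1_D w.
have mZ t : measurable_fun setT (Z t).
  by apply: measurable_funM => //; exact: measurable_indic.
have bZ w : bounded_variation_rat (Z ^~ w).
  have [[M yM]|wD] := pselect (D w).
    exists M => x s xs; rewrite (_ : Z ^~ w = Y ^~ w) ?yM//.
    by apply/funext => t; rewrite /Z indicE mem_set ?mulr1//; exists M.
  exists 0 => x s _; rewrite (_ : Z ^~ w = cst 0); last first.
    by apply/funext => t; rewrite /Z indicE memNset ?mulr0.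
  by elim: s x => [|z s ih] x //=; rewrite subrr normr0 add0r.
pose F w := right_cumulative (variation_nondecreasing (bZ w)).
pose G w := right_cumulative (variationB_nondecreasing (bZ w)).
have mI : measurable (`]-1, 1]%classic : set (measurableTypeR R)) by exact: measurable_itv.
pose mu w : {measure set (measurableTypeR R) -> \bar R} := mrestr (lebesgue_stieltjes_measure (F w)) mI.
pose nu w : {measure set (measurableTypeR R) -> \bar R} := mrestr (lebesgue_stieltjes_measure (G w)) mI.
have mvar t : measurable_fun setT (fun w => variation (Z ^~ w) t).
  exact: measurable_variation.
have mrl (v : T -> rat -> R) s : (forall w, {homo v w : x y / x <= y}) ->
    (forall t, measurable_fun setT (v ^~ t)) ->
    measurable_fun setT (fun w => right_limit (v w) s).
  move=> hv mv; have [t [st _ ts]] := rat_seq_right s.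
  apply: (measurable_fun_cvg (fun n => mv (t n))) => w _.
  exact: right_limit_cvg.
have mF s : measurable_fun setT (fun w => F w s).
  by apply: (mrl (fun w => variation (Z ^~ w))) => // w; exact: variation_nondecreasing.
have mG s : measurable_fun setT (fun w => G w s).
  apply: (mrl (fun w t => variation (Z ^~ w) t - Z t w)) => [w|t].
    exact: variationB_nondecreasing.
  exact: measurable_funB.
have oc1 (A : set (measurableTypeR R)) : ocitv A -> exists ab : R * R, ab.1 <= ab.2 /\ A `&` `]-1, 1]%classic = `]ab.1, ab.2]%classic.
  move=> oA; have := ocitvI oA (is_ocitv (-1) 1) => /ocitvP[->|[[a b] /= ab ->]].
    by exists (0, 0); split => //=; rewrite set_itv_ge// bnd_simp ltxx.
  by exists (a, b); rewrite ltW.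
exists mu, nu; split.
- move=> w; rewrite /mu /nu /= /mrestr setTI.
  by rewrite !lebesgue_stieltjes_measure_itv ?ltry//; lra.
- have H (H : T -> cumulative R R) A : (forall s, measurable_fun setT (fun w => H w s)) -> measurable A ->
    measurable_fun setT (fun w => fine (mrestr (lebesgue_stieltjes_measure (H w)) mI A)).
    move=> mH; apply: (@measurable_measure_family _ _ _ _ _
      (fun w => mrestr (lebesgue_stieltjes_measure (H w)) mI : {measure set (measurableTypeR R) -> \bar R}) (@ocitv R)) => //.
    + exact: ocitvI.
    + by move=> w; rewrite /= /mrestr setTI lebesgue_stieltjes_measure_itv ?ltry//; lra.
    + rewrite (_ : (fun w => _) = fun w => H w 1 - H w (-1)); first exact: measurable_funB.
      apply/funext => w; rewrite /= /mrestr setTI.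
      by rewrite lebesgue_stieltjes_measure_itv//; lra.
    + move=> B /oc1[[a b] [/= ab BE]]; rewrite /= /mrestr BE.
      rewrite (_ : (fun w => _) = fun w => H w b - H w a); first exact: measurable_funB.
      by apply/funext => w; rewrite lebesgue_stieltjes_measure_itv.
  by move=> A mA; split; exact: H.
- move=> w k1 k2 k1oo k2oo YE.
  (* A difference of bounded nondecreasing functions has bounded variation, so that [Z] agrees with
     [Y] at this [w]. *)
  have wD : D w.
    rewrite /D /=.
    have K (k : {measure set (measurableTypeR R) -> \bar R}) : (k setT < +oo)%E ->
        {homo (fun t => fine (k (ray (ratr t)))) : s t / (s <= t :> rat)%R >-> s <= t} /\
        forall t : rat, 0 <= fine (k (ray (ratr t))) <= fine (k setT).
      move=> koo; have fin (B : set (measurableTypeR R)) : measurable B -> k B \is a fin_num.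
        move=> mB; rewrite ge0_fin_numE//; apply: le_lt_trans koo.
        by apply: le_measure => //; rewrite inE.
      have mr r : measurable (@ray R r) by exact: measurable_itv.
      split=> [t t' tt'|t]; last first.
        apply/andP; split; first exact: fine_ge0.
        apply: fine_le; [exact: fin (mr _)|exact: fin|].
        by apply: le_measure => //; rewrite inE//; exact: mr.
      apply: fine_le; [exact: fin (mr _)|exact: fin (mr _)|].
      apply: le_measure; rewrite ?inE; [exact: mr|exact: mr|].
      by move=> x; rewrite /ray /= !in_itv /= => /le_trans; apply; rewrite ler_rat.
    have [h1 h2] := K _ k1oo; have [h3 h4] := K _ k2oo.
    rewrite (_ : Y ^~ w = fun t => fine (k1 (ray (ratr t))) - fine (k2 (ray (ratr t)))).
      have h5 : 0 <= fine (k1 setT) by exact: fine_ge0.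
      have h6 : 0 <= fine (k2 setT) by exact: fine_ge0.
      apply: (@bounded_variation_diff _ _ _ (fine (k1 setT) + fine (k2 setT))) => // t.
        by have /andP[-> h] := h2 t; lra.
      by have /andP[-> h] := h4 t; lra.
    by apply/funext => t; exact: YE.
  (* Along rationals decreasing to [s] the variation cancels in [F - G] and leaves [Y], which tends
     to the difference of the right-continuous distribution functions. *)
  have FG s : F w s - G w s = fine (k1 (ray s)) - fine (k2 (ray s)).
    have [t [st tt ts]] := rat_seq_right s.
    have c1 : variation (Z ^~ w) (t n) - (variation (Z ^~ w) (t n) - Z (t n) w) @[n --> \oo] --> F w s - G w s.
      apply: cvgB; apply: right_limit_cvg => //.
        exact: variation_nondecreasing.
      exact: variationB_nondecreasing.
    apply: (cvg_unique _ c1) => //.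
    have c2 : fine (k1 (ray (ratr (t n)))) - fine (k2 (ray (ratr (t n)))) @[n --> \oo] -->
        fine (k1 (ray s)) - fine (k2 (ray s)).
      by apply: cvgB; apply: cvg_cumulative => // n; rewrite ler_rat; exact: tt.
    apply: cvg_trans c2; apply: near_eq_cvg; apply: nearW => n.
    by rewrite /= subKr /Z indicE mem_set// mulr1 YE.
  have := @measure_diff_unique _ _ R (mu w) (nu w) (mrestr k1 mI) (mrestr k2 mI)
    (@ocitv R) (fun n => `]-n%:R, n%:R]%classic).
  have le1 (k : {measure set (measurableTypeR R) -> \bar R}) : (k setT < +oo)%E ->
      (mrestr k mI setT < +oo)%E.
    rewrite /mrestr; apply: le_lt_trans; apply: le_measure => //; rewrite inE//.
    exact: measurableI.
  apply => //.
  + exact: ocitvI.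
  + by move=> n; exact: is_ocitv.
  + apply/seteqP; split => // x _; exists (Num.trunc `|x|).+1 => //=.
    rewrite in_itv /=; have := truncnS_gt `|x|; rewrite ltr_norml => /andP[-> /ltW].
    by [].
  + by rewrite /mu /= /mrestr setTI lebesgue_stieltjes_measure_itv ?ltry//; lra.
  + by rewrite /nu /= /mrestr setTI lebesgue_stieltjes_measure_itv ?ltry//; lra.
  + exact: le1.
  + exact: le1.
  + move=> B /oc1[[a b] [/= ab BE]]; rewrite /mu /nu /= /mrestr BE.
    rewrite !lebesgue_stieltjes_measure_itv//=.
    rewrite !cumulative_interval//.
    by have := FG a; have := FG b; rewrite /F /G /=; lra.
Qed.

Lemma image_measure d1 d2 (T1 : measurableType d1) (T2 : measurableType d2)
    (R : realType) (m : {measure set T1 -> \bar R}) (f : T1 -> T2) :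
  measurable_fun setT f ->
  exists k : {measure set T2 -> \bar R}, forall A, k A = m (f @^-1` A).
Proof.
by move=> mf; unshelve eexists (pushforward m f : {measure set T2 -> \bar R}).
Qed.

(** * From the spectral hypotheses to maximal rigidity *)

Section maximal_rigidity.
Context {R : realType} {d : nat} {disp : measure_display}
  {Omega : measurableType disp} (P : probability Omega R)
  (Phi : {mfun Omega >-> cmeasure R d}).
Lemma small_spectrum_of_q_uniform (p : nat) :
  q_uniform P Phi (2 * p + d)%:R -> small_spectrum P Phi (p + d).
Proof.
move=> [beta hb] /eqO_exP[K K0] /nbhs_ballP[e /= e0 He].
(* Half the radius, as the neighbourhood controls only radii strictly below [e]. *)
have e2 : 0 < e / 2 by rewrite divr_gt0.
exists beta, K, (e / 2); split => //; first exact: ltW.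
move=> x /andP[x0 xe].
have : `|x ^- d * fine (beta (eball x))| <= K * `|x `^ (2 * p + d)%:R|.
  apply: He => //; rewrite /ball /= sub0r normrN gtr0_norm//.
  by apply: le_lt_trans xe _; rewrite ltr_pdivrMr// ltr_pMr// ltr1n.
rewrite powR_mulrn ?(ltW x0)// [leRHS](_ : _ = K * x ^+ (2 * p + d)); last first.
  by rewrite ger0_norm// exprn_ge0// ltW.
have b0 : 0 <= fine (beta (eball x)) by exact: fine_ge0.
have xd : 0 < x ^+ d by rewrite exprn_gt0.
rewrite ger0_norm; last by rewrite mulr_ge0// invr_ge0 ltW.
rewrite mulrC ler_pdivrMr// => /le_trans; apply.
rewrite -mulrA -exprD -exprM.
by rewrite (_ : (2 * p + d + d = (p + d) * 2)%N)//; lia.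
Qed.

Lemma small_spectrum_of_infty_uniform (D : nat) :
  infty_uniform P Phi -> small_spectrum P Phi D.
Proof.
move=> [beta hb [e e0 be]]; exists beta, 0, e; split => // x /andP[x0 xe].
suff -> : beta (eball x) = 0%E by rewrite mul0r.
apply/eqP; rewrite eq_le measure_ge0 andbT -be.
by apply: le_measure; rewrite ?inE; [exact: measurable_eball..|exact: eball_le].
Qed.

Variables (theta : 'rV[R]_d -> Omega -> Omega).
Hypotheses (htheta : measurable_flow P theta) (hinv : invariant_cm Phi theta)
  (hsq : locally_abs_square_integrable P Phi) (hd : (0 < d)%N).

(** The random measure is built on the line, from versions of the masses of rational rays, and
    carried back by [dec]. Where the versions are the true values it is the restriction of [Phi] to
    [B], because [dec] inverts [enc]. *)
Lemma maximally_rigid_of_small_spectrum :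
  (forall D, small_spectrum P Phi D) -> maximally_rigid P Phi.
Proof.
move=> hs B bB.
pose h w := Defs.crestr (measurableC bB.1) (Phi w).
have det b A : measurable A -> determined P h (fun w => cpart b (Phi w (A `&` B))).
  move=> mA; apply: (determined_cmval bB) => // l.
  exact: (moment_determined htheta hinv hsq hd bB b (hs (size l + d)%N) (leqnn _)).
have [enc [dec [menc mdec encK enc01]]] := rV_embedding R d.
have mpre S : measurable S -> measurable (enc @^-1` S).
  by move=> mS; rewrite -[X in measurable X]setTI; exact: menc.
have mpre' A : measurable A -> measurable (dec @^-1` A).
  by move=> mA; rewrite -[X in measurable X]setTI; exact: mdec.
have mray r : measurable (@ray R r) by exact: measurable_itv.
(* One version for each part and each rational ray: a countable family, so that almost surely all of
   them are correct at once. *)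
have [Y /all_and2[mY YE]] :=
  choice (fun bt : bool * rat => det bt.1 _ (mpre _ (mray (ratr bt.2)))).
(* [Omega] with the sigma-algebra of the restriction to the complement of [B]. Working over it makes
   the constructed measures measurable with respect to that restriction. *)
pose G := g_sigma_algebra_preimageType h.
have [mu /= muP] := choice (fun b => @signed_measure_of_cdf _ G R
  (fun t => Y (b, t)) (fun t => mY (b, t))).
have [nu {}muP] := choice muP.
pose val w A : R[i] := if `[< bounded_borel A >] then
  Complex (fine (mu true w (dec @^-1` A)) - fine (nu true w (dec @^-1` A)))
          (fine (mu false w (dec @^-1` A)) - fine (nu false w (dec @^-1` A))) else 0.
have val_decomp w : exists mu1 mu2 mu3 mu4, decomposition (val w) mu1 mu2 mu3 mu4.
  have [k1 k1E] := image_measure (mu true w) mdec.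
  have [k2 k2E] := image_measure (nu true w) mdec.
  have [k3 k3E] := image_measure (mu false w) mdec.
  have [k4 k4E] := image_measure (nu false w) mdec.
  have lf (k : {measure set (measurableTypeR R) -> \bar R}) (k' : {measure set 'rV[R]_d -> \bar R}) :
      (k setT < +oo)%E -> (forall A, k' A = k (dec @^-1` A)) -> locally_finite k'.
    move=> koo kE A [mA _]; rewrite kE; apply: le_lt_trans koo.
    by apply: le_measure; rewrite ?inE//; exact: mpre'.
  have [/(_ w)[oo1 oo2] _ _] := muP true; have [/(_ w)[oo3 oo4] _ _] := muP false.
  exists k1, k2, k3, k4; split; [exact: lf k1E|exact: lf k2E|exact: lf k3E|exact: lf k4E|].
  by move=> A bA; rewrite /val asboolT// k1E k2E k3E k4E.
have val_out w A : ~ bounded_borel A -> val w A = 0 by move=> nA; rewrite /val asboolF.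
pose Psi w := CMeasure (val_decomp w) (val_out w).
exists Psi; split.
  apply: (measurability (@cmeasure_eval R d)) => // _ [_ [A bA [S mS <-]] <-].
  rewrite !setTI -comp_preimage -[X in measurable X]setTI.
  suff : measurable_fun setT ((fun w => Psi w A) : G -> R[i]) by exact.
  apply: measurable_complex => b; rewrite (_ : (fun w => _) =
      fun w => fine (mu b w (dec @^-1` A)) - fine (nu b w (dec @^-1` A))).
    have [_ H _] := muP b; have [m1 m2] := H _ (mpre' _ bA.1).
    exact: measurable_funB.
  by apply/funext => w; rewrite /= /val asboolT//; case: b.
have : {ae P, forall w, forall bt : bool * rat,
    cpart bt.1 (Phi w (enc @^-1` ray (ratr bt.2) `&` B)) = Y bt w}.
  exact: ae_forall_countable.
apply: filterS => w YEw; apply: cmeasure_eq => A bA; rewrite crestrE//.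
apply: cpart_eq => b; rewrite /= /val asboolT//.
transitivity (fine (mu b w (dec @^-1` A)) - fine (nu b w (dec @^-1` A))); last by case: b.
have [m [n [lm ln mnE _]]] := rintegral_decomp b (Phi w).
(* The image under [enc] of this part of [Phi] on [B], as a difference of two finite measures; on
   the almost sure event its distribution function at the rationals is [Y]. *)
have [k1 k1E] := @image_measure _ _ _ (measurableTypeR R) R (mrestr m bB.1) enc menc.
have [k2 k2E] := @image_measure _ _ _ (measurableTypeR R) R (mrestr n bB.1) enc menc.
have bI C : measurable C -> bounded_borel (C `&` B).
  move=> mC; apply: (bounded_borelS bB); last by move=> x [].
  by apply: measurableI => //; exact: bB.1.
have [_ _ /(_ w k1 k2)] := muP b; move=> ->.
- rewrite k1E k2E /mrestr /= preimage_setI.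
  have -> : enc @^-1` (dec @^-1` A) = A.
    by apply/seteqP; split => x /=; rewrite encK.
  have -> : enc @^-1` `]-1, 1] = setT.
    apply/seteqP; split => // x _ /=; rewrite in_itv /=.
    have /andP[h0 h1] := enc01 x; apply/andP; split => //; lra.
  by rewrite setIT mnE//; apply: bI bA.1.
- by rewrite k1E /mrestr /= preimage_setT; apply: lm; exact: bI.
- by rewrite k2E /mrestr /= preimage_setT; apply: ln; exact: bI.
- move=> t; rewrite -(YEw (b, t)) /= mnE ?k1E ?k2E//.
  by apply: bI; exact: (mpre _ (mray _)).
- exact: mpre' bA.1.
Qed.

End maximal_rigidity.

Theorem proposition3p17 (R : realType) (d : nat) (hd : (0 < d)%N)
    (disp : measure_display) (Omega : measurableType disp)
    (P : probability Omega R) (theta : 'rV[R]_d -> Omega -> Omega)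
    (htheta : measurable_flow P theta)
    (p : nat) (Phi : {mfun Omega >-> cmeasure R d})
    (hinv : invariant_cm Phi theta)
    (hsq : locally_abs_square_integrable P Phi) :
  (q_uniform P Phi (2 * p + d)%:R -> rigid P Phi p) /\
  ((forall q : R, - d%:R <= q -> q_uniform P Phi q) -> maximally_rigid P Phi) /\
  (infty_uniform P Phi -> maximally_rigid P Phi).
Proof.
split=> [hq|].
  apply: (rigid_of_small_spectrum htheta hinv hsq hd).
  exact: small_spectrum_of_q_uniform.
split=> hq; apply: (maximally_rigid_of_small_spectrum htheta hinv hsq hd) => D.
  (* [D] is enlarged to [D + d], the exponent that belongs to uniformity of order [2D + d]. *)
  apply: (small_spectrumS (leq_addr d D)); apply: small_spectrum_of_q_uniform.
  by apply: hq; rewrite (le_trans _ (ler0n _ _))// oppr_le0.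
exact: small_spectrum_of_infty_uniform.
Qed.
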